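(* Let $W$ be an irreducible finite Coxeter group. Up to conjugacy in $W$ and up to interchanging the two members of a pair, the parabolic concepts $P\perp Q$ of $W$ are, depending on the type of $W$, as follows. Type $A_n$: $A_n\perp\emptyset$, and $A_m\perp A_l$ where $n=m+l+1$, $m,l>0$. Type $B_n$: $B_mA_1^k\perp B_lA_1^k$ where $n=m+l+2k$, $m,l,k\ge0$. Type $D_n$: $D_mA_1^k\perp D_lA_1^k$ where $n=m+l+2k$, $m,l\ne1$, $k\ge0$; and $A_1^k\perp A_1^k$ if $n=2k+1$; $(A_1^k)^+\perp(A_1^k)^+$ and $(A_1^k)^-\perp(A_1^k)^-$ if $n=2k$ and $k$ is even; $(A_1^k)^+\perp(A_1^k)^-$ if $n=2k$ and $k$ is odd. Type $I_2(m)$: $I_2(m)\perp\emptyset$; and, if $m$ is even, $A_1'\perp A_1'$ and $A_1''\perp A_1''$. Type $E_6$: $E_6\perp\emptyset$, $A_5\perp A_1$, $A_2^2\perp A_2$, $A_3\perp A_1^2$. Type $E_7$: $E_7\perp\emptyset$, $D_6\perp A_1$, $A_5'\perp A_2$, $D_4A_1\perp A_1^2$, $(A_3A_1)'\perp A_3$, $D_4\perp(A_1^3)'$, $A_1^4\perp(A_1^3)''$. Type $E_8$: $E_8\perp\emptyset$, $E_7\perp A_1$, $E_6\perp A_2$, $D_6\perp A_1^2$, $D_5\perp A_3$, $A_5\perp A_2A_1$, $D_4A_1\perp A_1^3$, $D_4\perp D_4$, $A_4\perp A_4$, $A_3A_1\perp A_3A_1$, $A_2^2\perp A_2^2$, $A_1^4\perp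 A_1^4$. Type $F_4$: $F_4\perp\emptyset$, $B_3\perp\tilde A_1$, $\tilde B_3\perp A_1$, $A_2\perp\tilde A_2$, $A_1^2\perp A_1^2$, $B_2\perp B_2$. Type $H_3$: $H_3\perp\emptyset$, $A_1^2\perp A_1$. Type $H_4$: $H_4\perp\emptyset$, $H_3\perp A_1$, $A_1^2\perp A_1^2$, $A_2\perp A_2$, $I_2(5)\perp I_2(5)$.
   Context: $W$ is a finite real reflection group with set of reflections $T$. A parabolic subgroup is the pointwise stabilizer in $W$ of a subspace of the reflection representation. For $s,t\in T$ write $s\perp t$ if their reflecting hyperplanes are orthogonal (equivalently $st=ts$, $s\neq t$). The orthogonal complement of a reflection subgroup $U$ of $W$ is $U^\dagger=\langle t\in T:t\perp s\text{ for all }s\in U\cap T\rangle$, which is a parabolic subgroup. A parabolic concept, written $P\perp Q$, is a pair of parabolic subgroups with $Q=P^\dagger$ and $P=Q^\dagger$. In the lists, each symbol stands for a conjugacy class of parabolic subgroups of the given Coxeter type, $\emptyset$ for the trivial subgroup; types are written as products, e.g. $A_1^k$ is the type of a direct product of $k$ groups of type $A_1$. Conventions. $A_0,B_0,D_0$ are trivial types; $B_1$ has the same Coxeter type as $A_1$ and $D_2$ as $A_1\times A_1$. In type $B_n$ (signed permutations of $\{1,\dots,n\}$), the class $B_mA_1^k$ is that of $W(B_m)$ on $m$ of the points times $k$ groups $\mathfrak S_2$ permuting (without signs) pairs among the remaining points, so $B_1$ (generated by a sign change) is distinguished from $A_1$. In type $D_n$, $n\ge4$ (signed permutations with an even number of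 sign changes), $D_mA_1^k$ is the class of $W(D_m)$ on $m$ of the points times $k$ groups $\mathfrak S_2$ on pairs of remaining points. For $n=2k$ the subgroups $\mathfrak S_2^k$ ($k$ disjoint pairs, no $D$-factor) and their images under conjugation by a single sign change form two $W$-classes, denoted $(A_1^k)^+$ and $(A_1^k)^-$; the pairs listed for $n=2k$ specify the concepts $D_mA_1^k\perp D_lA_1^k$ with $m=l=0$. In type $I_2(m)$, $m\ge5$, for $m$ even $A_1'$ and $A_1''$ are the two classes of subgroups generated by a reflection. In type $E_7$, with simple reflections $s_1,\dots,s_7$ in Bourbaki numbering, $(A_1^3)'$, $(A_3A_1)'$, $A_5'$ are the classes of the standard parabolic subgroups generated by $\{s_2,s_5,s_7\}$, $\{s_2,s_5,s_6,s_7\}$, $\{s_2,s_4,s_5,s_6,s_7\}$, respectively, and a double prime denotes the other class of parabolic subgroups of the same type. In type $F_4$, $A_1,A_2$ denote the classes of parabolic subgroups generated by reflections in long roots and $\tilde A_1,\tilde A_2$ by reflections in short roots; $B_3$ (resp. $\tilde B_3$) is the class of rank-3 parabolic subgroups of type $B_3$ containing a parabolic $A_2$ (resp. $\tilde A_2$).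
   Formalization: In type I_2(m), the pairs A_1' ⊥ A_1' and A_1'' ⊥ A_1'' are listed only when 4 divides m; for m ≡ 2 mod 4, where they do not occur (e.g. m = 6), the single pair A_1' ⊥ A_1'' replaces them. *)

(* Defs.v *)
From HB Require Import structures.
From mathcomp Require Import all_boot all_order all_algebra all_fingroup.
From mathcomp Require Import mxrepresentation.
From mathcomp Require Import boolp reals trigo.

Set Implicit Arguments.
Unset Strict Implicit.
Unset Printing Implicit Defensive.

Import GroupScope GRing.Theory.
Local Open Scope ring_scope.

(* A Coxeter diagram with nodes 1, ..., n is the pair of n and the list of its
   edges (i, j, m), where m >= 3 is the edge label m_ij. *)
Definition diagram := (nat * seq (nat * nat * nat))%type.

Definition cox_entry (D : diagram) (i j : nat) : nat :=
  if i == j then 1%N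
  else head 2%N [seq e.2 | e <- D.2 & (e.1 == (i, j)) || (e.1 == (j, i))].

Definition diagram_sum (D1 D2 : diagram) : diagram :=
  ((D1.1 + D2.1)%N,
   D1.2 ++ [seq ((D1.1 + e.1.1)%N, (D1.1 + e.1.2)%N, e.2) | e <- D2.2]).

Inductive cox_type :=
  | TA of nat | TB of nat | TD of nat | TE of nat | TF4 | TH of nat
  | TI of nat (* TI m is the dihedral type I_2(m), of rank 2 *).

Definition irr_cox_type (X : cox_type) : bool :=
  match X with
  | TA n => (0 < n)%N
  | TB n => (1 < n)%N
  | TD n => (3 < n)%N
  | TE n => n \in [:: 6; 7; 8]%N
  | TF4 => true
  | TH n => n \in [:: 3; 4]%N
  | TI m => (4 < m)%N
  end.

(* The k edges i -- i+1 -- ... -- i+k, all with label 3. *)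
Definition chain (i k : nat) : seq (nat * nat * nat) :=
  [seq (j, j.+1, 3%N) | j <- iota i k].

(* Bourbaki numbering of the nodes; nodes 1 and 2 of H_n carry the label 5. *)
Definition cox_diagram (X : cox_type) : diagram :=
  match X with
  | TA n => (n, chain 1 n.-1)
  | TB n => (n, rcons (chain 1 n.-2) (n.-1, n, 4%N))
  | TD n => (n, rcons (chain 1 n.-2) (n.-2, n, 3%N))
  | TE n => (n, [:: (1, 3, 3), (2, 4, 3) & chain 3 (n - 3)]%N)
  | TF4 => (4%N, [:: (1, 2, 3); (2, 3, 4); (3, 4, 3)]%N)
  | TH n => (n, (1, 2, 5)%N :: chain 2 n.-2)
  | TI m => (2%N, [:: (1, 2, m)]%N)
  end.

Definition cox_rank (X : cox_type) : nat := (cox_diagram X).1.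

(* The type X_1 x ... x X_r of a product; [::] is the trivial type. *)
Definition product_diagram (Xs : seq cox_type) : diagram :=
  foldr (fun X D => diagram_sum (cox_diagram X) D) (0%N, [::]) Xs.

Section Euclidean.
Variables (R : realType) (d : nat).

Definition dot (u v : 'rV[R]_d) : R := (u *m v^T) 0 0.

(* v *m reflmx a = v - 2 <v, a> / <a, a> a, for row vectors v. *)
Definition reflmx (a : 'rV[R]_d) : 'M[R]_d :=
  1%:M - (2 / dot a a) *: (a^T *m a).

Definition orthonormal (I : finType) (e : I -> 'rV[R]_d) : Prop :=
  forall i j, dot (e i) (e j) = (i == j)%:R.

End Euclidean.

Section ReflectionGroup.
Variables (R : realType) (gT : finGroupType) (W : {group gT}) (d : nat).
Variable rG : mx_representation R W d.

(* The set T of reflections of W, in the Euclidean space of row vectors. *)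
Definition reflections : {set gT} :=
  [set t in W | `[< exists2 a, a != 0 & rG t = reflmx a >]].

Definition reflection_group : Prop :=
  mx_faithful rG /\ W :=: <<reflections>>.

Definition parabolic (P : {set gT}) : Prop :=
  exists (m : nat) (U : 'M[R]_(m, d)), P = rstab rG U.

Definition perp (s t : gT) : Prop :=
  exists a b, [/\ a != 0, b != 0, rG s = reflmx a, rG t = reflmx b
                & dot a b = 0].

Definition dagger (U : {set gT}) : {set gT} :=
  <<[set t in reflections | [forall s in U :&: reflections, `[< perp t s >]]]>>.

Definition concept (P Q : {group gT}) : Prop :=
  [/\ parabolic P, parabolic Q, Q :=: dagger P & P :=: dagger Q].

Definition conjugate (P P' : {group gT}) : Prop :=
  exists2 w, w \in W & P' :=: P :^ w.

(* Conjugacy of pairs up to interchanging the members: one w conjugates both. *)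
Definition equiv_pair (P Q P' Q' : {group gT}) : Prop :=
  exists2 w, w \in W & (P' :=: P :^ w /\ Q' :=: Q :^ w)
                    \/ (P' :=: Q :^ w /\ Q' :=: P :^ w).

(* The s i are simple reflections generating P, with simple roots the unit
   vectors a i; the angles between the roots are pi - pi / m_ij (for i = j the
   equation says that a i has length 1). *)
Definition simple_system (D : diagram) (s : 'I_D.1 -> gT) (P : {set gT}) :=
  exists a : 'I_D.1 -> 'rV[R]_d,
  [/\ row_free (\matrix_i a i),
      forall i j, dot (a i) (a j) = - cos (pi / (cox_entry D i.+1 j.+1)%:R),
      forall i, s i \in W /\ rG (s i) = reflmx (a i)
    & P = <<[set s i | i : 'I_D.1]>>].

Definition has_type (Xs : seq cox_type) (P : {set gT}) : Prop :=
  exists s : 'I_(product_diagram Xs).1 -> gT, simple_system s P.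

Definition refls_in (roots : 'rV[R]_d -> Prop) : {set gT} :=
  [set t in W | `[< exists2 a, roots a & rG t = reflmx a >]].

Definition conj_of_gen (A : {set gT}) (P : {group gT}) : Prop :=
  exists2 w, w \in W & P :=: <<A>> :^ w.

Definition is_parabolic_class (C : {group gT} -> Prop) : Prop :=
  exists2 P0 : {group gT}, parabolic P0 & forall P, C P <-> conjugate P0 P.

Section Classes.
Variables (r : nat) (s : 'I_r -> gT).

(* Simple reflections selected by their node numbers, which start at 1. *)
Definition simples (J : seq nat) : {set gT} := [set s i | i : 'I_r & i.+1 \in J].

(* In types B_r and D_r, the coordinate vectors e_1, ..., e_r of the points
   1, ..., r on which W acts by signed permutations: s_i is the reflection in
   e_i - e_{i+1} for i < r, while s_r is the one in e_r (type B_r),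
   respectively in e_{r-1} + e_r (type D_r). *)
Definition frame_chain (e : 'I_r -> 'rV[R]_d) : Prop :=
  forall i j : 'I_r, j = i.+1 :> nat -> rG (s i) = reflmx (e i - e j).

Definition frameB (e : 'I_r -> 'rV[R]_d) : Prop :=
  [/\ orthonormal e, frame_chain e
    & forall i : 'I_r, i.+1 = r -> rG (s i) = reflmx (e i)].

Definition frameD (e : 'I_r -> 'rV[R]_d) : Prop :=
  [/\ orthonormal e, frame_chain e
    & forall i j : 'I_r, j = i.+1 :> nat -> j.+1 = r ->
        rG (s j) = reflmx (e i + e j)].

(* Generating roots of W(B_m) A_1^k (resp. W(D_m) A_1^k): the m points are the
   elements of M, and the k pairs are the {p c, q c}. *)
Inductive rootsB (e : 'I_r -> 'rV[R]_d) (M : {set 'I_r}) (k : nat)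
    (p q : 'I_k -> 'I_r) : 'rV[R]_d -> Prop :=
  | rootsB_sign i of i \in M : rootsB e M p q (e i)
  | rootsB_perm i j of i \in M & j \in M & i != j : rootsB e M p q (e i - e j)
  | rootsB_pair c : rootsB e M p q (e (p c) - e (q c)).

Inductive rootsD (e : 'I_r -> 'rV[R]_d) (M : {set 'I_r}) (k : nat)
    (p q : 'I_k -> 'I_r) : 'rV[R]_d -> Prop :=
  | rootsD_plus i j of i \in M & j \in M & i != j : rootsD e M p q (e i + e j)
  | rootsD_minus i j of i \in M & j \in M & i != j : rootsD e M p q (e i - e j)
  | rootsD_pair c : rootsD e M p q (e (p c) - e (q c)).

Definition distinct_points (M : {set 'I_r}) (m k : nat) (p q : 'I_k -> 'I_r) :=
  #|M| = m /\ uniq (enum M ++ codom p ++ codom q).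

Definition classB (m k : nat) (P : {group gT}) : Prop :=
  exists e M (p q : 'I_k -> 'I_r),
  [/\ frameB e, distinct_points M m p q
    & conj_of_gen (refls_in (rootsB e M p q)) P].

Definition classD (m k : nat) (P : {group gT}) : Prop :=
  exists e M (p q : 'I_k -> 'I_r),
  [/\ frameD e, distinct_points M m p q
    & conj_of_gen (refls_in (rootsD e M p q)) P].

Definition sign_change (j : 'I_r) (e : 'I_r -> 'rV[R]_d) : 'I_r -> 'rV[R]_d :=
  fun i => if i == j then - e i else e i.

Definition classDplus (k : nat) (P : {group gT}) : Prop :=
  exists e (p q : 'I_k -> 'I_r),
  [/\ frameD e, distinct_points set0 0 p q
    & conj_of_gen (refls_in (rootsD e set0 p q)) P].

(* Conjugating by a sign change of e_j amounts to replacing e_j by - e_j. *)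
Definition classDminus (k : nat) (P : {group gT}) : Prop :=
  exists e j (p q : 'I_k -> 'I_r),
  [/\ frameD e, distinct_points set0 0 p q
    & conj_of_gen (refls_in (rootsD (sign_change j e) set0 p q)) P].

(* In type F_4 the simple roots 1, 2 are long and 3, 4 are short; every root
   lies in the W-orbit of a simple root of the same length. *)
Definition refls_of_length (long : bool) : {set gT} :=
  class_support (simples (if long then [:: 1; 2] else [:: 3; 4])%N) W.

Definition classF_A (long : bool) (k : nat) (P : {group gT}) : Prop :=
  [/\ parabolic P, has_type [:: TA k] P & P :=: <<P :&: refls_of_length long>>].

Definition classF_B3 (long : bool) (P : {group gT}) : Prop :=
  [/\ parabolic P, has_type [:: TB 3] P
    & exists2 Q : {group gT}, Q \subset P & classF_A long 2 Q].

End Classes.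

End ReflectionGroup.

(* Names for conjugacy classes of parabolic subgroups; [denote] below gives
   their meaning. *)
Inductive label :=
  | Typ of seq cox_type
  | Std of seq nat                    (* class of a standard parabolic *)
  | NonStd of seq cox_type & seq nat  (* same type, but not in the class Std J *)
  | BA of nat & nat                   (* B_m A_1^k *)
  | DA of nat & nat                   (* D_m A_1^k *)
  | DPlus of nat                      (* (A_1^k)^+ *)
  | DMinus of nat                     (* (A_1^k)^- *)
  | FA of bool & nat                  (* type F_4; true: no tilde *)
  | FB3 of bool.                      (* type F_4; true: no tilde *)

Definition denote (R : realType) (gT : finGroupType) (W : {group gT}) (d : nat)
    (rG : mx_representation R W d) (r : nat) (s : 'I_r -> gT) (C : label)
    : {group gT} -> Prop :=
  match C with
  | Typ Xs => fun P => parabolic rG P /\ has_type rG Xs P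
  | Std J => conj_of_gen W (simples s J)
  | NonStd Xs J => fun P => [/\ parabolic rG P, has_type rG Xs P
                              & ~ conj_of_gen W (simples s J) P]
  | BA m k => classB rG s m k
  | DA m k => classD rG s m k
  | DPlus k => classDplus rG s k
  | DMinus k => classDminus rG s k
  | FA long k => classF_A rG s long k
  | FB3 long => classF_B3 rG s long
  end.

Fixpoint listed (A : Type) (l : seq A) (x : A) : Prop :=
  if l is y :: l' then x = y \/ listed l' x else False.

(* In type I_2(m), A_1' and A_1'' are the classes of <s_1> and <s_2>. For m even,
   z = (s_1 s_2)^(m/2) acts as -1 on the plane and the only reflection orthogonal
   to a reflection t is t z, which is conjugate to t if and only if m/2 is even. *)
Definition concept_list (X : cox_type) : label * label -> Prop :=
  match X with
  | TA n => fun c =>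
         c = (Typ [:: TA n], Typ [::])
      \/ exists m l, [/\ n = (m + l + 1)%N, (0 < m)%N, (0 < l)%N
                       & c = (Typ [:: TA m], Typ [:: TA l])]
  | TB n => fun c =>
      exists m l k, n = (m + l + k.*2)%N /\ c = (BA m k, BA l k)
  | TD n => fun c =>
      [\/ exists m l k, [/\ n = (m + l + k.*2)%N, m != 1%N, l != 1%N,
                            (m, l) != (0, 0)%N & c = (DA m k, DA l k)],
          exists2 k, n = k.*2.+1 & c = (DA 0 k, DA 0 k),
          exists k, [/\ n = k.*2, ~~ odd k
                      & listed [:: (DPlus k, DPlus k); (DMinus k, DMinus k)] c]
        | exists k, [/\ n = k.*2, odd k & c = (DPlus k, DMinus k)]]
  | TI m => fun c =>
      [\/ c = (Typ [:: TI m], Typ [::]),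
          (4 %| m)%N /\ listed [:: (Std [:: 1%N], Std [:: 1%N]);
                                   (Std [:: 2%N], Std [:: 2%N])] c
        | (m %% 4 = 2)%N /\ c = (Std [:: 1%N], Std [:: 2%N])]
  | TE 6 => listed
      [:: (Typ [:: TE 6], Typ [::]);
          (Typ [:: TA 5], Typ [:: TA 1]);
          (Typ [:: TA 2; TA 2], Typ [:: TA 2]);
          (Typ [:: TA 3], Typ [:: TA 1; TA 1])]
  | TE 7 => listed
      [:: (Typ [:: TE 7], Typ [::]);
          (Typ [:: TD 6], Typ [:: TA 1]);
          (Std [:: 2; 4; 5; 6; 7]%N, Typ [:: TA 2]);
          (Typ [:: TD 4; TA 1], Typ [:: TA 1; TA 1]);
          (Std [:: 2; 5; 6; 7]%N, Typ [:: TA 3]);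
          (Typ [:: TD 4], Std [:: 2; 5; 7]%N);
          (Typ [:: TA 1; TA 1; TA 1; TA 1],
           NonStd [:: TA 1; TA 1; TA 1] [:: 2; 5; 7]%N)]
  | TE 8 => listed
      [:: (Typ [:: TE 8], Typ [::]);
          (Typ [:: TE 7], Typ [:: TA 1]);
          (Typ [:: TE 6], Typ [:: TA 2]);
          (Typ [:: TD 6], Typ [:: TA 1; TA 1]);
          (Typ [:: TD 5], Typ [:: TA 3]);
          (Typ [:: TA 5], Typ [:: TA 2; TA 1]);
          (Typ [:: TD 4; TA 1], Typ [:: TA 1; TA 1; TA 1]);
          (Typ [:: TD 4], Typ [:: TD 4]);
          (Typ [:: TA 4], Typ [:: TA 4]);
          (Typ [:: TA 3; TA 1], Typ [:: TA 3; TA 1]);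
          (Typ [:: TA 2; TA 2], Typ [:: TA 2; TA 2]);
          (Typ [:: TA 1; TA 1; TA 1; TA 1], Typ [:: TA 1; TA 1; TA 1; TA 1])]
  | TF4 => listed
      [:: (Typ [:: TF4], Typ [::]);
          (FB3 true, FA false 1);
          (FB3 false, FA true 1);
          (FA true 2, FA false 2);
          (Typ [:: TA 1; TA 1], Typ [:: TA 1; TA 1]);
          (Typ [:: TB 2], Typ [:: TB 2])]
  | TH 3 => listed
      [:: (Typ [:: TH 3], Typ [::]);
          (Typ [:: TA 1; TA 1], Typ [:: TA 1])]
  | TH 4 => listed
      [:: (Typ [:: TH 4], Typ [::]);
          (Typ [:: TH 3], Typ [:: TA 1]);
          (Typ [:: TA 1; TA 1], Typ [:: TA 1; TA 1]);
          (Typ [:: TA 2], Typ [:: TA 2]);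
          (Typ [:: TI 5], Typ [:: TI 5])]
  | _ => fun _ => False
  end.

Section Classification.
Variables (R : realType) (gT : finGroupType) (W : {group gT}) (d : nat).
Variables (rG : mx_representation R W d) (r : nat) (s : 'I_r -> gT).

Definition instance_of (c : label * label) (P Q : {group gT}) : Prop :=
  concept rG P Q /\ (denote rG s c.1 P /\ denote rG s c.2 Q
                     \/ denote rG s c.1 Q /\ denote rG s c.2 P).

(* The pairs of symbols in L, up to interchange of their members, correspond
   bijectively to the concepts up to conjugacy and interchange. *)
Definition classified_by (L : label * label -> Prop) : Prop :=
  [/\ forall c, L c -> is_parabolic_class rG (denote rG s c.1)
                    /\ is_parabolic_class rG (denote rG s c.2),
      forall c, L c -> exists P Q : {group gT},
        [/\ concept rG P Q, denote rG s c.1 P & denote rG s c.2 Q],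
      forall P Q, concept rG P Q -> exists2 c, L c & instance_of c P Q
    & forall c c' P Q P' Q', L c -> L c' ->
        instance_of c P Q -> instance_of c' P' Q' ->
        (equiv_pair W P Q P' Q' <-> c' = c \/ c' = (c.2, c.1))].

End Classification.

(* Main.v *)
(* By Steinberg's theorem a parabolic subgroup is generated by the reflections
   in the roots orthogonal to some vector v, and it is conjugate to the standard
   parabolic subgroup of the simple roots orthogonal to a dominant translate of
   v.  Hence P and Q form a concept if and only if their roots are closed under
   the Galois connection sending a set of roots to the roots orthogonal to it.

   In the classical and dihedral types the closed sets are computed from the
   coordinates of v.  In types B and D a signed permutation makes these
   coordinates nonnegative; a pair of points is a coordinate value taken exactly
   twice, and the roots e_p - e_q and e_p + e_q of a pair are exchanged by the
   Galois connection.  The classes are separated by the vectors they fix.  In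
   type A the closed sets are those of a set of points and of its complement.
   In type I_2(m) the roots are the multiples of the angle pi / m, and the parity
   of the multiple is invariant under W for m even.

   In types E, F and H all standard parabolic subgroups are tabulated.  Products
   of two longest elements provide the conjugations between them; the ranks and
   the numbers of roots, of each length, of P and of its orthogonal complement
   show that the remaining classes differ.  The table is checked by computation
   with coefficients in Z[phi], where phi is the golden ratio. *)

Require Import Defs.
From Stdlib Require Import BinNums.
From Stdlib Require BinInt.
From mathcomp Require Import all_boot all_order all_algebra all_fingroup.
From mathcomp Require Import mxrepresentation.
From mathcomp Require Import boolp reals trigo ring lra zify ssrZ.

Set Implicit Arguments.
Unset Strict Implicit.
Unset Printing Implicit Defensive.

Import Order.TTheory GroupScope GRing.Theory Num.Theory.
Local Open Scope ring_scope.

(** * Reflections *)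

(** Pairs reduce to single subgroups: [dagger] commutes with conjugation and Q is [dagger P], so two
    concepts are conjugate as soon as their first members are. What remains is to describe the
    classes of parabolic subgroups and to attach one label to each. Three obstacles shape the rest.
    The space may contain vectors fixed by W, so the simple roots are independent but need not span,
    and the reflections of W are not known beforehand to have their roots in a given set; both
    points are settled for an abstract [root_system], which each type then instantiates. Many labels
    name a Coxeter type and not a class: to recover the class, one uses invariants shared by all
    subgroups of a type, the rank and the number of reflections. Finally, the unit simple roots of
    the statement give irrational coefficients in the presence of two lengths, and differ from e_i -
    e_j by a factor sqrt 2; suitable simple roots are therefore rescaled, which leaves the
    reflections unchanged. *)

Lemma dot_trmx (R : realType) m n (u : 'rV[R]_m) (v : 'rV[R]_n) (M : 'M_(m, n)) :
  dot (u *m M) v = dot u (v *m M^T).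
Proof. by rewrite /dot trmx_mul trmxK mulmxA. Qed.

Section EuclideanTheory.
Variables (R : realType) (d : nat).
Implicit Types (u v a b : 'rV[R]_d) (x y : R) (M : 'M[R]_d).

Lemma dotE u v : dot u v = \sum_i u 0 i * v 0 i.
Proof. by rewrite /dot mxE; apply: eq_bigr => i _; rewrite mxE. Qed.

Lemma dotC u v : dot u v = dot v u.
Proof. by rewrite !dotE; apply: eq_bigr => i _; rewrite mulrC. Qed.

Lemma dotDl u v w : dot (u + v) w = dot u w + dot v w.
Proof. by rewrite /dot mulmxDl mxE. Qed.

Lemma dotZl x u v : dot (x *: u) v = x * dot u v.
Proof. by rewrite /dot -scalemxAl mxE. Qed.

Lemma dotNl u v : dot (- u) v = - dot u v.
Proof. by rewrite -scaleN1r dotZl mulN1r. Qed.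

Lemma dotBl u v w : dot (u - v) w = dot u w - dot v w.
Proof. by rewrite dotDl dotNl. Qed.

Lemma dot0l v : dot 0 v = 0.
Proof. by rewrite /dot mul0mx mxE. Qed.

Lemma dotDr w u v : dot w (u + v) = dot w u + dot w v.
Proof. by rewrite !(dotC w) dotDl. Qed.

Lemma dotZr x u v : dot u (x *: v) = x * dot u v.
Proof. by rewrite !(dotC u) dotZl. Qed.

Lemma dotNr u v : dot u (- v) = - dot u v.
Proof. by rewrite !(dotC u) dotNl. Qed.

Lemma dotBr w u v : dot w (u - v) = dot w u - dot w v.
Proof. by rewrite !(dotC w) dotBl. Qed.

Lemma dot_suml I (r : seq I) (P : pred I) (F : I -> 'rV[R]_d) v :
  dot (\sum_(i <- r | P i) F i) v = \sum_(i <- r | P i) dot (F i) v.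
Proof. by rewrite (big_morph _ (fun u w => dotDl u w v) (dot0l v)). Qed.

Lemma dot_mull n (c : 'rV[R]_n) (A : 'M[R]_(n, d)) v :
  dot (c *m A) v = \sum_i c 0 i * dot (row i A) v.
Proof. by rewrite mulmx_sum_row dot_suml; apply: eq_bigr => i _; rewrite dotZl. Qed.

Lemma dot_ge0 u : 0 <= dot u u.
Proof. by rewrite dotE sumr_ge0 // => i _; rewrite -expr2 sqr_ge0. Qed.

Lemma dot_eq0 u : (dot u u == 0) = (u == 0).
Proof.
apply/idP/eqP => [|->]; last by rewrite dot0l.
rewrite dotE psumr_eq0 => [/allP u0|i _]; last by rewrite -expr2 sqr_ge0.
apply/rowP => i; rewrite mxE.
by have := u0 i (mem_index_enum i); rewrite -expr2 sqrf_eq0 => /eqP.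
Qed.

Lemma dot_gt0 u : u != 0 -> 0 < dot u u.
Proof. by move=> u0; rewrite lt_neqAle eq_sym dot_eq0 u0 dot_ge0. Qed.

Lemma reflmxE a v : v *m reflmx a = v - (2 * dot v a / dot a a) *: a.
Proof.
rewrite mulmxBr mulmx1 -scalemxAr mulmxA; congr (_ - _).
have -> : v *m a^T = (dot v a)%:M.
  by apply/matrixP => i j; rewrite !ord1 [RHS]mxE mulr1n.
by rewrite mul_scalar_mx scalerA mulrAC.
Qed.

Lemma reflmx0 : reflmx 0 = 1%:M :> 'M[R]_d.
Proof. by rewrite /reflmx mulmx0 scaler0 subr0. Qed.

Lemma reflmx_id a : a != 0 -> a *m reflmx a = - a.
Proof.
move=> a0; rewrite reflmxE mulfK ?dot_eq0 // -[X in X - _]scale1r -scalerBl.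
by rewrite opprD addrA subrr sub0r scaleN1r.
Qed.

Lemma reflmx_fix a v : a != 0 -> (v *m reflmx a == v) = (dot v a == 0).
Proof.
move=> a0; rewrite reflmxE -subr_eq0 addrAC subrr sub0r oppr_eq0 scaler_eq0.
by rewrite (negPf a0) orbF !mulf_eq0 pnatr_eq0 invr_eq0 dot_eq0 (negPf a0) orbF.
Qed.

Lemma reflmxZ x a : x != 0 -> reflmx (x *: a) = reflmx a.
Proof.
move=> x0; rewrite /reflmx [(x *: a)^T]linearZ /= -scalemxAl -scalemxAr !scalerA dotZl dotZr.
have [->|a0] := eqVneq a 0; first by rewrite !mulmx0 !scaler0.
by congr (_ - _ *: _); field; rewrite dot_eq0 a0 x0.
Qed.

Lemma reflmxN a : reflmx (- a) = reflmx a.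
Proof. by rewrite -scaleN1r reflmxZ // oppr_eq0 oner_eq0. Qed.

Lemma reflmx_isom a u v : dot (u *m reflmx a) (v *m reflmx a) = dot u v.
Proof.
have [->|a0] := eqVneq a 0; first by rewrite reflmx0 !mulmx1.
rewrite !reflmxE !(dotBl, dotBr, dotZl, dotZr) (dotC a v).
by field; rewrite dot_eq0.
Qed.

Lemma reflmx_invol a v : v *m reflmx a *m reflmx a = v.
Proof.
have [->|a0] := eqVneq a 0; first by rewrite reflmx0 !mulmx1.
rewrite !reflmxE dotBl dotZl -addrA -opprD -scalerDl.
rewrite [X in X *: a](_ : _ = 0) ?scale0r ?subr0 //.
by field; rewrite dot_eq0.
Qed.

Lemma reflmxK a : reflmx a *m reflmx a = 1%:M.
Proof.
by apply/row_matrixP => i; rewrite !rowE mulmxA reflmx_invol mulmx1.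
Qed.

(** The line of the root is the eigenspace for -1: [a] is negated by [reflmx b], hence is a multiple
    of [b]. *)
Lemma reflmx_inj a b : a != 0 -> reflmx a = reflmx b ->
  exists2 x, x != 0 & b = x *: a.
Proof.
move=> a0 ab; have := reflmx_id a0; rewrite ab reflmxE.
set y := _ / _ => /eqP; rewrite subr_eq addrC -subr_eq opprK => /eqP a2.
have y0 : y != 0.
  apply: contra_neq a0 => y0; move: a2; rewrite y0 scale0r -mulr2n => /eqP.
  by rewrite -scaler_nat scaler_eq0 pnatr_eq0 => /eqP.
exists (2 / y); first by rewrite mulf_neq0 ?invr_eq0 ?pnatr_eq0.
rewrite mulrC -scalerA scaler_nat mulr2n a2 scalerA mulVf ?scale1r //.
Qed.

Lemma reflmx_neq1 a : a != 0 -> reflmx a != 1%:M.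
Proof.
move=> a0; apply: contra_neq a0 => a1.
have [//|a0] := eqVneq a 0; have /eqP := reflmx_id a0.
rewrite a1 mulmx1 -subr_eq0 opprK -mulr2n -scaler_nat scaler_eq0 pnatr_eq0.
by rewrite (negPf a0).
Qed.

Lemma reflmx_conj a M N : (forall u v, dot (u *m M) (v *m M) = dot u v) ->
  N *m M = 1%:M -> reflmx (a *m M) = N *m reflmx a *m M.
Proof.
move=> isoM NM; apply/row_matrixP => i; rewrite !rowE !mulmxA.
move: (delta_mx 0 i) => u.
rewrite -{1}[u]mulmx1 -NM mulmxA.
by rewrite !reflmxE !isoM mulmxBl -scalemxAl.
Qed.

End EuclideanTheory.

(** * Root systems and parabolic subgroups *)

Lemma gen_ind (gT : finGroupType) (A : {set gT}) (Q : gT -> Prop) :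
  Q 1%g ->
  (forall x y, x \in <<A>>%g -> y \in A -> Q x -> Q (x * y)%g) ->
  forall x, x \in <<A>>%g -> Q x.
Proof.
move=> Q1 QM x /gen_prodgP[n [c cA ->]].
elim: n c cA => [|n IH] c cA; first by rewrite big_ord0.
rewrite big_ord_recr /=; apply: QM => //; last by apply: IH.
by apply: group_prod => i _; apply: mem_gen.
Qed.

Lemma exists_argmax (R : realType) (T : finType) (A : {set T}) (f : T -> R) x0 :
  x0 \in A -> exists2 x, x \in A & forall y, y \in A -> f y <= f x.
Proof. by move=> x0A; case: (arg_maxP f x0A) => x xA xM; exists x. Qed.

Section RootSystem.
Variables (R : realType) (gT : finGroupType) (W : {group gT}) (d : nat).
Variable rG : mx_representation R W d.
Implicit Types (t w x y z : gT) (u v b : 'rV[R]_d) (Psi : 'rV[R]_d -> Prop).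

Definition gp Psi : {group gT} := <<refls_in rG Psi>>%G.

(** [Psi] may be infinite, as for the stabilizer of a hyperplane; [parabolic_stabp] shows that such
    stabilizers are parabolic all the same. *)
Definition stabp Psi : {set gT} :=
  [set w in W | `[< forall u, Psi u -> u *m rG w = u >]].

Lemma refls_inP Psi t :
  reflect (t \in W /\ exists2 b, Psi b & rG t = reflmx b) (t \in refls_in rG Psi).
Proof. by rewrite inE; apply: (iffP andP) => -[tW /asboolP H]; split. Qed.

Lemma reflectionsP t :
  reflect (t \in W /\ exists2 b, b != 0 & rG t = reflmx b)
          (t \in reflections rG).
Proof. by rewrite inE; apply: (iffP andP) => -[tW /asboolP H]; split. Qed.

Lemma stabpP Psi w :
  reflect (w \in W /\ forall u, Psi u -> u *m rG w = u) (w \in stabp Psi).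
Proof. by rewrite inE; apply: (iffP andP) => -[tW /asboolP H]; split. Qed.

Lemma refls_in_sub Psi : refls_in rG Psi \subset W.
Proof. by apply/subsetP => t /refls_inP[]. Qed.

Lemma gp_sub Psi : gp Psi \subset W.
Proof. by rewrite gen_subG refls_in_sub. Qed.

(* A coefficient family [a] of simple roots need not be normalised: rescaling
   the roots makes the coefficients of all roots integral. *)
Record root_system n (s : 'I_n -> gT) (a : 'I_n -> 'rV[R]_d)
    (Phi : 'rV[R]_d -> Prop) : Prop := RootSystem {
  rs_faithful : mx_faithful rG;
  rs_gen : W :=: <<[set s i | i : 'I_n]>>%g;
  rs_in : forall i, s i \in W;
  rs_refl : forall i, rG (s i) = reflmx (a i);
  rs_free : row_free (\matrix_i a i);
  rs_simple : forall i, Phi (a i);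
  rs_neq0 : forall b, Phi b -> b != 0;
  rs_closed : forall b i, Phi b -> Phi (b *m reflmx (a i));
  rs_sign : forall b, Phi b -> exists2 c : 'rV_n, b = c *m \matrix_i a i &
    (forall i, 0 <= c 0 i) \/ (forall i, c 0 i <= 0);
  rs_reduced : forall i (x : R), Phi (x *: a i) -> x = 1 \/ x = -1
}.

Variables (n : nat) (s : 'I_n -> gT) (a : 'I_n -> 'rV[R]_d).
Variable Phi : 'rV[R]_d -> Prop.
Hypothesis RS : root_system s a Phi.

Let A := \matrix_i a i.
Let s_in := rs_in RS.
Let s_refl := rs_refl RS.
Hint Resolve s_in : core.

Lemma rs_inj : {in W &, injective rG}.
Proof. exact: mx_faithful_inj (rs_faithful RS). Qed.

Lemma rs_gen_ind (Q : gT -> Prop) :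
  Q 1%g -> (forall x i, x \in W -> Q x -> Q (x * s i)%g) ->
  forall w, w \in W -> Q w.
Proof.
move=> Q1 QM w; rewrite {1}(rs_gen RS) => wW; move: w wW; apply: gen_ind => //.
by move=> x y; rewrite -(rs_gen RS) => xW /imsetP[i _ ->]; apply: QM.
Qed.

Lemma rs_isom w u v : w \in W -> dot (u *m rG w) (v *m rG w) = dot u v.
Proof.
move=> wW; move: w wW u v; apply: rs_gen_ind => [u v|x i xW IH u v].
  by rewrite repr_mx1 !mulmx1.
by rewrite repr_mxM // s_refl !mulmxA reflmx_isom IH.
Qed.

Lemma rs_conj t w b : t \in W -> w \in W -> rG t = reflmx b ->
  rG (t ^ w)%g = reflmx (b *m rG w).
Proof.
move=> tW wW tb; rewrite (@reflmx_conj _ _ _ _ (rG w^-1%g)) //.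
- by rewrite conjgE !repr_mxM ?groupM ?groupV // tb mulmxA.
- by move=> u v; apply: rs_isom.
- by rewrite -repr_mxM ?groupV // mulVg repr_mx1.
Qed.

Lemma rs_stable b w : w \in W -> Phi b -> Phi (b *m rG w).
Proof.
move=> wW; move: w wW b; apply: rs_gen_ind => [b|x i xW IH b] Pb.
  by rewrite repr_mx1 mulmx1.
by rewrite repr_mxM // mulmxA s_refl; apply: (rs_closed RS); apply: IH.
Qed.

Lemma rs_simple_neq0 i : a i != 0.
Proof. exact: (rs_neq0 RS (rs_simple RS i)). Qed.

(** A right inverse of the matrix of simple roots provides the vector; it exists because they are
    independent. *)
Lemma dual_vec (x : 'I_n -> R) : exists v, forall i, dot (a i) v = x i.
Proof.
have /row_freeP[B AB] := rs_free RS.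
exists (\row_i x i *m B^T) => i.
rewrite -dot_trmx; have -> : a i = row i A by rewrite rowK.
rewrite -row_mul AB row1 dotE (bigD1 i) //= big1 ?addr0 => [|j ji].
  by rewrite !mxE !eqxx mul1r.
by rewrite !mxE eqxx (negPf ji) mul0r.
Qed.

(** The pairings with the simple roots make [ht] the sum of the coefficients of a root, so the sign
    of [ht] tells positive roots from negative ones. *)
Definition rho := sval (cid (dual_vec (fun=> 1))).

Lemma rhoE i : dot (a i) rho = 1.
Proof. exact: (svalP (cid (dual_vec (fun=> 1)))). Qed.

Definition ht b := dot b rho.

Lemma ht_mull (c : 'rV_n) : ht (c *m A) = \sum_i c 0 i.
Proof.
by rewrite /ht dot_mull; apply: eq_bigr => i _; rewrite rowK rhoE mulr1.
Qed.

Lemma ht_refl b i : ht (b *m reflmx (a i)) = ht b - 2 * dot b (a i) / dot (a i) (a i).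
Proof. by rewrite /ht reflmxE dotBl dotZl rhoE mulr1. Qed.

Lemma ht_pos b : Phi b -> 0 <= ht b ->
  exists2 c : 'rV_n, b = c *m A & forall i, 0 <= c 0 i.
Proof.
move=> Pb hb; have [c bE [c0|c0]] := rs_sign RS Pb; first by exists c.
exists c => // i; move: hb; rewrite bE ht_mull => hb.
suff /eqP : c 0 i = 0 by rewrite eq_le => /andP[].
apply/eqP; rewrite -oppr_eq0.
have : \sum_i - c 0 i == 0.
  by rewrite eq_le sumr_ge0 ?sumrN ?oppr_le0 ?hb // => j _; rewrite oppr_ge0.
rewrite psumr_eq0 => [/allP/(_ i (mem_index_enum i))//|j _].
by rewrite oppr_ge0.
Qed.

Lemma ht_neq0 b : Phi b -> ht b != 0.
Proof.
move=> Pb; apply: contraNneq (rs_neq0 RS Pb) => hb.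
have [c bE c0] : exists2 c : 'rV_n, b = c *m A & forall i, 0 <= c 0 i.
  by apply: ht_pos; rewrite ?hb.
suff c00 : c = 0 by rewrite bE c00 mul0mx.
move/eqP: hb; rewrite bE ht_mull psumr_eq0 // => /allP H.
by apply/rowP => i; rewrite mxE; apply/eqP/(H i (mem_index_enum i)).
Qed.

(** The reflection in [a i] alters only the i-th coefficient. If the sign of the root changes, all
    other coefficients are both nonnegative and nonpositive, and reducedness leaves only [a i]. *)
Lemma simple_permutes b i :
  Phi b -> 0 < ht b -> ht (b *m reflmx (a i)) < 0 -> b = a i.
Proof.
move=> Pb hb hb'; have [c bE c0] := ht_pos Pb (ltW hb).
have [c' bE' [c'0|c'0]] := rs_sign RS (rs_closed RS i Pb).
  by move: hb'; rewrite bE' ht_mull ltNge sumr_ge0.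
have cc' : c' = c - (2 * dot b (a i) / dot (a i) (a i)) *: delta_mx 0 i.
  apply: (row_free_inj (rs_free RS)); rewrite -bE' mulmxBl -bE reflmxE.
  by rewrite -scalemxAl -rowE rowK.
have cj j : j != i -> c 0 j = 0.
  move=> ji; apply/eqP; rewrite eq_le c0 andbT.
  have := c'0 j; rewrite cc' !mxE eqxx (negPf ji) mulr0 oppr0 addr0.
  by [].
have bi : b = c 0 i *: a i.
  rewrite bE mulmx_sum_row (bigD1 i) //= big1 ?addr0 ?rowK // => j ji.
  by rewrite cj ?scale0r.
have := Pb; rewrite {1}bi => /(rs_reduced RS)[ci|ci].
  by rewrite bi ci scale1r.
by have := c0 i; rewrite ci oppr_ge0 ler10.
Qed.

Definition wprod (l : seq 'I_n) : gT := (\prod_(i <- l) s i)%g.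

Lemma wprod_in l : wprod l \in W.
Proof. by rewrite /wprod; apply: group_prod. Qed.
Hint Resolve wprod_in : core.

Lemma wordP w : w \in W -> exists l, w = wprod l.
Proof.
move: w; apply: rs_gen_ind => [|x i xW [l ->]].
  by exists [::]; rewrite /wprod big_nil.
by exists (rcons l i); rewrite /wprod big_rcons.
Qed.

Lemma s_invol i : (s i * s i = 1)%g.
Proof. by apply: rs_inj; rewrite ?groupM // repr_mxM // repr_mx1 s_refl reflmxK. Qed.

Lemma wprod_cons j l : wprod (j :: l) = (s j * wprod l)%g.
Proof. by rewrite /wprod big_cons. Qed.

Lemma wprod_cat l1 l2 : wprod (l1 ++ l2) = (wprod l1 * wprod l2)%g.
Proof. by rewrite /wprod big_cat. Qed.

Lemma wprod_nil : wprod [::] = 1%g.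
Proof. by rewrite /wprod big_nil. Qed.

Lemma rep_wprod_cons b j l :
  b *m rG (wprod (j :: l)) = b *m reflmx (a j) *m rG (wprod l).
Proof. by rewrite wprod_cons repr_mxM // s_refl mulmxA. Qed.

Lemma word_sign_change b l :
  Phi b -> 0 < ht b -> ht (b *m rG (wprod l)) < 0 ->
  exists l1 j l2, l = l1 ++ j :: l2 /\ b *m rG (wprod l1) = a j.
Proof.
elim: l b => [|j l IH] b Pb hb.
  by rewrite wprod_nil repr_mx1 mulmx1 => /(lt_trans hb); rewrite ltxx.
rewrite rep_wprod_cons => hbl.
have [hbj|hbj|hbj] := ltgtP (ht (b *m reflmx (a j))) 0.
- exists [::], j, l; split => //; rewrite wprod_nil repr_mx1 mulmx1.
  exact: simple_permutes.
- have [l1 [i [l2 [-> E]]]] := IH _ (rs_closed RS j Pb) hbj hbl.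
  by exists (j :: l1), i, l2; rewrite rep_wprod_cons.
- by have := ht_neq0 (rs_closed RS j Pb); rewrite hbj eqxx.
Qed.

(* The deletion argument: a nonempty word that keeps all simple roots positive
   can be shortened by two letters. *)
Lemma word_trivial l :
  (forall i, 0 < ht (a i *m rG (wprod l))) -> wprod l = 1%g.
Proof.
have [k] := ubnP (size l); elim: k l => // k IH [|i l] /ltnSE lk hl.
  exact: wprod_nil.
have neg : ht (a i *m rG (wprod l)) < 0.
  have := hl i; rewrite rep_wprod_cons.
  by rewrite reflmx_id ?rs_simple_neq0 // mulNmx /ht dotNl oppr_gt0.
have pos_i : 0 < ht (a i) by rewrite /ht rhoE ltr01.
have [l1 [j [l2 [lE al1]]]] := word_sign_change (rs_simple RS i) pos_i neg.
have sj : s j = (s i ^ wprod l1)%g.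
  by apply: rs_inj => //; rewrite ?groupJ // s_refl -al1 (rs_conj _ _ (s_refl i)).
have E : wprod (i :: l) = wprod (l1 ++ l2).
  rewrite lE wprod_cons !wprod_cat wprod_cons sj conjgE !mulgA mulgK.
  by rewrite s_invol mul1g.
rewrite E; apply: IH => [|i']; last by rewrite -E.
by move: lk; rewrite lE /= !size_cat /= addnS => /ltnW.
Qed.

Lemma simple_pos_eq1 w :
  w \in W -> (forall i, 0 < ht (a i *m rG w)) -> w = 1%g.
Proof. by move=> /wordP[l ->]; apply: word_trivial. Qed.

Lemma exists_neg w : w \in W -> w != 1%g -> exists i, ht (a i *m rG w) < 0.
Proof.
move=> wW w1; apply: contrapT => H; move/eqP: w1; apply.
apply: simple_pos_eq1 => // i; rewrite ltNge le_eqVlt negb_or.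
rewrite (ht_neq0 (rs_stable wW (rs_simple RS i))) /=.
by apply/negP => hi; apply: H; exists i.
Qed.

(** Take a translate of maximal height. If its coefficients were nonpositive, its positive norm
    would force a negative pairing with some simple root, whose reflection would raise the
    height. *)
Lemma exists_pos b : Phi b -> exists2 w, w \in W & 0 < ht (b *m rG w) /\
  forall w', w' \in W -> ht (b *m rG w') <= ht (b *m rG w).
Proof.
move=> Pb; have [w wW wM] := exists_argmax (fun w => ht (b *m rG w)) (group1 W).
exists w => //; split => //; have Pw := rs_stable wW Pb.
rewrite lt_neqAle eq_sym ht_neq0 //=; apply: contraT; rewrite -ltNge => hw.
have [c bE [c0|c0]] := rs_sign RS Pw.
  by move: hw; rewrite bE ht_mull ltNge sumr_ge0.
have [i hi] : exists i, dot (b *m rG w) (a i) < 0.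
  apply: contrapT => H; have := dot_gt0 (rs_neq0 RS Pw).
  rewrite {1}bE dot_mull ltNge => /negP; apply; apply: sumr_le0 => i _.
  rewrite rowK dotC mulr_le0_ge0 // leNgt; apply/negP => hi; apply: H.
  by exists i.
have := wM _ (groupM wW (s_in i)).
rewrite repr_mxM // mulmxA s_refl ht_refl gerBl leNgt => /negP[].
by rewrite pmulr_llt0 ?invr_gt0 ?dot_gt0 ?rs_simple_neq0 // pmulr_rlt0.
Qed.

(* A W-translate of [b] of least positive height is simple: otherwise some
   simple reflection lowers its height and keeps it positive. *)
Lemma root_conj_simple b : Phi b ->
  exists2 w, w \in W & exists i, b *m rG w = a i.
Proof.
move=> Pb; have [w0 w0W [w0p _]] := exists_pos Pb.
have w0S : w0 \in [set w in W | 0 < ht (b *m rG w)] by rewrite inE w0W.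
have [w] := exists_argmax (fun w => - ht (b *m rG w)) w0S.
rewrite inE => /andP[wW wp] wM; exists w => //.
have Pw := rs_stable wW Pb; have [c bE c0] := ht_pos Pw (ltW wp).
have [i hi] : exists i, 0 < dot (b *m rG w) (a i).
  apply: contrapT => H; have := dot_gt0 (rs_neq0 RS Pw).
  rewrite {1}bE dot_mull ltNge => /negP; apply; apply: sumr_le0 => i _.
  rewrite rowK dotC mulr_ge0_le0 // leNgt; apply/negP => hi; apply: H.
  by exists i.
exists i; apply: (simple_permutes Pw wp); rewrite ltNge; apply/negP => hp.
have wi : (w * s i)%g \in [set w in W | 0 < ht (b *m rG w)].
  rewrite inE groupM //= repr_mxM // mulmxA s_refl lt_neqAle eq_sym hp.
  by rewrite ht_neq0 //; apply: (rs_closed RS).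
have := wM _ wi; rewrite lerN2 repr_mxM // mulmxA s_refl ht_refl.
rewrite lerBrDr gerDl leNgt => /negP; apply.
by rewrite !(divr_gt0, mulr_gt0) // dot_gt0 // rs_simple_neq0.
Qed.

Lemma PhiN b : Phi b -> Phi (- b).
Proof.
move=> /root_conj_simple[w wW [i bi]].
have -> : - b = - a i *m rG w^-1%g by rewrite -bi mulNmx repr_mxK.
rewrite -reflmx_id ?rs_simple_neq0 //; apply: rs_stable; rewrite ?groupV //.
exact/(rs_closed RS)/(rs_simple RS).
Qed.

Lemma Phi_refl b : Phi b -> exists2 t, t \in W & rG t = reflmx b.
Proof.
move=> /root_conj_simple[w wW [i bi]]; exists (s i ^ w^-1)%g.
  by rewrite groupJ ?groupV.
by rewrite (rs_conj _ _ (s_refl i)) ?groupV // -bi repr_mxK.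
Qed.

Lemma Phi_reduced b (x : R) : Phi b -> Phi (x *: b) -> x = 1 \/ x = -1.
Proof.
move=> /root_conj_simple[w wW [i bi]] /(rs_stable wW).
by rewrite -scalemxAl bi; apply: (rs_reduced RS).
Qed.

Definition dominant v := forall i, 0 <= dot v (a i).

(** A translate of maximal height is dominant: a negative pairing with [a i] would let [s i] raise
    it. *)
Lemma exists_dominant v : exists2 w, w \in W & dominant (v *m rG w).
Proof.
have [w wW wM] := exists_argmax (fun w => ht (v *m rG w)) (group1 W).
exists w => // i; have := wM _ (groupM wW (s_in i)).
rewrite repr_mxM // mulmxA s_refl ht_refl gerBl.
by rewrite pmulr_lge0 ?invr_gt0 ?dot_gt0 ?rs_simple_neq0 // pmulr_rge0.
Qed.

Lemma dominant_pos v b : dominant v -> Phi b -> 0 <= ht b -> 0 <= dot v b.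
Proof.
move=> dv Pb /(ht_pos Pb)[c -> c0].
rewrite dotC dot_mull sumr_ge0 // => i _; rewrite rowK mulr_ge0 // dotC.
exact: dv.
Qed.

(* If [p * w] is not 1, a simple reflection fixing [v] increases
   [dot (rho *m rG (p * w)) rho]. *)
Lemma dominant_stab v w : dominant v -> w \in W -> v *m rG w = v ->
  w \in <<[set s i | i : 'I_n & dot v (a i) == 0]>>%g.
Proof.
move=> dv wW vw; set P := <<[set s i | i : 'I_n & dot v (a i) == 0]>>%G.
rewrite -[_ \in _]/(w \in P).
have PW : P \subset W.
  by rewrite gen_subG; apply/subsetP => _ /imsetP[i _ ->].
have fixP p : p \in P -> v *m rG p = v.
  move: p; apply: gen_ind => [|x y xP /imsetP[i vi ->] IH].
    by rewrite repr_mx1 mulmx1.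
  have xW := subsetP PW _ xP; rewrite repr_mxM // mulmxA IH s_refl; apply/eqP.
  by rewrite reflmx_fix ?rs_simple_neq0 //; move: vi; rewrite inE.
have [p pP pM] := exists_argmax (fun p => ht (rho *m rG (p * w)%g)) (group1 P).
have pW := subsetP PW _ pP.
have [pw|pw] := eqVneq (p * w)%g 1%g.
  by rewrite -[w](mulKg p) pw mulg1 groupV.
have pwW := groupM pW wW.
have [i hi] := exists_neg pwW pw.
have vpw : v *m rG (p * w)%g = v by rewrite repr_mxM // mulmxA fixP.
(* [p * w] fixes [v] and makes [a i] negative, so the pairing of [v] with [a i] is nonpositive as
   well as nonnegative. *)
have vi : dot v (a i) == 0.
  rewrite eq_le dv andbT -(rs_isom _ _ pwW) vpw -oppr_ge0 -dotNr.
  apply: dominant_pos => //; first exact/PhiN/rs_stable/(rs_simple RS).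
  by rewrite /ht dotNl oppr_ge0 ltW.
have siP : s i \in P by apply/mem_gen/imsetP; exists i; rewrite ?inE.
have := pM _ (groupM siP pP); rewrite leNgt => /negP[].
rewrite -mulgA [rG (s i * _)%g]repr_mxM // mulmxA s_refl reflmxE mulmxBl.
rewrite -scalemxAl.
rewrite /ht dotBl dotZl ltrDl oppr_gt0 pmulr_rlt0 // (dotC rho) rhoE mulr1.
by rewrite divr_gt0 // dot_gt0 // rs_simple_neq0.
Qed.

Lemma stabp_group_set Psi : group_set (stabp Psi).
Proof.
apply/group_setP; split=> [|x y /stabpP[xW xP] /stabpP[yW yP]].
  by apply/stabpP; split=> // u _; rewrite repr_mx1 mulmx1.
apply/stabpP; split=> [|u Pu]; first exact: groupM.
by rewrite repr_mxM // mulmxA xP ?yP.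
Qed.
Canonical stabp_group Psi := Group (stabp_group_set Psi).

Lemma stabp_conj Psi w : w \in W ->
  stabp Psi :^ w = stabp (fun u => Psi (u *m rG w^-1%g)) :> {set gT}.
Proof.
move=> wW; have wVW : w^-1%g \in W by rewrite groupV.
have sub w' Psi' : w' \in W ->
    stabp Psi' :^ w' \subset stabp (fun u => Psi' (u *m rG w'^-1%g)).
  move=> w'W; apply/subsetP => _ /imsetP[x /stabpP[xW xP] ->]; apply/stabpP.
  split=> [|u Pu]; first by rewrite groupJ.
  rewrite conjgE !repr_mxM ?groupM ?groupV // !mulmxA (xP _ Pu).
  by rewrite repr_mxKV.
apply/eqP; rewrite eqEsubset sub //= -sub_conjgV.
apply: subset_trans (sub _ _ wVW) _; apply/subsetP => x /stabpP[xW xP].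
apply/stabpP; split=> // u Pu; apply: xP.
by rewrite invgK repr_mxK.
Qed.

(** Finitely many vectors suffice: for each element of W outside the stabilizer, one vector of [Psi]
    that it moves. They form the rows of a matrix indexed by the elements of [gT], with zero rows
    elsewhere. *)
Lemma parabolic_stabp Psi : parabolic rG (stabp Psi).
Proof.
pose bad w u := Psi u /\ u *m rG w != u.
have ex w : exists u, w \in W -> w \notin stabp Psi -> bad w u.
  have [[u Hu]|H] := pselect (exists u, bad w u); first by exists u.
  exists 0 => wW /stabpP[]; split=> // u Pu; apply/eqP/contraT => uw.
  by case: H; exists u.
pose f w := sval (cid (ex w)).
have fP w : w \in W -> w \notin stabp Psi -> bad w (f w) := svalP (cid (ex w)).
pose g (i : 'I_#|gT|) : 'rV[R]_d :=
  if (enum_val i \in W) && (enum_val i \notin stabp Psi) then f (enum_val i) else 0.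
exists #|gT|, (\matrix_i g i); apply/setP => w; rewrite [RHS]inE.
apply/idP/andP => [wP|[wW /eqP gw]].
  have /stabpP[wW wu] := wP; split => //; apply/eqP/row_matrixP => i.
  rewrite row_mul !rowK /g; case: ifP => [/andP[iW /(fP _ iW)[Pi _]]|_].
    exact: wu.
  by rewrite mul0mx.
apply: contraT => wP; have [_ /eqP[]] := fP _ wW wP.
have := congr1 (row (enum_rank w)) gw; rewrite row_mul !rowK /g enum_rankK.
by rewrite wW wP.
Qed.

Lemma rstab_stabp m (U : 'M[R]_(m, d)) :
  rstab rG U = stabp (fun u => exists i, u = row i U).
Proof.
apply/setP => w; rewrite inE; apply/andP/stabpP => -[wW wU]; split => //.
  by move=> _ [i ->]; rewrite -row_mul (eqP wU).
by apply/eqP/row_matrixP => i; rewrite row_mul wU //; exists i.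
Qed.

(** A vector of the row space with a smallest stabilizer works: as long as an element fixing [v]
    moves some row [u], a suitable [v + t u] has a strictly smaller stabilizer. *)
Lemma rstab_generic m (U : 'M[R]_(m, d)) : exists v, rstab rG U = stabp (eq^~ v).
Proof.
suff [v vU vP] : exists2 v : 'rV[R]_d, (v <= U)%MS &
    forall w, w \in W -> v *m rG w = v -> w \in rstab rG U.
  exists v; apply/setP => w; apply/idP/stabpP => [wU|[wW /(_ _ erefl)]]; last exact: vP.
  split=> [|_ ->]; first exact: (subsetP (rstab_sub rG U)).
  exact: rstab_act vU.
have [v] : exists v : 'rV[R]_d, (v <= U)%MS by exists 0; apply: sub0mx.
 have [k] := ubnP #|stabp (eq^~ v)|.
elim: k v => // k IH v /ltnSE vk vU.
have [H|] := pselect (forall w, w \in W -> v *m rG w = v -> w \in rstab rG U).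
  by exists v.
move=> /existsNP[w /not_implyP[wW /not_implyP[vw wU]]].
have [i ui] : exists i, row i U *m rG w <> row i U.
  apply: contrapT => H; apply: wU; rewrite inE wW /=.
  apply/eqP/row_matrixP => i; rewrite row_mul; apply: contrapT => Hi.
  by apply: H; exists i.
set u := row i U in ui.
(* The coefficient never vanishes, so [w], which fixes [v] and moves [u], moves each of these
   vectors. *)
pose vt (t : 'I_#|gT|.+1) := v + t.+1%:R *: u.
(* For a bad [t], some element fixes [vt t] but not [v]. Two bad values cannot share this element,
   which would then fix [u] and [v]; as there are more values than group elements, one of them is
   good. *)
have [t tP] : exists t : 'I_#|gT|.+1, forall w', w' \in W ->
    vt t *m rG w' = vt t -> v *m rG w' = v.
  apply: contrapT => H.
  have ex (t : 'I_#|gT|.+1) : exists w', [/\ w' \in W, vt t *m rG w' = vt t & v *m rG w' <> v].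
    apply: contrapT => Ht; apply: H; exists t => w' w'W E.
    by apply: contrapT => Ht'; apply: Ht; exists w'.
  pose f (t : 'I_#|gT|.+1) := sval (cid (ex t)).
  have fP (t : 'I_#|gT|.+1) : [/\ f t \in W, vt t *m rG (f t) = vt t & v *m rG (f t) <> v].
    exact: (svalP (cid (ex t))).
  suff /leq_card : injective f by rewrite card_ord ltnn.
  move=> t t' E; have [_ Et Nt] := fP t; have [_ Et' _] := fP t'.
  rewrite -E in Et'; apply: contrapT => tt'; apply: Nt.
  have tt'0 : t.+1%:R - t'.+1%:R != 0 :> R.
    by rewrite subr_eq0 eqr_nat eqSS; apply/eqP => /val_inj.
  have uf : u *m rG (f t) = u.
    apply: (scalerI tt'0); rewrite scalemxAl.
    have -> : (t.+1%:R - t'.+1%:R) *: u = vt t - vt t'.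
      by rewrite scalerBl /vt opprD addrACA subrr add0r.
    by rewrite mulmxBl Et Et'.
  by have := Et; rewrite /vt mulmxDl -scalemxAl uf => /addIr.
apply: (IH (vt t)); last first.
  by rewrite addmx_sub // scalemx_sub // row_sub.
apply: leq_trans vk; apply: proper_card; apply/properP; split.
  apply/subsetP => x /stabpP[xW xP]; apply/stabpP; split=> // _ ->.
  exact: tP (xP _ erefl).
exists w; first by apply/stabpP; split=> // _ ->.
apply/negP => /stabpP[_ /(_ _ erefl)].
rewrite /vt mulmxDl vw => /addrI /eqP; rewrite -scalemxAl => /eqP E; apply: ui.
by apply: (scalerI _ E); rewrite pnatr_eq0.
Qed.

Definition stdp (J : {set 'I_n}) : {group gT} := <<[set s i | i in J]>>%G.

Lemma dominant_stabE v : dominant v ->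
  stabp (eq^~ v) = stdp [set i | dot v (a i) == 0].
Proof.
move=> dv; apply/eqP; rewrite eqEsubset; apply/andP; split.
  apply/subsetP => w /stabpP[wW /(_ _ erefl)] /(dominant_stab dv wW).
  rewrite /stdp /= => wP; apply: (subsetP _ _ wP); apply: genS.
  by apply/subsetP => _ /imsetP[i iv ->]; apply/imsetP; exists i; rewrite // !inE in iv *.
rewrite gen_subG; apply/subsetP => _ /imsetP[i vi ->]; apply/stabpP; split=> // _ ->.
apply/eqP; rewrite s_refl reflmx_fix ?rs_simple_neq0 //.
by move: vi; rewrite inE.
Qed.

Lemma stdp_vec (J : {set 'I_n}) :
  exists v, [/\ dominant v, forall i, (dot v (a i) == 0) = (i \in J)
               & stdp J = stabp (eq^~ v) :> {set gT}].
Proof.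
have [v vE] := dual_vec (fun i => (i \notin J)%:R).
have vJ i : (dot v (a i) == 0) = (i \in J).
  by rewrite dotC vE pnatr_eq0 eqb0 negbK.
have dv : dominant v by move=> i; rewrite dotC vE ler0n.
exists v; split=> //; rewrite dominant_stabE //.
by congr (stdp _ : {set gT}); apply/setP => i; rewrite inE vJ.
Qed.

Lemma parabolic_conj P w : parabolic rG P -> w \in W -> parabolic rG (P :^ w).
Proof.
move=> [m [U ->]] wW; rewrite rstab_stabp stabp_conj //.
exact: parabolic_stabp.
Qed.

Lemma parabolic_stdp J : parabolic rG (stdp J).
Proof. by have [v [_ _ ->]] := stdp_vec J; apply: parabolic_stabp. Qed.

Lemma parabolic_std P : parabolic rG P ->
  exists J : {set 'I_n}, exists2 w, w \in W & P = stdp J :^ w.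
Proof.
move=> [m [U ->]]; have [v ->] := rstab_generic U.
have [w wW dw] := exists_dominant v.
have vw : stabp (eq^~ v) = stabp (eq^~ (v *m rG w)) :^ w^-1.
  rewrite stabp_conj ?groupV // invgK; congr (stabp _ : {set gT}).
  apply/funext => u; apply/propext; split=> [-> //|].
  by move=> /(congr1 (mulmx^~ (rG w^-1%g))); rewrite !repr_mxK.
by rewrite vw dominant_stabE //; eexists; exists w^-1%g; rewrite ?groupV.
Qed.

(** The stabilizer of the mirror of [t] is parabolic and contains [t], hence is nontrivial and
    contains the reflection in some root [c] of [Phi]. A reflection fixing the mirror of [t] is
    [t]. *)
Lemma reflection_root t : t \in reflections rG ->
  exists2 b, Phi b & rG t = reflmx b.
Proof.
move=> /reflectionsP[tW [b b0 tb]].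
have [J [w wW E]] := parabolic_std (parabolic_stabp (fun u => dot u b = 0)).
have tP : t \in stabp (fun u => dot u b = 0).
  apply/stabpP; split=> // u ub; apply/eqP.
  by rewrite tb reflmx_fix // ub.
have [J0|[i iJ]] := set_0Vmem J.
  move: tP; rewrite E J0 /stdp /= imset0 gen0 conjs1g inE => /eqP t1.
  by have := reflmx_neq1 b0; rewrite -tb t1 repr_mx1 eqxx.
have Pi : Phi (a i *m rG w) by apply/rs_stable/(rs_simple RS).
exists (a i *m rG w) => //; set c := a i *m rG w in Pi *.
have /stabpP[_ cP] : (s i ^ w)%g \in stabp (fun u => dot u b = 0).
  by rewrite E memJ_conjg; apply/mem_gen/imsetP; exists i.
have rc : rG (s i ^ w)%g = reflmx c by apply: rs_conj.
(* The component of [c] orthogonal to [b] is fixed by the reflection in [c], hence orthogonal to [c]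
   as well as to [b], hence zero. *)
pose u := c - (dot c b / dot b b) *: b.
have ub : dot u b = 0 by rewrite dotBl dotZl divfK ?dot_eq0 // subrr.
have uc : dot u c = 0.
  apply/eqP; rewrite -reflmx_fix ?(rs_neq0 RS Pi) // -rc.
  by apply/eqP/cP.
have /eqP u0 : u == 0 by rewrite -dot_eq0 {2}/u dotBr dotZr ub uc mulr0 subr0.
move/eqP: u0; rewrite subr_eq0 => /eqP cb.
have := rs_neq0 RS Pi; rewrite {1}cb scaler_eq0 negb_or => /andP[x0 _].
by rewrite cb reflmxZ.
Qed.

Lemma reflectionsE : reflections rG = refls_in rG Phi.
Proof.
apply/setP => t; apply/idP/refls_inP => [tr|[tW [b Pb tb]]].
  by have [b Pb tb] := reflection_root tr; case/reflectionsP: tr; split=> //; exists b.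
by apply/reflectionsP; split=> //; exists b => //; apply: (rs_neq0 RS Pb).
Qed.

Definition Orth Psi b := Phi b /\ forall u, Psi u -> dot u b = 0.

Lemma eq_gp Psi Psi' : (forall b, Psi b <-> Psi' b) -> gp Psi = gp Psi'.
Proof. by move=> E; congr gp; apply/funext => b; apply/propext. Qed.

Lemma stabp_gp Psi : stabp Psi = gp (Orth Psi).
Proof.
have [J [w wW E]] := parabolic_std (parabolic_stabp Psi).
apply/eqP; rewrite eqEsubset; apply/andP; split.
  rewrite E sub_conjg gen_subG; apply/subsetP => _ /imsetP[i iJ ->].
  rewrite mem_conjgV; apply: mem_gen; apply/refls_inP.
  split; first by rewrite groupJ.
  exists (a i *m rG w); last exact: rs_conj.
  have Pi : Phi (a i *m rG w) by apply/rs_stable/(rs_simple RS).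
  split=> // u Pu; apply/eqP; rewrite -reflmx_fix ?(rs_neq0 RS Pi) //.
  rewrite -(rs_conj _ _ (s_refl i)) //; apply/eqP.
  have /stabpP[_] : (s i ^ w)%g \in stabp Psi; last exact.
  by rewrite E memJ_conjg; apply/mem_gen/imsetP; exists i.
rewrite gen_subG; apply/subsetP => t /refls_inP[tW [b [Pb ob] tb]].
apply/stabpP; split=> // u Pu; apply/eqP.
by rewrite tb reflmx_fix ?(rs_neq0 RS Pb) // ob.
Qed.

End RootSystem.

(** * Concepts *)

Section Concepts.
Variables (R : realType) (gT : finGroupType) (W : {group gT}) (d : nat).
Variable rG : mx_representation R W d.
Variables (n : nat) (s : 'I_n -> gT) (a : 'I_n -> 'rV[R]_d).
Variable Phi : 'rV[R]_d -> Prop.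
Hypothesis RS : root_system rG s a Phi.
Implicit Types (w x y z : gT) (u v b : 'rV[R]_d) (Psi : 'rV[R]_d -> Prop).
Implicit Types (P Q : {group gT}).

Local Notation gp := (gp rG).
Local Notation Orth := (Orth Phi).

Lemma Orth_root Psi b : Orth Psi b -> Phi b.
Proof. by case. Qed.

Lemma gp_fix Psi w v : w \in gp Psi -> (forall u, Psi u -> u != 0) ->
  (forall u, Psi u -> dot u v = 0) -> v *m rG w = v.
Proof.
move=> wP P0 Pv; move: w wP; apply: gen_ind => [|x y xP yP IH].
  by rewrite repr_mx1 mulmx1.
have xW := subsetP (gp_sub rG Psi) _ xP.
have /refls_inP[yW [b Pb yb]] := yP.
by rewrite repr_mxM // mulmxA IH yb; apply/eqP; rewrite reflmx_fix ?P0 // dotC Pv.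
Qed.

Lemma mem_refls_in Psi b t : Psi b -> t \in W -> rG t = reflmx b ->
  t \in refls_in rG Psi.
Proof. by move=> Pb tW tb; apply/refls_inP; split=> //; exists b. Qed.

(** The group generated by the reflections in [Orth Psi] fixes [Psi] pointwise, so it contains no
    reflection of W beyond its generators. *)
Lemma gp_OrthP Psi b t : Phi b -> t \in W -> rG t = reflmx b ->
  reflect (Orth Psi b) (t \in gp (Orth Psi)).
Proof.
move=> Pb tW tb; apply: (iffP idP) => [|ob]; last first.
  by apply: mem_gen; apply: mem_refls_in tb.
rewrite -[_ \in _]/(t \in (gp (Orth Psi) : {set gT})) -(stabp_gp RS).
case/stabpP => _ tP; split=> // u Pu; apply/eqP.
by rewrite -reflmx_fix ?(rs_neq0 RS Pb) // -tb tP.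
Qed.

Lemma gp_reflections Psi : gp (Orth Psi) :&: reflections rG = refls_in rG (Orth Psi).
Proof.
apply/setP => t; rewrite inE (reflectionsE RS).
apply/andP/idP => [[tP /refls_inP[tW [b Pb tb]]]|tP].
  by apply: (mem_refls_in _ tW tb); apply/(gp_OrthP Psi Pb tW tb).
split; first exact: mem_gen.
by case/refls_inP: tP => tW [b [Pb _] tb]; apply: mem_refls_in tb.
Qed.

(** Valid for any set of roots, closed or not: a root orthogonal to the generating roots is fixed by
    the whole group, hence orthogonal to the roots of all its reflections. *)
Lemma dagger_gp Psi : (forall b, Psi b -> Phi b) ->
  dagger rG (gp Psi) = gp (Orth Psi).
Proof.
move=> PP; congr <<_>>%g; apply/setP => t; rewrite inE.
apply/andP/idP => [[tr /forallP tP]|tO].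
  have [b Pb tb] := reflection_root RS tr; have /reflectionsP[tW _] := tr.
  apply: (mem_refls_in _ tW tb); split=> // u Pu.
  have [x xW xu] := Phi_refl RS (PP _ Pu).
  have xP : x \in gp Psi :&: reflections rG.
    rewrite inE (reflectionsE RS); apply/andP; split.
      by apply: mem_gen; apply: (mem_refls_in Pu xW xu).
    by apply: (mem_refls_in _ xW xu); apply: PP.
  have /implyP/(_ xP)/asboolP[c [e [c0 e0 tc xe ce]]] := tP x.
  have [y y0 ->] := reflmx_inj e0 (etrans (esym xe) xu).
  have [z z0 ->] := reflmx_inj c0 (etrans (esym tc) tb).
  by rewrite dotZl dotZr dotC ce !mulr0.
have /refls_inP[tW [b [Pb ob] tb]] := tO; split.
  by rewrite (reflectionsE RS); apply: mem_refls_in tb.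
apply/forallP => x; apply/implyP; rewrite inE => /andP[xP /reflectionsP[xW [c c0 xc]]].
apply/asboolP; exists b, c; split=> //; first exact: (rs_neq0 RS).
apply/eqP; rewrite -reflmx_fix // -xc; apply/eqP.
by apply: (gp_fix xP) => // u /PP; apply: (rs_neq0 RS).
Qed.

Lemma parabolic_vec P : parabolic rG P ->
  exists v, P = gp (Orth (eq^~ v)).
Proof.
move=> [m [U E]]; have [v vE] := rstab_generic rG U; exists v.
by apply/val_inj; rewrite /= E vE (stabp_gp RS).
Qed.

Lemma parabolic_gp Psi : parabolic rG (gp (Orth Psi)).
Proof. by rewrite -(stabp_gp RS); apply: parabolic_stabp. Qed.

(** P appears twice, as the complement of [v] and as its triple complement. In coordinates the
    double complement of [v] is the one that is computed; it gives Q, and one further complement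
    gives P. *)
Lemma concept_gp P Q : concept rG P Q ->
  exists2 v, P = gp (Orth (eq^~ v)) &
    Q = gp (Orth (Orth (eq^~ v))) /\ P = gp (Orth (Orth (Orth (eq^~ v)))).
Proof.
move=> [pP _ QP PQ]; have [v E] := parabolic_vec pP; exists v => //.
have E' : Q = gp (Orth (Orth (eq^~ v))).
  by apply/val_inj; rewrite /= QP E dagger_gp //; apply: Orth_root.
split=> //; apply/val_inj; rewrite /= PQ E' dagger_gp //; exact: Orth_root.
Qed.

Lemma gp_concept P Q Psi Psi' :
  (forall b, Psi b -> Phi b) -> (forall b, Psi' b -> Phi b) ->
  gp (Orth Psi) = gp Psi' -> gp (Orth Psi') = gp Psi ->
  P :=: gp Psi -> Q :=: gp Psi' -> concept rG P Q.
Proof.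
move=> PP PP' E E' PE QE; rewrite /concept PE QE; split.
- by rewrite -E'; apply: parabolic_gp.
- by rewrite -E; apply: parabolic_gp.
- by rewrite dagger_gp ?E.
- by rewrite dagger_gp ?E'.
Qed.

Lemma reflections_conj t w : w \in W -> t \in reflections rG ->
  (t ^ w)%g \in reflections rG.
Proof.
rewrite (reflectionsE RS) => wW /refls_inP[tW [b Pb tb]].
apply: (mem_refls_in (rs_stable RS wW Pb)); first exact: groupJ.
exact: (rs_conj RS).
Qed.

Lemma perp_conj x y w : x \in W -> y \in W -> w \in W ->
  perp rG x y -> perp rG (x ^ w)%g (y ^ w)%g.
Proof.
move=> xW yW wW [b [c [b0 c0 xb yc bc]]].
have nz u : u != 0 -> u *m rG w != 0.
  by rewrite -!dot_eq0 (rs_isom RS).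
exists (b *m rG w), (c *m rG w); split; rewrite ?nz ?(rs_isom RS) //.
  exact: (rs_conj RS).
exact: (rs_conj RS).
Qed.

Lemma dagger_conj (P : {set gT}) w : w \in W ->
  dagger rG (P :^ w) = dagger rG P :^ w.
Proof.
have half (P' : {set gT}) w' : w' \in W -> dagger rG P' :^ w' \subset dagger rG (P' :^ w').
  move=> wW; rewrite -genJ; apply: genS; apply/subsetP => _ /imsetP[t tD ->].
  have /andP[tr /forallP tP] : (t \in reflections rG) && [forall s in P' :&: reflections rG, `[< perp rG t s >]].
    by move: tD; rewrite inE.
  rewrite inE reflections_conj //; apply/forallP => x; apply/implyP => xP.
  have xr : (x ^ w'^-1)%g \in P' :&: reflections rG.
    move: xP; rewrite !in_setI mem_conjg => /andP[-> xr] /=.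
    exact: reflections_conj (groupVr wW) xr.
  have /implyP/(_ xr)/asboolP tx := tP (x ^ w'^-1)%g.
  have /reflectionsP[tW _] := tr; have /setIP[_ /reflectionsP[xW _]] := xr.
  by apply/asboolP; have := perp_conj tW xW wW tx; rewrite conjgKV.
move=> wW; apply/eqP; rewrite eqEsubset half // andbT.
have := half (P :^ w) _ (groupVr wW); rewrite conjsgK.
by rewrite sub_conjgV.
Qed.

Lemma gp_conj Psi w : w \in W ->
  gp Psi :^ w = gp (fun u => Psi (u *m rG w^-1%g)) :> {set gT}.
Proof.
move=> wW; have wVW := groupVr wW; rewrite -genJ; congr <<_>>%g.
apply/setP => t; rewrite mem_conjg; apply/refls_inP/refls_inP => -[tW [v vP tv]].
  have tW' : t \in W by move: tW; rewrite groupJr.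
  split=> //; exists (v *m rG w); first by rewrite repr_mxK.
  by rewrite -[t](conjgKV w); apply: (rs_conj RS).
split; first by rewrite groupJ.
by exists (v *m rG w^-1%g) => //; apply: (rs_conj RS).
Qed.

Lemma dot_mulV u v w : w \in W -> dot (u *m rG w^-1%g) v = dot u (v *m rG w).
Proof. by move=> wW; rewrite -(rs_isom RS _ _ wW) repr_mxKV. Qed.

Lemma concept_conj P Q w : w \in W -> concept rG P Q ->
  concept rG (P :^ w)%G (Q :^ w)%G.
Proof.
move=> wW [pP pQ QP PQ]; split=> /=.
- exact: parabolic_conj.
- exact: parabolic_conj.
- by rewrite dagger_conj // -QP.
- by rewrite dagger_conj // -PQ.
Qed.

Lemma conceptC P Q : concept rG P Q -> concept rG Q P.
Proof. by case. Qed.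

Lemma dagger_group (P : {set gT}) : exists Q : {group gT}, Q :=: dagger rG P.
Proof. by eexists (generated_group _). Qed.

(** The conjugacy clause of [classified_by] follows from the uniqueness of the label of one fixed
    pair: first members in the same class are conjugate, and [dagger] carries the conjugation over
    to the second members. *)
Lemma classified_by_intro (sT : 'I_n -> gT) (L : label * label -> Prop) :
  (forall c, L c -> is_parabolic_class rG (denote rG sT c.1)
                 /\ is_parabolic_class rG (denote rG sT c.2)) ->
  (forall c, L c -> exists P Q : {group gT},
     [/\ concept rG P Q, denote rG sT c.1 P & denote rG sT c.2 Q]) ->
  (forall P Q, concept rG P Q -> exists2 c, L c & instance_of rG sT c P Q) ->
  (forall c c' P Q, L c -> L c' -> concept rG P Q ->
     denote rG sT c.1 P -> denote rG sT c.2 Q ->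
     (denote rG sT c'.1 P -> denote rG sT c'.2 Q -> c' = c) /\
     (denote rG sT c'.1 Q -> denote rG sT c'.2 P -> c' = (c.2, c.1))) ->
  classified_by rG sT L.
Proof.
move=> cls ex cov uni; split=> // c c' P Q P' Q' Lc Lc' iP iP'.
have conjE C (X Y : {group gT}) w : is_parabolic_class rG (denote rG sT C) -> w \in W ->
    Y :=: X :^ w -> denote rG sT C X -> denote rG sT C Y.
  move=> [P0 _ CP] wW YX /CP[x xW XP]; apply/CP; exists (x * w)%g.
    exact: groupM.
  by rewrite YX XP conjsgM.
have clsc C (X Y : {group gT}) : is_parabolic_class rG (denote rG sT C) ->
    denote rG sT C X -> denote rG sT C Y -> exists2 w, w \in W & Y :=: X :^ w.
  move=> [P0 _ CP] /CP[x xW XP] /CP[y yW YP]; exists (x^-1 * y)%g.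
    by rewrite groupM ?groupV.
  by rewrite conjsgM XP conjsgK.
split.
  move=> [w wW]; have [[c1 c2] [c1' c2']] := (cls _ Lc, cls _ Lc').
  have [cPQ dPQ] := iP; have [_ dPQ'] := iP'.
  have wVW := groupVr wW.
  have back (X Y : {group gT}) : Y :=: X :^ w -> X :=: Y :^ w^-1 by move=> ->; rewrite conjsgK.
  have tr (X Y : {group gT}) : Y :=: X :^ w -> (denote rG sT c'.1 Y -> denote rG sT c'.1 X)
      /\ (denote rG sT c'.2 Y -> denote rG sT c'.2 X).
    by move=> /back E; split; apply: conjE E.
  move=> H.
  have {}dPQ' : denote rG sT c'.1 P /\ denote rG sT c'.2 Q
      \/ denote rG sT c'.1 Q /\ denote rG sT c'.2 P.
    case: H => -[/tr[t1 t2] /tr[t3 t4]]; case: dPQ' => -[x y].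
    - by left; split; [apply: t1|apply: t4].
    - by right; split; [apply: t3|apply: t2].
    - by right; split; [apply: t1|apply: t4].
    - by left; split; [apply: t3|apply: t2].
  case: dPQ => -[cP cQ].
    by have [u1 u2] := uni c c' P Q Lc Lc' cPQ cP cQ; case: dPQ' => -[]; auto.
  have [u1 u2] := uni c c' Q P Lc Lc' (conceptC cPQ) cP cQ.
  by case: dPQ' => -[]; auto.
have {}iP' : c' = c \/ c' = (c.2, c.1) -> instance_of rG sT c P' Q'.
  move=> [E|E]; move: iP'; rewrite E // => -[cPQ dPQ]; split=> //.
  by case: dPQ => -[x y]; [right|left].
move=> /iP'{iP'}[cPQ' dPQ']; have [cPQ dPQ] := iP.
have [cl1 cl2] := cls _ Lc.
have step (X Y X' Y' : {group gT}) : concept rG X Y -> concept rG X' Y' ->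
    denote rG sT c.1 X -> denote rG sT c.1 X' ->
    exists2 w, w \in W & X' :=: X :^ w /\ Y' :=: Y :^ w.
  move=> [_ _ YX _] [_ _ YX' _] dX dX'.
  have [w wW E] := clsc _ _ _ cl1 dX dX'; exists w => //; split=> //.
  by rewrite YX YX' E dagger_conj.
case: dPQ dPQ' => -[x y] [] [x' y'].
- by have [w wW E] := step _ _ _ _ cPQ cPQ' x x'; exists w => //; left.
- have [w wW [E1 E2]] := step _ _ _ _ cPQ (conceptC cPQ') x x'.
  by exists w => //; right; split; [move: E2|move: E1] => ->.
- have [w wW [E1 E2]] := step _ _ _ _ (conceptC cPQ) cPQ' x x'.
  by exists w => //; right; split.
have [w wW [E1 E2]] := step _ _ _ _ (conceptC cPQ) (conceptC cPQ') x x'.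
by exists w => //; left; split.
Qed.

End Concepts.

(** * Types of parabolic subgroups *)

Section Spans.
Variables (R : realType) (d : nat).

(** The columns of the cokernel of [B] are orthogonal to its rows and serve as test vectors. *)
Lemma submx_dual m n (A : 'M[R]_(m, d)) (B : 'M[R]_(n, d)) :
  (forall v, (forall i, dot v (row i B) = 0) -> forall i, dot v (row i A) = 0) ->
  (A <= B)%MS.
Proof.
move=> H; rewrite submxE; apply/eqP/matrixP => i j; rewrite [RHS]mxE.
have dotC' k (C : 'M[R]_(k, d)) i' :
    dot (row j (cokermx B)^T) (row i' C) = (C *m cokermx B) i' j.
  by rewrite dotC dotE mxE; apply: eq_bigr => l _; rewrite !mxE.
transitivity (dot (row j (cokermx B)^T) (row i A)).
  by rewrite mxE dotC dotE; apply: eq_bigr => l _; rewrite !mxE.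
by apply: H => i'; rewrite dotC' mulmx_coker mxE.
Qed.

(** If [u] is in the kernel, then [u *m A] has norm 0, so it vanishes, and [u] with it. *)
Lemma gram_unit m (A : 'M[R]_(m, d)) : row_free A -> A *m A^T \in unitmx.
Proof.
move=> fA; rewrite -row_free_unit -kermx_eq0; apply/eqP/row_matrixP => i.
set u := row i _; rewrite row0; apply: (row_free_inj fA); rewrite mul0mx.
apply/eqP; rewrite -dot_eq0 /dot trmx_mul !mulmxA -(mulmxA u).
by rewrite (sub_kermxP (row_sub _ _)) mul0mx mxE.
Qed.

Lemma eq_on_span m (A : 'M[R]_(m, d)) (X Y : 'M[R]_d) : row_free A ->
  A *m X = A *m Y ->
  (forall v, (forall i, dot v (row i A) = 0) -> v *m X = v *m Y) -> X = Y.
Proof.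
move=> fA AXY H; apply/row_matrixP => i; rewrite !rowE.
move: (delta_mx 0 i) => u; set G := A *m A^T.
(* The coefficients of the orthogonal projection of [u] to the row space. *)
pose c := u *m A^T *m invmx G.
suff E : (u - c *m A) *m X = (u - c *m A) *m Y.
  by move: E; rewrite !mulmxBl -!mulmxA AXY => /addIr.
apply: H => k; have E : (u - c *m A) *m A^T = 0.
  by rewrite mulmxBl -(mulmxA c) mulmxKV ?subrr ?gram_unit.
have -> : dot (u - c *m A) (row k A) = ((u - c *m A) *m A^T) 0 k.
  by rewrite dotE [RHS]mxE; apply: eq_bigr => l _; rewrite !mxE.
by rewrite E mxE.
Qed.

(** On the rows of [A], a reflection is expressed by the coefficients of its root and the Gram
    matrix alone. Families with equal Gram matrices therefore yield equal matrices. *)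
Lemma mul_reflmx_span m (A : 'M[R]_(m, d)) (c : 'rV_m) :
  A *m reflmx (c *m A) =
  (1%:M - (2 / (c *m (A *m A^T) *m c^T) 0 0) *: (A *m A^T *m c^T *m c)) *m A.
Proof.
rewrite /reflmx /dot mulmxBr mulmx1 mulmxBl mul1mx -scalemxAr -scalemxAl.
by rewrite trmx_mul !mulmxA.
Qed.

Lemma row_free_rowsub m n (A : 'M[R]_(n, d)) (g : 'I_m -> 'I_n) :
  injective g -> row_free A -> row_free (\matrix_i row (g i) A).
Proof.
move=> g_inj /row_freeP[B AB]; apply/row_freeP.
exists (B *m \matrix_(k, i) (k == g i)%:R); rewrite mulmxA.
apply/matrixP => i j; rewrite mxE (bigD1 (g i)) //= big1 => [|k ki].
  have -> : ((\matrix_i row (g i) A) *m B) i (g i) = 1.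
    transitivity ((A *m B) (g i) (g i)); last by rewrite AB mxE eqxx.
    by rewrite !mxE; apply: eq_bigr => l _; rewrite !mxE.
  by rewrite mul1r addr0 !mxE (inj_eq g_inj).
have -> : ((\matrix_i row (g i) A) *m B) i k = 0.
  transitivity ((A *m B) (g i) k); last by rewrite AB mxE eq_sym (negPf ki).
  by rewrite !mxE; apply: eq_bigr => l _; rewrite !mxE.
by rewrite mul0r.
Qed.

End Spans.

Section Types.
Variables (R : realType) (gT : finGroupType) (W : {group gT}) (d : nat).
Variable rG : mx_representation R W d.
Variables (n : nat) (s : 'I_n -> gT) (a : 'I_n -> 'rV[R]_d).
Variable Phi : 'rV[R]_d -> Prop.
Hypothesis RS : root_system rG s a Phi.
Implicit Types (w x y z : gT) (u v b : 'rV[R]_d) (P Q : {set gT}).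

(** A simple system without the condition on the angles: independence of the roots alone makes the
    rank an invariant of the subgroup. *)
Definition generated_by r (c : 'I_r -> 'rV[R]_d) P :=
  row_free (\matrix_i c i) /\ exists2 t : 'I_r -> gT,
  forall i, t i \in W /\ rG (t i) = reflmx (c i) & P = <<[set t i | i : 'I_r]>>%g.

Lemma row_free_neq0 r (c : 'I_r -> 'rV[R]_d) i : row_free (\matrix_i c i) -> c i != 0.
Proof.
move=> /row_freeP[B AB]; apply/eqP => ci0.
have := congr1 (row i) AB; rewrite row_mul rowK ci0 mul0mx row1.
by move/rowP/(_ i)/eqP; rewrite !mxE !eqxx eq_sym oner_eq0.
Qed.

Lemma generated_by_sub r (c : 'I_r -> 'rV[R]_d) P : generated_by c P -> P \subset W.
Proof.
by move=> [_ [t tP ->]]; rewrite gen_subG; apply/subsetP => _ /imsetP[i _ ->]; case: (tP i).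
Qed.

Lemma generated_by_fix r (c : 'I_r -> 'rV[R]_d) P v : generated_by c P ->
  (forall i, dot v (c i) = 0) <-> (forall w, w \in P -> v *m rG w = v).
Proof.
move=> [fc [t tP ->]]; split=> [vc w|H i]; last first.
  apply/eqP; rewrite -reflmx_fix ?(row_free_neq0 _ fc) //; have [_ <-] := tP i.
  by apply/eqP/H/mem_gen/imsetP; exists i.
move: w; apply: gen_ind => [|x y xP /imsetP[i _ ->] IH].
  by rewrite repr_mx1 mulmx1.
have xW : x \in W.
  have gP : generated_by c <<[set t i | i : 'I_r]>>%g by split=> //; exists t.
  exact: (subsetP (generated_by_sub gP)).
have [tW ti] := tP i.
rewrite repr_mxM // mulmxA IH ti; apply/eqP.
by rewrite reflmx_fix ?(row_free_neq0 _ fc) // vc.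
Qed.

(** The span of the roots is the orthogonal complement of the vectors fixed by P, hence depends on P
    only. *)
Lemma generated_by_rank r r' (c : 'I_r -> 'rV[R]_d) (c' : 'I_r' -> 'rV[R]_d) P :
  generated_by c P -> generated_by c' P -> r = r'.
Proof.
move=> gc gc'; have [fc _] := gc; have [fc' _] := gc'.
have half q q' (e : 'I_q -> 'rV[R]_d) (e' : 'I_q' -> 'rV[R]_d) :
    generated_by e P -> generated_by e' P -> (\matrix_i e i <= \matrix_i e' i)%MS.
  move=> ge ge'; apply: submx_dual => v vE i; rewrite rowK.
  apply: (generated_by_fix v ge).2; apply: (generated_by_fix v ge').1 => j.
  by have := vE j; rewrite rowK.
by rewrite -(eqP fc) -(eqP fc'); apply/eqP; rewrite eqn_leq !mxrankS ?half.
Qed.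

Lemma generated_by_root r (c : 'I_r -> 'rV[R]_d) P t b : generated_by c P ->
  t \in P -> b != 0 -> rG t = reflmx b -> exists x : 'rV_r, b = x *m \matrix_i c i.
Proof.
move=> gc tP b0 tb; apply/submxP/submx_dual => v vE i; rewrite row_id.
apply/eqP; rewrite -reflmx_fix // -tb; apply/eqP.
by apply: (generated_by_fix v gc).1 tP => j; have := vE j; rewrite rowK.
Qed.

(** With equal Gram matrices, corresponding words have the same matrix on both spans, so a word that
    is a reflection on one side is one on the other. The reflections of P thus inject into those of
    P', and the number of reflections depends on the type only. *)
Lemma generated_by_transfer r (c c' : 'I_r -> 'rV[R]_d) P P' :
  generated_by c P -> generated_by c' P' ->
  (forall i j, dot (c i) (c j) = dot (c' i) (c' j)) ->
  (#|P :&: reflections rG| <= #|P' :&: reflections rG|)%N.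
Proof.
move=> gc gc' cc'; have [fc [t tP PE]] := gc; have [fc' [t' tP' PE']] := gc'.
set A := \matrix_i c i in fc; set A' := \matrix_i c' i in fc'.
have GE : A *m A^T = A' *m A'^T.
  apply/matrixP => i j; transitivity (dot (c i) (c j)).
    by rewrite dotE mxE; apply: eq_bigr => l _; rewrite !mxE.
  by rewrite cc' dotE mxE; apply: eq_bigr => l _; rewrite !mxE.
(* [w'] is obtained by spelling a word for [w] in the other generators; [M] is the common matrix. *)
have lift w : w \in P -> exists2 w', w' \in P' &
    exists2 M, A *m rG w = M *m A & A' *m rG w' = M *m A'.
  have PW := generated_by_sub gc; have PW' := generated_by_sub gc'.
  rewrite PE in PW *; rewrite PE' in PW' *; move: w.
  apply: gen_ind => [|x y xP /imsetP[i _ ->] [x' xP' [M E E']]].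
    by exists 1%g; [exact: group1|exists 1%:M; rewrite repr_mx1 mulmx1 mul1mx].
  have tP'' : t' i \in <<[set t' i | i : 'I_r]>>%g.
    by apply/mem_gen/imsetP; exists i.
  exists (x' * t' i)%g; first exact: groupM.
  have [tW ti] := tP i; have [tW' ti'] := tP' i.
  have ci : c i = delta_mx 0 i *m A by rewrite -rowE rowK.
  have ci' : c' i = delta_mx 0 i *m A' by rewrite -rowE rowK.
  have xW := subsetP PW _ xP; have xW' := subsetP PW' _ xP'.
  have H := mul_reflmx_span A (delta_mx 0 i).
  have H' := mul_reflmx_span A' (delta_mx 0 i).
  rewrite -ci -ti in H; rewrite -ci' -ti' -GE in H'.
  move: (_ - _) H H' => N H H'; exists (M *m N).
    by rewrite repr_mxM // mulmxA E -!mulmxA H.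
  by rewrite repr_mxM // mulmxA E' -!mulmxA H'.
have ex x : exists x', x \in P :&: reflections rG -> x' \in P' :&: reflections rG /\
    exists e : 'rV_r, rG x = reflmx (e *m A) /\ rG x' = reflmx (e *m A').
  have [xPr|] := boolP (x \in P :&: reflections rG); last by exists x.
  have /setIP[xP /reflectionsP[xW [b b0 xb]]] := xPr.
  have [e be] := generated_by_root gc xP b0 xb.
  have [x' xP' [M E E']] := lift x xP; exists x' => _.
  have xW' := subsetP (generated_by_sub gc') _ xP'.
  have e0 : e *m A' != 0.
    rewrite -(mul0mx _ A') (inj_eq (row_free_inj fc')).
    by apply: contraNneq b0 => e0; rewrite be e0 mul0mx.
  (* [x'] agrees with the reflection on the span, by equality of the Gram matrices, and on the
     orthogonal complement, which all of P' fixes. *)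
  have xe : rG x' = reflmx (e *m A').
    apply: (eq_on_span fc').
      rewrite E' mul_reflmx_span -GE; congr (_ *m _).
      by apply: (row_free_inj fc); rewrite -mul_reflmx_span -be -xb.
    move=> v vA'; have /eqP : dot v (e *m A') = 0.
      by rewrite dotC dot_mull big1 // => i _; rewrite dotC vA' mulr0.
    rewrite -reflmx_fix // => /eqP ->.
    by apply: (generated_by_fix v gc').1 xP' => i; have := vA' i; rewrite rowK.
  split; last by exists e; rewrite -be.
  by rewrite inE xP'; apply/reflectionsP; split=> //; exists (e *m A').
pose f x := sval (cid (ex x)).
have fP x (xP : x \in P :&: reflections rG) := svalP (cid (ex x)) xP.
rewrite -(card_in_imset (f := f)).
  by apply/subset_leq_card/subsetP => _ /imsetP[x xP ->]; have [] := fP x xP.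
move=> x y xP yP fxy; have [_ [e [xe fe]]] := fP x xP.
have [_ [e' [ye' fe']]] := fP y yP.
have /setIP[_ /reflectionsP[xW [b b0 xb]]] := xP.
have /setIP[_ /reflectionsP[yW _]] := yP.
apply: (rs_inj RS) => //; rewrite xe ye'.
have e0 : e *m A' != 0.
  rewrite -(mul0mx _ A') (inj_eq (row_free_inj fc')).
  apply: contra_neq (reflmx_neq1 b0) => e0.
  by rewrite -xb xe e0 mul0mx reflmx0.
have [z z0 E] := reflmx_inj e0 (etrans (esym fe) (etrans (congr1 rG fxy) fe')).
have -> : e' = z *: e by apply: (row_free_inj fc'); rewrite -scalemxAl.
by rewrite -scalemxAl reflmxZ.
Qed.

Lemma simple_system_generated (D : diagram) (t : 'I_D.1 -> gT) P :
  simple_system rG t P -> exists2 c : 'I_D.1 -> 'rV[R]_d, generated_by c P &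
    forall i j, dot (c i) (c j) = - cos (pi / (cox_entry D i.+1 j.+1)%:R).
Proof. by move=> [c [fc cE tP PE]]; exists c => //; split=> //; exists t. Qed.

Lemma has_type_card Xs P P' : has_type rG Xs P -> has_type rG Xs P' ->
  #|P :&: reflections rG| = #|P' :&: reflections rG|.
Proof.
move=> [t /simple_system_generated[c gc cE]] [t' /simple_system_generated[c' gc' cE']].
apply/eqP; rewrite eqn_leq (generated_by_transfer gc gc') => [|i j].
  by rewrite (generated_by_transfer gc' gc) // => i j; rewrite cE cE'.
by rewrite cE cE'.
Qed.

Lemma has_type_rank Xs r (c : 'I_r -> 'rV[R]_d) P :
  has_type rG Xs P -> generated_by c P -> (product_diagram Xs).1 = r.
Proof. by move=> [t /simple_system_generated[c' gc' _]] /(generated_by_rank gc'). Qed.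

Lemma generated_by_conj r (c : 'I_r -> 'rV[R]_d) P w : w \in W ->
  generated_by c P -> generated_by (fun i => c i *m rG w) (P :^ w).
Proof.
move=> wW [fc [t tP ->]]; split.
  have -> : \matrix_i (c i *m rG w) = (\matrix_i c i) *m rG w.
    by apply/row_matrixP => i; rewrite row_mul !rowK.
  by rewrite /row_free mxrankMfree // row_free_unit repr_mx_unit.
exists (fun i => (t i ^ w)%g) => [i|].
  by have [tW ti] := tP i; rewrite groupJ //; split=> //; apply: (rs_conj RS).
rewrite -genJ; congr <<_>>%g; apply/setP => x; rewrite mem_conjg.
apply/imsetP/imsetP => -[i _ E]; exists i; rewrite // ?E ?conjgK //.
by rewrite -E conjgKV.
Qed.

Lemma has_type_conj Xs P w : w \in W -> has_type rG Xs P -> has_type rG Xs (P :^ w).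
Proof.
move=> wW [t [c [fc cE tP PE]]].
have gc : generated_by c P by split=> //; exists t.
have [fc' [t' tP' PE']] := generated_by_conj wW gc.
exists t', (fun i => c i *m rG w); split=> // i j.
by rewrite (rs_isom RS).
Qed.

Lemma stdp_generated (J : {set 'I_n}) :
  generated_by (fun i : 'I_#|J| => a (enum_val i)) (stdp s J).
Proof.
split.
  have -> : \matrix_i a (enum_val i : 'I_n) = \matrix_(i < #|J|) row (enum_val i) (\matrix_i a i).
    by apply/row_matrixP => i; rewrite !rowK.
  by apply: row_free_rowsub (rs_free RS); apply: enum_val_inj.
exists (fun i => s (enum_val i)) => [i|].
  by split; [apply: (rs_in RS)|apply: (rs_refl RS)].
congr <<_>>%g; apply/setP => x; apply/imsetP/imsetP => -[i iJ ->].
  by exists (enum_rank_in iJ i); rewrite ?enum_rankK_in.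
by exists (enum_val i) => //; apply: enum_valP.
Qed.

Lemma stdp_rank Xs (J : {set 'I_n}) w : w \in W ->
  has_type rG Xs (stdp s J :^ w) -> #|J| = (product_diagram Xs).1.
Proof.
move=> wW H; symmetry; apply: (has_type_rank H).
exact: generated_by_conj (stdp_generated J).
Qed.

Lemma stdp_has_type (D : diagram) (en : D.1 = n) Xs (g : nat -> 'I_n) :
  @simple_system R gT W d rG D (fun i => s (cast_ord en i)) W ->
  (forall i j, i < (product_diagram Xs).1 -> j < (product_diagram Xs).1 ->
    g i = g j -> i = j)%N ->
  (forall i j, i < (product_diagram Xs).1 -> j < (product_diagram Xs).1 ->
    cox_entry (product_diagram Xs) i.+1 j.+1 = cox_entry D (g i).+1 (g j).+1)%N ->
  has_type rG Xs (stdp s [set g (i : 'I_(product_diagram Xs).1) | i : 'I__]).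
Proof.
case: D en => m E /= en; subst m.
move=> [c [fc cE sP _]] g_inj gE.
exists (fun i => s (g i)); exists (fun i => c (g i)); split.
- have -> : \matrix_(i < (product_diagram Xs).1) c (g i) =
      \matrix_(i < (product_diagram Xs).1) row (g i) (\matrix_i c i).
    by apply/row_matrixP => i; rewrite !rowK.
  apply: row_free_rowsub fc => i j E'; apply/val_inj/(g_inj i j) => //.
- by move=> i j; rewrite cE gE.
- by move=> i; have := sP (g i); rewrite cast_ord_id.
congr <<_>>%g; apply/setP => x.
apply/imsetP/imsetP => [[_ /imsetP[i _ ->] ->]|[i _ ->]]; first by exists i.
by exists (g i) => //; apply/imsetP; exists i.
Qed.

End Types.

(** * Types E, F and H *)

(* The pair (x, y) stands for x + y phi, where phi = 2 cos (pi / 5) satisfies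
   phi^2 = phi + 1. *)
Definition golden : Type := (Z * Z)%type.

Definition g0 : golden := (Z0, Z0).
Definition g1 : golden := (Zpos xH, Z0).

Definition gadd (x y : golden) : golden :=
  (BinInt.Z.add x.1 y.1, BinInt.Z.add x.2 y.2).

Definition gopp (x : golden) : golden := (BinInt.Z.opp x.1, BinInt.Z.opp x.2).

Definition gmul (x y : golden) : golden :=
  let t := BinInt.Z.mul x.2 y.2 in
  (BinInt.Z.add (BinInt.Z.mul x.1 y.1) t,
   BinInt.Z.add (BinInt.Z.add (BinInt.Z.mul x.1 y.2) (BinInt.Z.mul x.2 y.1)) t).

(** A sufficient condition for nonnegativity; the positive roots of H_3 and H_4 have coefficients of
    this kind, as [roots_ok] confirms. *)
Definition gnneg (x : golden) : bool := BinInt.Z.leb Z0 x.1 && BinInt.Z.leb Z0 x.2.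

Definition gdot (u v : seq golden) : golden :=
  foldr (fun p t => gadd (gmul p.1 p.2) t) g0 (zip u v).

(* Nodes are numbered from 0 here.  Roots are lists of coefficients over the
   rescaled simple roots b_j; the i-th entry of [nth [::] cols j] is the
   coefficient 2 <b_i, b_j> / <b_j, b_j>, and [norms] lists the <b_j, b_j>.
   A set of nodes is given by its mask. *)
Definition unitv (n j : nat) : seq golden :=
  [seq (if i == j then g1 else g0) | i <- iota 0 n].

Definition coroot (cols : seq (seq golden)) (c : seq golden) (j : nat) : golden :=
  gdot c (nth [::] cols j).

Definition srefl cols c j : seq golden :=
  set_nth g0 c j (gadd (nth g0 c j) (gopp (coroot cols c j))).

Definition srefls cols c (l : seq nat) := foldl (srefl cols) c l.

(** Closes the simple roots layer by layer under the simple reflections, keeping positive roots.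
    Completeness is certified afterwards by [roots_ok]; the 60 rounds used below exceed the number
    of layers in each type. *)
Fixpoint gen_roots n cols fuel (layer acc : seq (seq golden)) : seq (seq golden) :=
  if fuel is k.+1 then
    let next := undup [seq r <- [seq srefl cols c j | c <- layer, j <- iota 0 n]
                      | all gnneg r && (r \notin acc)] in
    if next is [::] then acc else gen_roots n cols k next (acc ++ next)
  else acc.

Definition positive_roots n cols : seq (seq golden) :=
  let simple := [seq unitv n j | j <- iota 0 n] in gen_roots n cols 60 simple simple.

(** The axioms of [root_system] in decidable form, for positive roots only: a simple reflection
    keeps all of them in the list except its own root, and a root supported on one node is
    simple. *)
Definition roots_ok n cols (roots : seq (seq golden)) : bool :=
  [&& all (fun j => unitv n j \in roots) (iota 0 n),
      all (fun c => [&& size c == n, all gnneg c, has (fun x => x != g0) c,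
        all (fun j => (srefl cols c j \in roots) || (c == unitv n j)) (iota 0 n)
      & all (fun j => all (fun i => (i == j) || (nth g0 c i == g0)) (iota 0 n)
                      ==> (c == unitv n j)) (iota 0 n)]) roots
    & uniq roots].

Definition supported n (m : seq bool) (c : seq golden) : bool :=
  all (fun i => nth false m i || (nth g0 c i == g0)) (iota 0 n).

Definition roots_of n (roots : seq (seq golden)) (m : seq bool) :=
  [seq c <- roots | supported n m c].

(** The j-th entry is 2 <c, b_j>, so that pairing the list with the coefficients of [e] gives 2 <c,
    e>; the factor 2 keeps the entries in Z[phi]. *)
Definition weigh cols norms n (c : seq golden) : seq golden :=
  [seq gmul (coroot cols c j) (nth g0 norms j) | j <- iota 0 n].

Definition perp_roots n cols norms (roots l : seq (seq golden)) :=
  [seq c <- roots | let w := weigh cols norms n c in all (fun e => gdot w e == g0) l].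

(** Compares twice the squared length with 4: after rescaling, the long roots of F_4 have squared
    length 2. In types E and H all roots have length 1 and none is long. *)
Definition long_root n cols norms (c : seq golden) : bool :=
  gdot (weigh cols norms n c) c == (Zpos (xO (xO xH)), Z0).

Definition nodes n (m : seq bool) : seq nat := [seq j <- iota 0 n | nth false m j].

Definition mask_of n (l : seq nat) : seq bool := [seq j \in l | j <- iota 0 n].

Definition simples_of n (m : seq bool) := [seq unitv n j | j <- nodes n m].

(* The numbers game: starting from a vector whose pairings with the simple
   coroots in [l] are -1, reflect until they are nonnegative.  The result is a
   reduced word of the longest element of the subgroup generated by [l]. *)
Fixpoint longest_word n (cols : seq (seq golden)) fuel (l : seq nat) (x : seq golden) : seq nat :=
  if fuel is k.+1 then
    if [seq j <- l | ~~ gnneg (nth g0 x j)] is j :: _ then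
      j :: longest_word n cols k l
        [seq gadd (nth g0 x i) (gopp (gmul (nth g0 x j) (nth g0 (nth [::] cols i) j)))
        | i <- iota 0 n]
    else [::]
  else [::].

(** The bound 130 exceeds 120, the length of the longest element of E_8 and the greatest that
    occurs. *)
Definition longest n cols (m : seq bool) : seq nat :=
  longest_word n cols 130 (nodes n m)
    [seq (if nth false m j then gopp g1 else g0) | j <- iota 0 n].

Definition add_node (m : seq bool) j := set_nth false m j true.

(* w_0(m) w_0(m + i) conjugates the standard parabolic subgroup of [m] to a
   standard one. *)
Definition move n cols (m : seq bool) (i : nat) : seq bool :=
  let l := longest n cols m ++ longest n cols (add_node m i) in
  let images := [seq srefls cols (unitv n j) l | j <- nodes n m] in
  let support c := find (fun x => x != g0) c in
  if all (fun c => let k := support c in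
          (k < n)%N && ((c == unitv n k) || (c == [seq gopp x | x <- unitv n k]))) images
  then mask_of n [seq support c | c <- images] else m.

Fixpoint closure n cols fuel (todo seen : seq (seq bool)) : seq (seq bool) :=
  if fuel is k.+1 then
    if todo is m :: t then
      let next := undup [seq m' <- [seq move n cols m i | i <- iota 0 n & ~~ nth false m i]
                        | m' \notin seen] in
      closure n cols k (next ++ t) (next ++ seen)
    else seen
  else seen.

(** At most 70 subsets of eight nodes have the same size, and each enters the list of tasks once, so
    200 rounds are enough. *)
Definition conj_masks n cols (m : seq bool) := closure n cols 200 [:: m] [:: m].

Fixpoint masks (n : nat) : seq (seq bool) :=
  if n is k.+1 then [seq b :: m | b <- [:: true; false], m <- masks k] else [:: [::]].

Definition weight n cols norms (l : seq (seq golden)) : nat * nat :=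
  (size l, count (long_root n cols norms) l).

(** For the standard parabolic P of [m]: the weights of P and of its complement, and the number of
    positive roots of its double complement. The latter equals the number of positive roots of P
    exactly when P is closed. *)
Definition info n cols norms roots (m : seq bool) :=
  let p := perp_roots n cols norms roots (simples_of n m) in
  (m, (weight n cols norms (roots_of n roots m), weight n cols norms p,
       size (perp_roots n cols norms roots p))).

(** The Cartan entry 2 <b_i, b_j> / <b_j, b_j> when the unit simple roots of the first [lng] nodes
    are stretched by sqrt 2; [lng] is 2 in type F_4 and 0 in types E and H. *)
Definition label_ind (D : diagram) (lng i j : nat) : golden :=
  if i == j then (Zpos (xO xH), Z0) else
  match cox_entry D i.+1 j.+1 with
  | 3 => (Zneg xH, Z0)
  | 4 => (if (i < lng)%N then Zneg (xO xH) else Zneg xH, Z0)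
  | 5 => (Z0, Zneg xH)
  | _ => g0
  end%N.

Definition cartan_cols (D : diagram) lng : seq (seq golden) :=
  [seq [seq label_ind D lng i j | i <- iota 0 D.1] | j <- iota 0 D.1].

Definition norms_of (D : diagram) lng : seq golden :=
  [seq (if (j < lng)%N then (Zpos (xO xH), Z0) else g1) | j <- iota 0 D.1].

(** * Special values of the cosine, and the real values of elements of Z[phi] *)

Section Trigonometry.
Variable R : realType.

(** Since 2x = pi - x, the duplication formula is a quadratic equation for cos x, with roots 1/2 and
    -1. *)
Lemma cos_pi3 : cos (pi / 3) = 1 / 2 :> R.
Proof.
set x : R := pi / 3; have E : x *+ 2 = pi - x by rewrite /x; field.
have := cos_mulr2n x; rewrite E cosB cospi sinpi mul0r addr0 mulN1r => H.
have c0 : 0 < cos x.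
  by apply: cos_gt0_pihalf; have := pi_gt0 R; rewrite /x => ?; apply/andP; split; lra.
have : (2 * cos x - 1) * (cos x + 1) = 0 by rewrite -mulr_natl in H; nra.
move/eqP; rewrite mulf_eq0 => /orP[/eqP|/eqP]; lra.
Qed.

Lemma cos_pi4 : Num.sqrt 2 * cos (pi / 4) = 1 :> R.
Proof.
set x : R := pi / 4; have E : x *+ 2 = pi / 2 by rewrite /x; field.
have := cos_mulr2n x; rewrite E cos_pihalf => H.
have c0 : 0 < cos x.
  by apply: cos_gt0_pihalf; have := pi_gt0 R; rewrite /x => ?; apply/andP; split; lra.
have s0 : 0 <= Num.sqrt 2 * cos x by rewrite mulr_ge0 ?sqrtr_ge0 // ltW.
apply/eqP; rewrite -(@eqrXn2 _ 2) // expr1n exprMn sqr_sqrtr //.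
by apply/eqP; rewrite -mulr_natl in H; lra.
Qed.

Definition phi : R := 2 * cos (pi / 5).

Lemma phi_gt0 : 0 < phi.
Proof.
rewrite mulr_gt0 //; apply: cos_gt0_pihalf; have := pi_gt0 R => ?.
by apply/andP; split; lra.
Qed.

(* cos 3x = - cos 2x at x = pi / 5. *)
Lemma phi_sqr : phi ^+ 2 = phi + 1.
Proof.
set x : R := pi / 5; have E : x *+ 2 + x = pi - x *+ 2 by rewrite /x; field.
have := congr1 (@cos R) E; rewrite cosB cospi sinpi mul0r addr0 mulN1r cosD.
rewrite sin_mulr2n cos_mulr2n.
have := phi_gt0; rewrite /phi -/x; have := cos2Dsin2 x.
move: (cos x) (sin x) => c t ct c0 H.
have : (c + 1) * (4 * c ^+ 2 - 2 * c - 1) = 0.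
  have t2 : t ^+ 2 = 1 - c ^+ 2 by rewrite -ct addrAC subrr add0r.
  transitivity ((c ^+ 2 *+ 2 - 1) * c - 2 * c * (1 - c ^+ 2) + (c ^+ 2 *+ 2 - 1)).
    by ring.
  by rewrite -t2; move: H => /eqP; rewrite -subr_eq0 opprK => /eqP <-; ring.
move/eqP; rewrite mulf_eq0 => /orP[/eqP|/eqP] E'; first lra.
by rewrite exprMn; lra.
Qed.

Definition ev (x : golden) : R :=
  (int_of_Z x.1)%:~R + (int_of_Z x.2)%:~R * phi.

Lemma ev0 : ev g0 = 0.
Proof. by rewrite /ev /= mul0r addr0. Qed.

Lemma ev1 : ev g1 = 1.
Proof. by rewrite /ev /= mul0r addr0. Qed.

Lemma ev2 : ev (Zpos (xO xH), Z0) = 2.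
Proof. by rewrite /ev /= mul0r addr0. Qed.

Lemma evN1 : ev (Zneg xH, Z0) = -1.
Proof. by rewrite /ev /= mul0r addr0. Qed.

Lemma evN2 : ev (Zneg (xO xH), Z0) = -2.
Proof. by rewrite /ev /= mul0r addr0. Qed.

Lemma evNphi : ev (Z0, Zneg xH) = - phi.
Proof. by rewrite /ev /= mulN1r add0r. Qed.

Lemma evD x y : ev (gadd x y) = ev x + ev y.
Proof.
rewrite /ev /gadd /= -![BinInt.Z.add _ _]/(_ + _ : Z) !rmorphD /=.
by rewrite mulrDl addrACA.
Qed.

Lemma evN x : ev (gopp x) = - ev x.
Proof.
rewrite /ev /gopp /= -![BinInt.Z.opp _]/(- _ : Z) !rmorphN /=.
by rewrite mulNr opprD.
Qed.

Lemma evM x y : ev (gmul x y) = ev x * ev y.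
Proof.
rewrite /ev /gmul /= -![BinInt.Z.add _ _]/(_ + _ : Z).
rewrite -![BinInt.Z.mul _ _]/(_ * _ : Z) !rmorphD !rmorphM /=.
have := phi_sqr; rewrite expr2 => E.
set a := (int_of_Z x.1)%:~R; set b := (int_of_Z x.2)%:~R.
set c := (int_of_Z y.1)%:~R; set e := (int_of_Z y.2)%:~R.
transitivity (a * c + (a * e + b * c) * phi + b * e * (phi * phi)); last by ring.
by rewrite E; ring.
Qed.

Lemma ev_ge0 x : gnneg x -> 0 <= ev x.
Proof.
have Z0 z : BinInt.Z.leb BinNums.Z0 z -> 0 <= (int_of_Z z)%:~R :> R.
  by rewrite ler0z; case: z.
move=> /andP[/Z0 h1 /Z0 h2]; rewrite addr_ge0 // mulr_ge0 // ltW //.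
exact: phi_gt0.
Qed.

(* The norm of [x] vanishes, and 5 is not a rational square. *)
Lemma ev_eq0 x : (ev x == 0) = (x == g0).
Proof.
apply/eqP/eqP => [|->]; last exact: ev0.
case: x => a b; rewrite /ev /= => H.
have E : ((int_of_Z a *+ 2 + int_of_Z b) ^+ 2)%:~R = (5 * int_of_Z b ^+ 2)%:~R :> R.
  rewrite !rmorphXn /= rmorphM rmorphXn rmorphD !rmorphMn /= mulr1z.
  have := phi_sqr; move: H.
  set u := (int_of_Z a)%:~R; set v := (int_of_Z b)%:~R; move=> H HP.
  have -> : u = - (v * phi) by apply/eqP; rewrite -addr_eq0 H.
  transitivity (v ^+ 2 * (4 * phi ^+ 2 - 4 * phi + 1)); first by ring.
  by rewrite HP; ring.
have {}E : (absz (int_of_Z a *+ 2 + int_of_Z b)%R ^ 2 = 5 * absz (int_of_Z b) ^ 2)%N.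
  by move/eqP: E; rewrite eqr_int => /eqP/(congr1 absz); rewrite abszX abszM abszX.
have b0 : int_of_Z b = 0.
  apply/eqP; rewrite -absz_eq0 -leqn0 leqNgt; apply/negP => b_gt0.
  (* The exponent of 5 is even on the left and odd on the right. *)
  have := congr1 (logn 5) E; rewrite lognM ?expn_gt0 ?b_gt0 // !lognX.
  by move/(congr1 odd); rewrite oddD !oddM /=.
have a0 : int_of_Z a = 0.
  by apply/eqP; move/eqP: H; rewrite b0 mul0r addr0 intr_eq0.
by rewrite /g0; congr (_, _); rewrite -[LHS]int_of_ZK ?a0 ?b0.
Qed.

End Trigonometry.

(** * Root tables as models of the root system *)

Section Model.
Variables (R : realType) (gT : finGroupType) (W : {group gT}) (d : nat).
Variable rG : mx_representation R W d.
Variables (n : nat) (s : 'I_n -> gT) (b : 'I_n -> 'rV[R]_d).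
Variables (cols : seq (seq golden)) (norms : seq golden) (roots : seq (seq golden)).

Record is_model : Prop := IsModel {
  model_faithful : mx_faithful rG;
  model_gen : W :=: <<[set s i | i : 'I_n]>>%g;
  model_in : forall i, s i \in W;
  model_refl : forall i, rG (s i) = reflmx (b i);
  model_free : row_free (\matrix_i b i);
  model_cols : forall j : 'I_n, size (nth [::] cols j) = n;
  model_norm : forall j : 'I_n, dot (b j) (b j) = ev R (nth g0 norms j);
  model_gram : forall i j : 'I_n,
    2 * dot (b i) (b j) = ev R (nth g0 (nth [::] cols j) i) * dot (b j) (b j);
  model_roots : roots_ok n cols roots
}.

Hypothesis M : is_model.
Let W_faithful := model_faithful M.
Let W_gen := model_gen M.
Let s_in := model_in M.
Let s_refl := model_refl M.
Let b_free := model_free M.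
Let size_cols := model_cols M.
Let b_norm := model_norm M.
Let b_gram := model_gram M.
Let roots_okP := model_roots M.
Hint Resolve s_in : core.

Implicit Types (c e : seq golden) (m : seq bool).

Definition vec c : 'rV[R]_d := \sum_(i < n) ev R (nth g0 c i) *: b i.

Definition vecs (l : seq (seq golden)) v := exists2 c, c \in l & v = vec c.

Definition model v := exists2 c, c \in roots & v = vec c \/ v = - vec c.

Lemma ev_gdot k u v : size u = k -> size v = k ->
  ev R (gdot u v) = \sum_(i < k) ev R (nth g0 u i) * ev R (nth g0 v i).
Proof.
elim: k u v => [|k IH] [|x u] [|y v] //= => [_ _|[su] [sv]].
  by rewrite big_ord0 ev0.
by rewrite big_ord_recl /= -IH // /gdot /= evD evM.
Qed.

Lemma vecE c : vec c = (\row_i ev R (nth g0 c i)) *m \matrix_i b i.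
Proof. by rewrite mulmx_sum_row; apply: eq_bigr => i _; rewrite rowK mxE. Qed.

Lemma b_neq0 i : b i != 0.
Proof. exact: row_free_neq0 b_free. Qed.

Lemma vec_inj c e : size c = n -> size e = n -> vec c = vec e -> c = e.
Proof.
move=> sc se; rewrite !vecE => /(row_free_inj b_free)/rowP H.
apply: (@eq_from_nth _ g0) => [|i]; rewrite sc // => ic.
have /eqP := H (Ordinal ic); rewrite !mxE /= -subr_eq0 -evN -evD ev_eq0.
case: (nth g0 c i) (nth g0 e i) => [x1 x2] [y1 y2] /eqP[/eqP E1 /eqP E2].
by congr (_, _); apply/eqP; rewrite -subr_eq0.
Qed.

Lemma vec_unitv (j : 'I_n) : vec (unitv n j) = b j.
Proof.
rewrite /vec (bigD1 j) //= big1 => [|i ij].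
  by rewrite (nth_map 0%N) ?size_iota // nth_iota // eqxx ev1 scale1r addr0.
by rewrite (nth_map 0%N) ?size_iota // nth_iota // add0n ifN // ev0 scale0r.
Qed.

Lemma size_unitv j : size (unitv n j) = n.
Proof. by rewrite size_map size_iota. Qed.

Lemma vec_opp c : size c = n -> vec [seq gopp x | x <- c] = - vec c.
Proof.
move=> sc; rewrite /vec -sumrN; apply: eq_bigr => i _.
by rewrite (nth_map g0) ?sc // evN scaleNr.
Qed.

Lemma dot_vec_b c (j : 'I_n) : size c = n ->
  2 * dot (vec c) (b j) = ev R (coroot cols c j) * dot (b j) (b j).
Proof.
move=> sc; rewrite (ev_gdot sc) // /vec dot_suml mulr_sumr mulr_suml.
by apply: eq_bigr => i _; rewrite dotZl mulrCA b_gram mulrA.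
Qed.

Lemma size_srefl c j : size c = n -> (j < n)%N -> size (srefl cols c j) = n.
Proof. by move=> sc jn; rewrite size_set_nth sc; apply/maxn_idPr. Qed.

Lemma vec_srefl c (j : 'I_n) : size c = n ->
  vec (srefl cols c j) = vec c *m reflmx (b j).
Proof.
move=> sc; rewrite reflmxE dot_vec_b // mulfK ?dot_eq0 ?b_neq0 //.
rewrite /vec (bigD1 j) //= [X in _ = X - _](bigD1 j) //=.
rewrite nth_set_nth /= eqxx evD evN scalerDl scaleNr.
rewrite addrAC; congr (_ + _ - _).
by apply: eq_bigr => i ij; rewrite nth_set_nth /= ifN.
Qed.

Lemma dot_vec c e : size c = n -> size e = n ->
  2 * dot (vec c) (vec e) = ev R (gdot (weigh cols norms n c) e).
Proof.
move=> sc se; rewrite (ev_gdot (k := n)) //; last by rewrite size_map size_iota.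
rewrite dotC {1}/vec dot_suml mulr_sumr; apply: eq_bigr => j _.
rewrite dotZl mulrCA dotC dot_vec_b // (nth_map 0%N) ?size_iota // nth_iota //.
by rewrite add0n evM b_norm mulrC.
Qed.

Lemma roots_okE :
  [/\ forall j : 'I_n, unitv n j \in roots,
      forall c, c \in roots -> [/\ size c = n, all gnneg c, has (fun x => x != g0) c,
        forall j : 'I_n, (srefl cols c j \in roots) \/ c = unitv n j
      & forall j : 'I_n, (forall i : 'I_n, i != j -> nth g0 c i = g0) -> c = unitv n j]
    & uniq roots].
Proof.
case/and3P: roots_okP => /allP r1 /allP r2 r3; split=> // [j|c /r2].
  by apply: r1; rewrite mem_iota ltn_ord.
move=> /and5P[/eqP sc c0 cn /allP h1 /allP h2]; split=> // j.
  have := h1 j; rewrite mem_iota ltn_ord => /(_ isT) /orP[|/eqP]; by [left|right].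
have := h2 j; rewrite mem_iota ltn_ord => /(_ isT) /implyP H H'.
apply/eqP/H/allP => i; rewrite mem_iota => /= ni.
by have [//|ij] := eqVneq i j; rewrite (H' (Ordinal ni)).
Qed.

Lemma root_size c : c \in roots -> size c = n.
Proof. by have [_ h _] := roots_okE; case/h. Qed.

Lemma root_nneg c (i : nat) : c \in roots -> 0 <= ev R (nth g0 c i).
Proof.
have [_ h _] := roots_okE => /h[sc /all_nthP c0 _ _ _].
have [ic|ci] := ltnP i (size c); first exact/ev_ge0/c0.
by rewrite nth_default // ev0.
Qed.

Lemma vec_neq0 c : c \in roots -> vec c != 0.
Proof.
have [_ h _] := roots_okE => /h[sc _ /(hasP)[x /(nthP g0)[i ic <-] cx] _ _].
apply: contra cx => /eqP; rewrite vecE => H.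
have /rowP/(_ (Ordinal (eq_ind _ (fun k => (i < k)%N) ic _ sc))) :
    (\row_i ev R (nth g0 c i)) = 0 :> 'rV_n.
  by apply: (row_free_inj b_free); rewrite H mul0mx.
by rewrite !mxE /= => /eqP; rewrite ev_eq0.
Qed.

Lemma model_root_system : root_system rG s b model.
Proof.
have [h1 h2 h3] := roots_okE; split=> //.
- by move=> i; exists (unitv n i); rewrite ?vec_unitv //; left.
- by move=> v [c /vec_neq0 c0 [->|->]]; rewrite ?oppr_eq0.
- move=> v j [c cr cv]; have [sc _ _ H _] := h2 _ cr.
  have [cj|cj] := H j.
    exists (srefl cols c j); rewrite ?vec_srefl //.
    by case: cv => ->; [left|right; rewrite mulNmx].
  exists c => //; move: cv; rewrite cj vec_unitv => -[->|->].
    by right; rewrite reflmx_id ?b_neq0.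
  by left; rewrite mulNmx reflmx_id ?b_neq0 // opprK.
- move=> v [c cr cv]; exists ((if v == vec c then 1 else -1) *: \row_i ev R (nth g0 c i)).
    rewrite -scalemxAl -vecE; case: ifP => [/eqP ->|vc]; first by rewrite scale1r.
    by case: cv => cv; rewrite ?scaleN1r // cv eqxx in vc *.
  case: ifP => _; [left|right] => i; rewrite !mxE; have := root_nneg i cr; lra.
move=> i x [c cr cv]; have [sc _ _ _ H] := h2 _ cr.
have [y xy] : exists y, vec c = y *: b i.
  case: cv => E; first by exists x.
  by exists (- x); rewrite scaleNr E opprK.
have ci : c = unitv n i.
  apply: H => k ki; apply/eqP; rewrite -(ev_eq0 R).
  have /rowP/(_ k) : \row_i ev R (nth g0 c i) = y *: delta_mx 0 i.
    by apply: (row_free_inj b_free); rewrite -vecE xy -scalemxAl -rowE rowK.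
  by rewrite !mxE eqxx (negPf ki) mulr0 => ->.
have b0 := b_neq0 i; move: cv; rewrite ci vec_unitv -[X in _ = X \/ _]scale1r -scaleN1r.
by case=> /eqP; rewrite -subr_eq0 -scalerBl scaler_eq0 (negPf b0) orbF subr_eq0 => /eqP; auto.
Qed.

Local Notation RS := model_root_system.

Definition mset m : {set 'I_n} := [set i : 'I_n | nth false m i].

Definition long_refls : {set gT} :=
  refls_in rG (fun v => model v /\ dot v v = 2).

Definition inv (P : {set gT}) : nat * nat :=
  (#|P :&: reflections rG|, #|P :&: long_refls|).

Definition conj_std m (P : {set gT}) := exists2 w, w \in W & P = stdp s (mset m) :^ w.

Lemma root_model c : c \in roots -> model (vec c).
Proof. by exists c => //; left. Qed.

Lemma vecs_model l : {subset l <= roots} -> forall v, vecs l v -> model v.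
Proof. by move=> lr v [c cl ->]; apply/root_model/lr. Qed.

Lemma perp_roots_sub l : {subset perp_roots n cols norms roots l <= roots}.
Proof. by move=> c; rewrite mem_filter => /andP[]. Qed.

Lemma perp_rootsP l c : {subset l <= roots} -> c \in roots ->
  reflect (forall v, vecs l v -> dot v (vec c) = 0)
          (c \in perp_roots n cols norms roots l).
Proof.
move=> lr cr; have two0 : 2 != 0 :> R by rewrite pnatr_eq0.
rewrite mem_filter cr andbT; apply: (iffP allP) => [H _ [e el ->]|H e el].
  have /eqP := H e el; have := dot_vec (root_size cr) (root_size (lr _ el)).
  move=> E E'; move: E; rewrite E' ev0 => /eqP.
  by rewrite mulf_eq0 (negPf two0) dotC => /eqP.
rewrite -(ev_eq0 R) -dot_vec ?root_size // ?lr // dotC H ?mulr0 //.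
by exists e.
Qed.

Lemma perp_refls l : {subset l <= roots} ->
  refls_in rG (Orth model (vecs l)) =
  refls_in rG (vecs (perp_roots n cols norms roots l)).
Proof.
move=> lr; apply/setP => t; apply/refls_inP/refls_inP => -[tW [v vP tv]]; split=> //.
  have [[c cr cv] ov] := vP; exists (vec c).
    exists c => //; apply/perp_rootsP => // u ul.
    by have := ov u ul; case: cv => ->; rewrite ?dotNr // => /eqP; rewrite oppr_eq0 => /eqP.
  by rewrite tv; case: cv => ->; rewrite ?reflmxN.
exists v => //; have [c cp ->] := vP; split.
  exact/root_model/perp_roots_sub/cp.
by apply/perp_rootsP => //; apply: perp_roots_sub cp.
Qed.

(** A standard parabolic is the stabilizer of a dominant [v] orthogonal to exactly the simple roots
    of [m]. The pairing of a positive root with [v] is a sum of nonnegative terms, so it vanishes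
    only if the root is supported on [m]. *)
Lemma stdp_refls m : exists v, stdp s (mset m) = gp rG (Orth model (eq^~ v)) /\
  refls_in rG (Orth model (eq^~ v)) = refls_in rG (vecs (roots_of n roots m)).
Proof.
have [v [dv vE vS]] := stdp_vec RS (mset m); exists v; split.
  by apply/val_inj; rewrite /= vS (stabp_gp RS).
have dot_v c : c \in roots -> (dot v (vec c) == 0) = supported n m c.
  move=> cr; rewrite dotC /vec dot_suml psumr_eq0 => [|i _]; last first.
    by rewrite dotZl mulr_ge0 ?root_nneg // dotC dv.
  apply/allP/allP => H i.
    rewrite mem_iota => /= ni; have := H (Ordinal ni) (mem_index_enum _).
    rewrite /= dotZl mulf_eq0 ev_eq0 dotC vE inE /= orbC.
    by [].
  move=> _; have := H i; rewrite mem_iota ltn_ord => /(_ isT).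
  by rewrite /= dotZl mulf_eq0 ev_eq0 dotC vE inE /= orbC.
apply/setP => t; apply/refls_inP/refls_inP => -[tW [u uP tu]]; split=> //.
  have [[c cr cu] ou] := uP; exists (vec c).
    exists c => //; rewrite mem_filter cr -dot_v // andbT.
    have := ou v erefl; case: cu => ->; rewrite ?dotNr; first by move=> ->.
    by move/eqP; rewrite oppr_eq0.
  by rewrite tu; case: cu => ->; rewrite ?reflmxN.
exists u => //; have [c cm ->] := uP; move: cm; rewrite mem_filter => /andP[cm cr].
by split=> [|_ ->]; [apply: root_model|apply/eqP; rewrite dot_v].
Qed.

Lemma vec_refl_ex c : exists t, c \in roots -> t \in W /\ rG t = reflmx (vec c).
Proof.
have [cr|] := boolP (c \in roots); last by exists 1%g.
by have [t tW tc] := Phi_refl RS (root_model cr); exists t.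
Qed.

Definition trefl c := sval (cid (vec_refl_ex c)).

Lemma treflP c : c \in roots -> trefl c \in W /\ rG (trefl c) = reflmx (vec c).
Proof. exact: (svalP (cid (vec_refl_ex c))). Qed.

(** Roots with the same reflection are equal or opposite, and the table contains only positive
    ones. *)
Lemma trefl_inj : {in roots &, injective trefl}.
Proof.
move=> c e cr er E; have [_ tc] := treflP cr; have [_ te] := treflP er.
have [x x0 Ex] := reflmx_inj (vec_neq0 cr) (etrans (esym tc) (etrans (congr1 rG E) te)).
have := root_model er; rewrite Ex => /(Phi_reduced RS (root_model cr))[x1|x1].
  by apply: vec_inj; rewrite ?root_size // Ex x1 scale1r.
have [_ h _] := roots_okE; have [sc _ /(hasP)[y /(nthP g0)[i ic <-] ci] _ _] := h _ cr.
rewrite sc in ic; case/negP: ci; rewrite -(ev_eq0 R) eq_le root_nneg // andbT.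
have /rowP/(_ (Ordinal ic)) : \row_i ev R (nth g0 e i) = - \row_i ev R (nth g0 c i) :> 'rV_n.
  by apply: (row_free_inj b_free); rewrite mulNmx -!vecE Ex x1 scaleN1r.
by rewrite !mxE /= => H; have := root_nneg i er; rewrite H oppr_ge0.
Qed.

Lemma refls_in_trefl l : {subset l <= roots} ->
  refls_in rG (vecs l) = [set t in [seq trefl c | c <- l]].
Proof.
move=> lr; apply/setP => t; rewrite [RHS]inE.
apply/refls_inP/mapP => [[tW [_ [c cl ->] tc]]|[c cl ->]].
  exists c => //; have [tW' tc'] := treflP (lr _ cl).
  by apply: (rs_inj RS); rewrite ?tc'.
have [tW tc] := treflP (lr _ cl); split=> //; exists (vec c) => //; by exists c.
Qed.

Lemma card_refls_in l : {subset l <= roots} -> uniq l -> #|refls_in rG (vecs l)| = size l.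
Proof.
move=> lr ul; rewrite refls_in_trefl // cardsE -(size_map trefl l); apply/card_uniqP.
by rewrite map_inj_in_uniq // => c e cl el; apply: trefl_inj; apply: lr.
Qed.

Lemma long_rootP c : c \in roots -> reflect (dot (vec c) (vec c) = 2) (long_root n cols norms c).
Proof.
move=> cr; have sc := root_size cr.
have -> : long_root n cols norms c =
    (gadd (gdot (weigh cols norms n c) c) (Zneg (xO (xO xH)), Z0) == g0).
  rewrite /long_root; case: (gdot _ _) => x y; rewrite /g0 /gadd /= !xpair_eqE.
  by apply/andP/andP => -[/eqP h1 /eqP h2]; split; apply/eqP; lia.
rewrite -(ev_eq0 R) evD -dot_vec // [X in _ + X](_ : _ = - 4).
  by apply: (iffP eqP) => H; lra.
by rewrite /ev /= mul0r addr0.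
Qed.

Lemma refls_in_long l : {subset l <= roots} ->
  refls_in rG (vecs l) :&: long_refls =
  refls_in rG (vecs [seq c <- l | long_root n cols norms c]).
Proof.
move=> lr; apply/setP => t; rewrite in_setI; apply/andP/idP.
  move=> [/refls_inP[tW [_ [c cl ->] tc]] /refls_inP[_ [v [Mv v2] tv]]].
  have cr := lr _ cl; apply: (mem_refls_in _ tW tc); exists c => //.
  rewrite mem_filter cl andbT; apply/long_rootP => //.
  have [x x0 E] := reflmx_inj (vec_neq0 cr) (etrans (esym tc) tv).
  move: Mv; rewrite E => /(Phi_reduced RS (root_model cr)) Ex.
  by move: v2; rewrite E dotZl dotZr; case: Ex => ->; rewrite ?mul1r ?mulN1r ?opprK.
move=> /refls_inP[tW [_ [c + ->] tc]]; rewrite mem_filter => /andP[cL cl].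
split; first by apply: (mem_refls_in _ tW tc); exists c.
apply: (mem_refls_in _ tW tc); split; first exact/root_model/lr.
by apply/long_rootP => //; apply: lr.
Qed.

Lemma long_refls_sub : long_refls \subset reflections rG.
Proof.
rewrite (reflectionsE RS); apply/subsetP => t /refls_inP[tW [v [Mv _] tv]].
exact: (mem_refls_in Mv tW tv).
Qed.

(** The hypothesis on [Psi] makes [l] list the roots of a full orthogonal complement, so the group
    contains no reflections beyond those of [l] and counting roots counts reflections. *)
Lemma inv_vecs l Psi : {subset l <= roots} -> uniq l ->
  refls_in rG (Orth model Psi) = refls_in rG (vecs l) ->
  inv (gp rG (vecs l)) = weight n cols norms l.
Proof.
move=> lr ul E; have G : gp rG (vecs l) :&: reflections rG = refls_in rG (vecs l).
  by rewrite -E -(gp_reflections RS) /gp /= E.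
congr (_, _); first by rewrite G card_refls_in.
rewrite -(setIidPr long_refls_sub) setIA G refls_in_long // card_refls_in.
- by rewrite size_filter.
- by move=> c; rewrite mem_filter => /andP[_ /lr].
- exact: filter_uniq.
Qed.

Lemma roots_of_sub m : {subset roots_of n roots m <= roots}.
Proof. by move=> c; rewrite mem_filter => /andP[]. Qed.

Lemma uniq_roots : uniq roots.
Proof. by have [] := roots_okE. Qed.

Lemma stdp_vecs m : stdp s (mset m) = gp rG (vecs (roots_of n roots m)).
Proof. by have [v [-> E]] := stdp_refls m; apply/val_inj; rewrite /= E. Qed.

Lemma inv_stdp m : inv (stdp s (mset m)) = weight n cols norms (roots_of n roots m).
Proof.
have [v [_ E]] := stdp_refls m; rewrite stdp_vecs.
by apply: inv_vecs E; [exact: roots_of_sub|exact/filter_uniq/uniq_roots].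
Qed.

Lemma dagger_vecs l : {subset l <= roots} ->
  dagger rG (gp rG (vecs l)) = gp rG (vecs (perp_roots n cols norms roots l)).
Proof.
move=> lr; rewrite (dagger_gp RS); last exact: vecs_model.
by rewrite /gp /= perp_refls.
Qed.

Lemma inv_perp l : {subset l <= roots} ->
  inv (gp rG (vecs (perp_roots n cols norms roots l))) =
  weight n cols norms (perp_roots n cols norms roots l).
Proof.
move=> lr; apply: inv_vecs (perp_refls lr); first exact: perp_roots_sub.
exact/filter_uniq/uniq_roots.
Qed.

Lemma simples_of_sub m : {subset simples_of n m <= roots}.
Proof.
move=> _ /mapP[j + ->]; rewrite mem_filter mem_iota => /andP[_ /= jn].
by have [h _ _] := roots_okE; apply: (h (Ordinal jn)).
Qed.

Lemma mem_nodes m (i : 'I_n) : ((i : nat) \in nodes n m) = (i \in mset m).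
Proof. by rewrite mem_filter mem_iota leq0n add0n ltn_ord /= andbT inE. Qed.

Lemma stdp_simples m : stdp s (mset m) = gp rG (vecs (simples_of n m)).
Proof.
apply/val_inj => /=; congr <<_>>%g; apply/setP => t.
apply/imsetP/refls_inP => [[i im ->]|[tW [_ [c /mapP[j jm ->] ->] tj]]].
  split=> //; exists (b i) => //; exists (unitv n i); rewrite ?vec_unitv //.
  by apply/mapP; exists (i : nat) => //; rewrite mem_nodes.
move: jm; rewrite mem_filter mem_iota => /andP[jm /= jn].
exists (Ordinal jn); first by rewrite inE.
by apply: (rs_inj RS) => //; rewrite tj s_refl -vec_unitv.
Qed.

Lemma dagger_stdp m : dagger rG (stdp s (mset m)) =
  gp rG (vecs (perp_roots n cols norms roots (simples_of n m))).
Proof. by rewrite stdp_simples dagger_vecs //; apply: simples_of_sub. Qed.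

Lemma inv_conj (P : {set gT}) w : w \in W -> inv (P :^ w) = inv P.
Proof.
move=> wW; have cj (S : {set gT}) : (forall w', w' \in W -> S :^ w' \subset S) -> S :^ w = S.
  move=> H; apply/eqP; rewrite eqEsubset H //= -sub_conjgV H //.
  exact: groupVr.
have Er : reflections rG :^ w = reflections rG.
  apply: cj => w' wW'; apply/subsetP => _ /imsetP[t tr ->].
  exact: (reflections_conj RS).
have El : long_refls :^ w = long_refls.
  apply: cj => w' wW'; apply/subsetP => _ /imsetP[t /refls_inP[tW [v [Mv v2] tv]] ->].
  apply: (mem_refls_in _ (groupJ tW wW') (rs_conj RS tW wW' tv)).
  by split; [apply: (rs_stable RS)|rewrite (rs_isom RS)].
by rewrite /inv -{1}Er -{1}El -!conjIg !cardJg.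
Qed.

Lemma conj_std_inv m P : conj_std m P -> inv P = weight n cols norms (roots_of n roots m).
Proof. by move=> [w wW ->]; rewrite inv_conj // inv_stdp. Qed.

Lemma conj_std_dagger_inv m P : conj_std m P ->
  inv (dagger rG P) = weight n cols norms (perp_roots n cols norms roots (simples_of n m)).
Proof.
move=> [w wW ->]; rewrite (dagger_conj RS) // inv_conj // dagger_stdp inv_perp //.
exact: simples_of_sub.
Qed.

Lemma dagger2_inv m :
  inv (dagger rG (dagger rG (stdp s (mset m)))) = weight n cols norms
    (perp_roots n cols norms roots (perp_roots n cols norms roots (simples_of n m))).
Proof.
rewrite dagger_stdp dagger_vecs ?inv_perp //; exact: perp_roots_sub.
Qed.

Lemma srefls_word (l : seq nat) : all (fun j => j < n)%N l ->
  exists2 w, w \in W & forall c, size c = n ->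
    size (srefls cols c l) = n /\ vec (srefls cols c l) = vec c *m rG w.
Proof.
elim: l => [_|j l IH /= /andP[jn /IH[w wW H]]].
  by exists 1%g => // c sc; rewrite repr_mx1 mulmx1.
exists (s (Ordinal jn) * w)%g => [|c sc]; first by rewrite groupM.
have sj : size (srefl cols c j) = n by apply: size_srefl.
have [h1 h2] := H _ sj; split=> //.
by rewrite h2 repr_mxM // mulmxA s_refl -vec_srefl.
Qed.

Lemma longest_word_sub fuel l x : {subset longest_word n cols fuel l x <= l}.
Proof.
elim: fuel x => // fuel IH x j /=; case E: [seq _ <- l | _] => [//|i t].
rewrite inE => /orP[/eqP ->|/IH //].
have : i \in [seq j <- l | ~~ gnneg (nth g0 x j)] by rewrite E mem_head.
by rewrite mem_filter => /andP[].
Qed.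

Lemma nodes_lt m j : j \in nodes n m -> (j < n)%N.
Proof. by rewrite mem_filter mem_iota => /andP[_]. Qed.

Lemma longest_lt m : all (fun j => j < n)%N (longest n cols m).
Proof.
rewrite /longest; move: 130%N => fuel.
by apply/allP => j /longest_word_sub/nodes_lt.
Qed.

Lemma nth_mask_of l (i : 'I_n) : nth false (mask_of n l) i = ((i : nat) \in l).
Proof. by rewrite (nth_map 0%N) ?size_iota // nth_iota. Qed.

(** Any pair of words gives a conjugation: [move] accepts the images of the simple roots only if
    they are simple up to sign, and returns [m] otherwise. The choice of the words affects only how
    many conjugates are found. *)
Lemma move_conj m i : exists2 w, w \in W &
  stdp s (mset (move n cols m i)) = stdp s (mset m) :^ w :> {set gT}.
Proof.
rewrite /move; have := longest_lt (add_node m i); have := longest_lt m.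
move: (longest n cols (add_node m i)) (longest n cols m) => l2 l1 l1n l2n.
have ln : all (fun j => j < n)%N (l1 ++ l2) by rewrite all_cat l1n.
move: (l1 ++ l2) ln => l ln; case: ifP => [/allP H|_]; last first.
  by exists 1%g => //; rewrite conjsg1.
have [w wW wE] := srefls_word ln; exists w => //.
rewrite -genJ; congr <<_>>%g.
set sup := find (fun x => x != g0).
have step (j : 'I_n) : (j : nat) \in nodes n m ->
    exists2 k : 'I_n, k = sup (srefls cols (unitv n j) l) :> nat & (s j ^ w)%g = s k.
  move=> jm; have [_ E] := wE _ (size_unitv j).
  have /andP[kn Hk] := H _ (map_f (fun j => srefls cols (unitv n j) l) jm).
  exists (Ordinal kn) => //; apply: (rs_inj RS); rewrite ?groupJ //.
  rewrite (rs_conj RS (s_in j) wW (s_refl j)) -vec_unitv -E s_refl -vec_unitv.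
  by case/orP: Hk => /eqP {1}->; rewrite ?vec_opp ?size_unitv // reflmxN.
apply/setP => t; rewrite mem_conjg; apply/imsetP/imsetP => [[k kS ->]|[j jm tj]].
  move: kS; rewrite inE nth_mask_of => /mapP[c /mapP[j jm ->] kE].
  have [k' k'E jk] := step (Ordinal (nodes_lt jm)) jm.
  exists (Ordinal (nodes_lt jm)); first by rewrite -mem_nodes.
  by have -> : k = k' by [apply/ord_inj; rewrite k'E kE]; rewrite -jk conjgK.
rewrite -mem_nodes in jm; have [k kE jk] := step _ jm.
exists k; last by rewrite -jk -tj conjgKV.
by rewrite inE nth_mask_of kE; do 2!apply: map_f.
Qed.

Lemma closure_conj m0 fuel todo seen :
  (forall m, m \in todo -> conj_std m0 (stdp s (mset m))) ->
  (forall m, m \in seen -> conj_std m0 (stdp s (mset m))) ->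
  forall m, m \in closure n cols fuel todo seen -> conj_std m0 (stdp s (mset m)).
Proof.
elim: fuel todo seen => //= fuel IH [//|m1 t] seen Ht Hs.
set next := undup _; have Hn m : m \in next -> conj_std m0 (stdp s (mset m)).
  rewrite mem_undup mem_filter => /andP[_ /mapP[i _ ->]].
  have [w wW Ew] := move_conj m1 i; have [w' wW' Ew'] := Ht m1 (mem_head _ _).
  exists (w' * w)%g; first exact: groupM.
  by rewrite conjsgM; apply: etrans Ew _; congr (_ :^ w).
apply: IH => m; rewrite mem_cat => /orP[/Hn //|mt]; last exact: Hs.
by apply: Ht; rewrite inE mt orbT.
Qed.

Lemma conj_masksP m m' : m' \in conj_masks n cols m -> conj_std m (stdp s (mset m')).
Proof.
have H m1 : m1 \in [:: m] -> conj_std m (stdp s (mset m1)).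
  by rewrite inE => /eqP ->; exists 1%g; rewrite ?conjsg1.
exact: closure_conj.
Qed.

Lemma mem_masks m : size m = n -> m \in masks n.
Proof.
elim: n m => [|k IH] [|x m] // [sm].
apply/allpairsP; exists (x, m); split=> //; first by case: x.
exact: IH.
Qed.

Lemma parabolic_mask P : parabolic rG P -> exists2 m, m \in masks n & conj_std m P.
Proof.
move=> /(parabolic_std RS)[J [w wW E]].
exists [seq i \in J | i <- enum 'I_n].
  by apply: mem_masks; rewrite size_map size_enum_ord.
exists w => //; rewrite E; congr (stdp s _ :^ w); apply/setP => i.
by rewrite inE (nth_map i) ?size_enum_ord // nth_ord_enum.
Qed.

Lemma conj_stdC m m' P : conj_std m P -> conj_std m' (stdp s (mset m)) -> conj_std m' P.
Proof.
move=> [w wW ->] [w' wW' E]; exists (w' * w)%g; first exact: groupM.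
by rewrite conjsgM; congr (_ :^ w).
Qed.

End Model.

(** Two labels, each with a list of nodes whose standard parabolic represents the class. [None]
    records that the second entry repeats the first, in a form that can be tested without comparing
    labels. *)
Definition row : Type := ((label * seq nat) * option (label * seq nat))%type.

Definition row_labels (r : row) : label * label := (r.1.1, (odflt r.1 r.2).1).

(** * The conditions tested by computation in types E, F and H *)

Section Checker.
Variables (D : diagram) (lng : nat) (cols : seq (seq golden)) (norms : seq golden).
Variable roots : seq (seq golden).
Variable tab : seq (seq bool * ((nat * nat) * (nat * nat) * nat)).
Let n := D.1.

(** The label 4 has to join simple roots of different length, and the labels 3 and 5 roots of equal
    length; otherwise the Cartan entries would leave Z[phi]. *)
Definition entry_ok i j : bool :=
  let e := cox_entry D i.+1 j.+1 in
  if (i < lng)%N == (j < lng)%N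
  then (e \in [:: 1; 2; 3; 5]%N) && ((e == 1%N) == (i == j))
  else e \in [:: 2; 4]%N.

Definition gram_ok : bool :=
  all (fun i => all (entry_ok i) (iota 0 n)) (iota 0 n).

Definition wt l := weight n cols norms (roots_of n roots (mask_of n l)).

Definition perp_simples l := perp_roots n cols norms roots (simples_of n (mask_of n l)).

Definition wp l := weight n cols norms (perp_simples l).

Local Notation cl l := (conj_masks n cols (mask_of n l)).

Definition type_ok Xs l : bool :=
  let PD := product_diagram Xs in
  [&& size l == PD.1, uniq l, all (fun j => j < n)%N l
    & all (fun i => all (fun j => cox_entry PD i.+1 j.+1 ==
        cox_entry D (nth 0 l i).+1 (nth 0 l j).+1) (iota 0 PD.1)) (iota 0 PD.1)]%N.

(* Every tabulated class with the invariants of the nodes [l] belongs to the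
   conjugacy class of [l] or satisfies the exclusion criterion [excl]. *)
Definition only_class l (excl : seq bool * ((nat * nat) * (nat * nat) * nat) -> bool) :=
  let c := cl l in let k := size l in let w := (wt l).1 in
  all (fun r => (count id r.1 == k) && (r.2.1.1.1 == w) ==> (r.1 \in c) || excl r) tab.

Definition count_length (long : bool) (w : nat * nat) : nat :=
  if long then w.2 else (w.1 - w.2)%N.

(** A class without reflections of the given length may be excluded: a member generated by such
    reflections would be trivial, while [l] is nonempty. *)
Definition fa_ok long k l : bool :=
  [&& n == 4, lng == 2, type_ok [:: TA k] l, l != [::],
      all (fun j => (j < lng) == long) l
    & only_class l (fun r => count_length long r.2.1.1 == 0)]%N.

(** If P contains Q, the complement of P lies in that of Q and cannot have more reflections of
    either length. Here [w] is the weight of the complement of a subgroup of type A_2 of the given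
    length. *)
Definition fb3_excl w (r : seq bool * ((nat * nat) * (nat * nat) * nat)) :=
  ~~ [&& count_length true r.2.1.2 <= count_length true w
       & count_length false r.2.1.2 <= count_length false w]%N.

(** Certifies that [C] denotes exactly the conjugates of the standard parabolic of [l]. For
    [NonStd], the weights of the complements prove that [l] is not conjugate to the excluded class,
    which the number of reflections cannot do. *)
Definition label_ok (C : label) (l : seq nat) : bool :=
  match C with
  | Typ Xs => type_ok Xs l && only_class l (fun=> false)
  | Std J => all (fun j => 0 < j)%N J && (l == [seq j.-1 | j <- J])
  | NonStd Xs J => let l' := [seq j.-1 | j <- J] in
      let c := cl l' in
      [&& all (fun j => 0 < j)%N J, type_ok Xs l, wp l != wp l'
        & only_class l (fun r => r.1 \in c)]
  | FA long k => fa_ok long k l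
  | FB3 long => let l' := if long then [:: 0; 1]%N else [:: 2; 3]%N in
      let w := wp l' in
      [&& fa_ok long 2 l', all (fun j => j \in l) l', type_ok [:: TB 3] l
        & only_class l (fb3_excl w)]
  | _ => false
  end.

(** The complement of a closed subgroup is known by its own weight and by that of its complement,
    which is the subgroup itself; these two have to single out the class of [l2]. *)
Definition partner_ok l1 l2 : bool :=
  let w := wt l1 in let w' := wp l1 in let c := cl l2 in
  all (fun e => (e.2.1.1 == w') && (e.2.1.2 == w) ==> (e.1 \in c)) tab.

Definition row_ok (r : row) : bool :=
  [&& label_ok r.1.1 r.1.2, label_ok (odflt r.1 r.2).1 (odflt r.1 r.2).2,
      perp_roots n cols norms roots (perp_simples r.1.2) ==
        roots_of n roots (mask_of n r.1.2)
    & partner_ok r.1.2 (odflt r.1 r.2).2].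

(** A subgroup is contained in its double complement, so equality of the numbers of roots expresses
    that it is closed. *)
Definition covered (rows : seq row) : bool :=
  let c := flatten [seq cl r.1.2 ++ cl (odflt r.1 r.2).2 | r <- rows] in
  all (fun e => (e.2.2 == e.2.1.1.1) ==> (e.1 \in c)) tab.

Definition row_weights (r : row) := (wt r.1.2, wt (odflt r.1 r.2).2).

(** Conjugate subgroups have equal weights, so distinct pairs of weights separate the rows. Weights
    may agree after a swap only within one row, and only if its two labels coincide. *)
Definition distinguished (rows : seq row) : bool :=
  let ws := [seq (row_weights r, ~~ r.2) | r <- rows] in
  uniq [seq w.1 | w <- ws] &&
  all (fun i => all (fun j =>
    let wi := nth (0, 0, (0, 0), false) ws i in
    let wj := nth (0, 0, (0, 0), false) ws j in
    (wi.1 == (wj.1.2, wj.1.1)) ==> (i == j) && wi.2)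
  (iota 0 (size ws))) (iota 0 (size ws)).

Definition rows_ok rows := [&& all row_ok rows, covered rows & distinguished rows].

End Checker.

(** Roots and Cartan columns are passed as arguments so that evaluation by value produces each of
    them once. *)
Definition check_roots D lng cols norms rows roots :=
  roots_ok D.1 cols roots &&
  rows_ok D lng cols norms roots [seq info D.1 cols norms roots m | m <- masks D.1] rows.

Definition check_cols D lng cols norms rows :=
  check_roots D lng cols norms rows (positive_roots D.1 cols).

Definition check D lng rows :=
  gram_ok D lng && check_cols D lng (cartan_cols D lng) (norms_of D lng) rows.

(** Nodes are counted from 0 and, for a label given by a type, listed in the Bourbaki order of that
    type; thus the D_6 in E_7 starts at the far end of the long arm. *)
Definition rowsE6 : seq row :=
  [:: ((Typ [:: TE 6], iota 0 6), Some (Typ [::], [::]));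
      ((Typ [:: TA 5], [:: 0; 2; 3; 4; 5]), Some (Typ [:: TA 1], [:: 0]));
      ((Typ [:: TA 2; TA 2], [:: 0; 2; 4; 5]), Some (Typ [:: TA 2], [:: 0; 2]));
      ((Typ [:: TA 3], [:: 0; 2; 3]), Some (Typ [:: TA 1; TA 1], [:: 0; 1]))]%N.

Definition rowsE7 : seq row :=
  [:: ((Typ [:: TE 7], iota 0 7), Some (Typ [::], [::]));
      ((Typ [:: TD 6], [:: 6; 5; 4; 3; 1; 2]), Some (Typ [:: TA 1], [:: 0]));
      ((Std [:: 2; 4; 5; 6; 7], [:: 1; 3; 4; 5; 6]), Some (Typ [:: TA 2], [:: 0; 2]));
      ((Typ [:: TD 4; TA 1], [:: 1; 3; 2; 4; 6]), Some (Typ [:: TA 1; TA 1], [:: 0; 1]));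
      ((Std [:: 2; 5; 6; 7], [:: 1; 4; 5; 6]), Some (Typ [:: TA 3], [:: 0; 2; 3]));
      ((Typ [:: TD 4], [:: 1; 3; 2; 4]), Some (Std [:: 2; 5; 7], [:: 1; 4; 6]));
      ((Typ [:: TA 1; TA 1; TA 1; TA 1], [:: 0; 1; 4; 6]),
       Some (NonStd [:: TA 1; TA 1; TA 1] [:: 2; 5; 7], [:: 0; 1; 4]))]%N.

Definition rowsE8 : seq row :=
  [:: ((Typ [:: TE 8], iota 0 8), Some (Typ [::], [::]));
      ((Typ [:: TE 7], iota 0 7), Some (Typ [:: TA 1], [:: 0]));
      ((Typ [:: TE 6], iota 0 6), Some (Typ [:: TA 2], [:: 0; 2]));
      ((Typ [:: TD 6], [:: 6; 5; 4; 3; 1; 2]), Some (Typ [:: TA 1; TA 1], [:: 0; 1]));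
      ((Typ [:: TD 5], [:: 0; 2; 3; 1; 4]), Some (Typ [:: TA 3], [:: 0; 2; 3]));
      ((Typ [:: TA 5], [:: 0; 2; 3; 4; 5]), Some (Typ [:: TA 2; TA 1], [:: 0; 2; 1]));
      ((Typ [:: TD 4; TA 1], [:: 1; 3; 2; 4; 6]),
       Some (Typ [:: TA 1; TA 1; TA 1], [:: 0; 1; 4]));
      ((Typ [:: TD 4], [:: 1; 3; 2; 4]), None);
      ((Typ [:: TA 4], [:: 0; 2; 3; 1]), None);
      ((Typ [:: TA 3; TA 1], [:: 1; 3; 4; 0]), None);
      ((Typ [:: TA 2; TA 2], [:: 0; 2; 4; 5]), None);
      ((Typ [:: TA 1; TA 1; TA 1; TA 1], [:: 0; 1; 4; 6]), None)]%N.

Definition rowsF4 : seq row :=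
  [:: ((Typ [:: TF4], iota 0 4), Some (Typ [::], [::]));
      ((FB3 true, [:: 0; 1; 2]), Some (FA false 1, [:: 3]));
      ((FB3 false, [:: 3; 2; 1]), Some (FA true 1, [:: 0]));
      ((FA true 2, [:: 0; 1]), Some (FA false 2, [:: 2; 3]));
      ((Typ [:: TA 1; TA 1], [:: 0; 2]), None);
      ((Typ [:: TB 2], [:: 1; 2]), None)]%N.

Definition rowsH3 : seq row :=
  [:: ((Typ [:: TH 3], iota 0 3), Some (Typ [::], [::]));
      ((Typ [:: TA 1; TA 1], [:: 0; 2]), Some (Typ [:: TA 1], [:: 0]))]%N.

Definition rowsH4 : seq row :=
  [:: ((Typ [:: TH 4], iota 0 4), Some (Typ [::], [::]));
      ((Typ [:: TH 3], iota 0 3), Some (Typ [:: TA 1], [:: 0]));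
      ((Typ [:: TA 1; TA 1], [:: 0; 2]), None);
      ((Typ [:: TA 2], [:: 1; 2]), None);
      ((Typ [:: TI 5], [:: 0; 1]), None)]%N.

(** * Soundness of the tests *)

Section Tables.
Variables (R : realType) (gT : finGroupType) (W : {group gT}) (d : nat).
Variable rG : mx_representation R W d.
Variables (D : diagram) (lng : nat) (s : 'I_D.1 -> gT) (b : 'I_D.1 -> 'rV[R]_d).
Variables (cols : seq (seq golden)) (norms : seq golden) (roots : seq (seq golden)).
Hypothesis M : is_model rG s b cols norms roots.
Hypothesis W_type : simple_system rG s W.
Hypothesis norms_lng : forall j : 'I_D.1,
  nth g0 norms j = if (j < lng)%N then (Zpos (xO xH), Z0) else g1.

Local Notation n := D.1.
Local Notation RS := (model_root_system M).
Local Notation tab := [seq info n cols norms roots m | m <- masks n].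
Local Notation wt := (wt D cols norms roots).
Local Notation wp := (wp D cols norms roots).
Local Notation cl l := (conj_masks n cols (mask_of n l)).
Local Notation long := (long_refls rG b roots).
Local Notation inv := (inv rG b roots).
Local Notation class l := (conj_std W s (mask_of n l)).
Local Notation stdl l := (stdp s (mset n (mask_of n l))).

Implicit Types (P Q : {group gT}).

Lemma tab_all (p : pred _) : all p tab -> forall m, m \in masks n ->
  p (info n cols norms roots m).
Proof. by rewrite all_map => /allP. Qed.

Lemma info_mask m : (info n cols norms roots m).1 = m.
Proof. by []. Qed.

Lemma info_wt m : (info n cols norms roots m).2.1.1 =
  weight n cols norms (roots_of n roots m).
Proof. by []. Qed.

Lemma info_wp m : (info n cols norms roots m).2.1.2 =
  weight n cols norms (perp_roots n cols norms roots (simples_of n m)).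
Proof. by []. Qed.

Lemma info_size m : (info n cols norms roots m).2.2 = size (perp_roots n cols norms roots
  (perp_roots n cols norms roots (simples_of n m))).
Proof. by []. Qed.

Lemma class_self l : class l (stdl l).
Proof. by exists 1%g => //; rewrite conjsg1. Qed.

Lemma mem_mset_mask l (i : 'I_n) : (i \in mset n (mask_of n l)) = ((i : nat) \in l).
Proof. by rewrite inE (nth_map 0%N) ?size_iota // nth_iota. Qed.

Lemma type_ok_has_type Xs l : type_ok D Xs l -> has_type rG Xs (stdl l).
Proof.
set k := (product_diagram Xs).1 => /and4P[/eqP sl ul /allP ln /allP en].
(* Without nodes there is no default element of ['I_n] for the enumeration [g] below. *)
case: (posnP n) => [n0|n0].
  have l0 : l = [::] by case: l ln {sl ul en} => // j l /(_ j (mem_head _ _)); rewrite n0.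
  have k0 : k = 0%N by rewrite /k -sl l0.
  have noI : forall i : 'I_k, False by case=> i; rewrite k0.
  exists (fun i => match noI i with end), (fun i => match noI i with end).
  split; try by move=> i; case: (noI i).
    rewrite -kermx_eq0; apply/eqP/matrixP => i; by case: (noI i).
  congr <<_>>%g; apply/setP => t; apply/imsetP/imsetP => -[i]; last by case: (noI i).
  by rewrite mem_mset_mask l0.
pose g i : 'I_n := insubd (Ordinal n0) (nth 0%N l i).
have gE i : (i < k)%N -> g i = nth 0%N l i :> nat.
  by move=> ik; rewrite val_insubd ln ?mem_nth // sl.
have -> : mset n (mask_of n l) = [set g (i : 'I_k) | i : 'I_k].
  apply/setP => i; rewrite mem_mset_mask; apply/idP/imsetP => [il|[j _ ->]].
    have ik : (index (i : nat) l < k)%N by rewrite /k -sl index_mem.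
    by exists (Ordinal ik) => //; apply/ord_inj; rewrite gE //= nth_index.
  by rewrite gE // mem_nth // sl.
apply: (stdp_has_type (D := D) (en := erefl)) => [|i j ik jk gij|i j ik jk].
- suff -> : (fun i => s (cast_ord erefl i)) = s by [].
  by apply/funext => i; rewrite cast_ord_id.
- apply/eqP; rewrite -(nth_uniq 0%N _ _ ul) ?sl //.
  by rewrite -!gE // gij.
have := en i; rewrite mem_iota => /(_ ik)/allP/(_ j).
by rewrite mem_iota => /(_ jk)/eqP ->; rewrite !gE.
Qed.

Lemma type_ok_size Xs l : type_ok D Xs l -> size l = (product_diagram Xs).1.
Proof. by case/and4P => /eqP. Qed.

Lemma size_masks k m : m \in masks k -> size m = k.
Proof.
elim: k m => [|k IH] m; first by rewrite inE => /eqP ->.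
by move=> /allpairsP[[x m'] [_ /= /IH <- ->]].
Qed.

Lemma card_mset m : size m = n -> #|mset n m| = count id m.
Proof.
move=> sm; have -> : m = [seq i \in mset n m | i <- enum 'I_n].
  apply: (@eq_from_nth _ false) => [|i]; first by rewrite size_map size_enum_ord.
  rewrite sm => ni; rewrite (nth_map (Ordinal ni)) ?size_enum_ord //.
  by rewrite inE nth_enum_ord.
rewrite count_map -size_filter cardE; congr size.
have -> : mset n [seq i \in mset n m | i <- enum 'I_n] = mset n m.
  by apply/setP => i; rewrite inE (nth_map i) ?size_enum_ord // nth_ord_enum.
by rewrite enumT; apply: eq_filter.
Qed.

Lemma inv_class l P : class l P -> inv P = wt l.
Proof. exact: conj_std_inv. Qed.

Lemma class_type Xs l P : type_ok D Xs l -> class l P -> has_type rG Xs P.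
Proof. by move=> /type_ok_has_type H [w wW ->]; apply: (has_type_conj RS). Qed.

Lemma class_parabolic l P : class l P -> parabolic rG P.
Proof.
by move=> [w wW ->]; apply: parabolic_conj => //; apply: (parabolic_stdp RS).
Qed.

Lemma class_conj l P w : w \in W -> class l P -> class l (P :^ w).
Proof. by move=> wW [x xW ->]; exists (x * w)%g; rewrite ?groupM // conjsgM. Qed.

Lemma cl_class l m P : m \in cl l -> conj_std W s m P -> class l P.
Proof. by move=> mc mP; apply: conj_stdC mP (conj_masksP M mc). Qed.

(** A standard conjugate of P has the rank and the number of reflections prescribed by the type, so
    its mask passes the premise of the test. *)
Lemma only_classP l Xs (ex : pred _) P :
  type_ok D Xs l -> only_class D cols norms roots tab l ex ->
  parabolic rG P -> has_type rG Xs P ->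
  class l P \/ exists2 m, conj_std W s m P & ex (info n cols norms roots m).
Proof.
move=> tl /tab_all H /(parabolic_mask M)[m mm mP] tP.
have := H m mm; have [w wW E] := mP.
rewrite -(card_mset (size_masks mm)) (type_ok_size tl).
have tP' := tP; rewrite E in tP'; rewrite (stdp_rank RS wW tP') eqxx /=.
have -> : size (roots_of n roots m) = (wt l).1.
  have -> : size (roots_of n roots m) = (inv P).1 by rewrite (conj_std_inv M mP).
  rewrite -(inv_class (class_self l)).
  exact: (has_type_card RS tP (type_ok_has_type tl)).
rewrite eqxx /= => /orP[mc|em]; [left|right]; first exact: cl_class mc mP.
by exists m.
Qed.

Lemma typ_class Xs l P : label_ok D lng cols norms roots tab (Typ Xs) l ->
  denote rG s (Typ Xs) P <-> class l P.
Proof.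
move=> /andP[tl H]; split=> [[pP tP]|cP].
  by case: (only_classP tl H pP tP) => [//|[]].
by split; [apply: class_parabolic cP|apply: class_type cP].
Qed.

Lemma simples_std J : all (fun j => 0 < j)%N J ->
  <<simples s J>>%g = stdl [seq j.-1 | j <- J].
Proof.
move=> /allP J0; congr <<_>>%g; apply/setP => t.
apply/imsetP/imsetP => -[i iJ ->]; exists i => //.
  by rewrite mem_mset_mask; apply/mapP; exists i.+1 => //; move: iJ; rewrite inE.
by move: iJ; rewrite mem_mset_mask => /mapP[j jJ ij]; rewrite inE ij prednK // J0.
Qed.

Lemma std_class J l P : label_ok D lng cols norms roots tab (Std J) l ->
  denote rG s (Std J) P <-> class l P.
Proof.
move=> /andP[J0 /eqP ->].
by split=> -[w wW E]; exists w => //; move: E; rewrite simples_std.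
Qed.

Lemma nonstd_class Xs J l P : label_ok D lng cols norms roots tab (NonStd Xs J) l ->
  denote rG s (NonStd Xs J) P <-> class l P.
Proof.
move=> /and4P[J0 tl wl H].
have JE Q : conj_of_gen W (simples s J) Q <-> class [seq j.-1 | j <- J] Q.
  by split=> -[w wW E]; exists w => //; move: E; rewrite simples_std.
split=> [[pP tP nP]|cP].
  case: (only_classP tl H pP tP) => [//|[m mP mc]]; case: nP; apply/JE.
  exact: cl_class mc mP.
split; [exact: class_parabolic cP|exact: class_type cP|move=> /JE cP'].
by case/eqP: wl; rewrite -[LHS](conj_std_dagger_inv M cP) (conj_std_dagger_inv M cP').
Qed.

Definition length_refls (l : bool) := if l then long else reflections rG :\: long.

Lemma card_length l (P : {set gT}) : #|P :&: length_refls l| = count_length l (inv P).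
Proof.
case: l => //=; rewrite setIDA cardsD -setIA; congr (_ - #|_ :&: _|)%N.
exact/setIidPr/(long_refls_sub M).
Qed.

Lemma simple_long (i : 'I_n) : (s i \in long) = (i < lng)%N.
Proof.
apply/idP/idP => [/refls_inP[_ [v [Mv v2] tv]]|il].
  have := tv; rewrite (model_refl M) => /(reflmx_inj (b_neq0 M i))[x x0 Ex].
  move: Mv; rewrite Ex => /(rs_reduced RS) xE.
  move: v2; rewrite Ex dotZl dotZr (model_norm M) norms_lng; case: ifP => // _.
  by rewrite ev1; case: xE => ->; rewrite ?mulN1r ?opprK ?mul1r => /eqP; rewrite (eqr_nat R 1 2).
apply/refls_inP; split; first exact: (model_in M).
exists (b i); last exact: (model_refl M).
split; first exact: (rs_simple RS).
by rewrite (model_norm M) norms_lng il /ev /= mul0r addr0.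
Qed.

Lemma long_conj t w : w \in W -> t \in long -> (t ^ w)%g \in long.
Proof.
move=> wW /refls_inP[tW [v [Mv v2] tv]].
apply: (mem_refls_in _ (groupJ tW wW) (rs_conj RS tW wW tv)).
by split; [apply: (rs_stable RS)|rewrite (rs_isom RS)].
Qed.

Lemma simple_length (i : 'I_n) l : (s i \in length_refls l) = ((i < lng)%N == l).
Proof.
have si : s i \in reflections rG.
  rewrite (reflectionsE RS); apply: (mem_refls_in _ (model_in M i) (model_refl M i)).
  exact: (rs_simple RS).
by case: l; rewrite /length_refls ?in_setD simple_long ?si ?andbT //; case: (_ < _)%N.
Qed.

(** Every reflection is conjugate to a simple one, and conjugation preserves the length of the
    root. *)
Lemma refls_of_lengthE l : n = 4%N -> lng = 2%N ->
  refls_of_length W s l = length_refls l.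
Proof.
move=> n4 l2.
have mJ (i : 'I_n) : (i.+1 \in (if l then [:: 1; 2] else [:: 3; 4])%N) = ((i < lng)%N == l).
  have := ltn_ord i; rewrite {2}n4 l2; case: (i : nat) => [|[|[|[|]]]] // _; by case: l.
apply/setP => t; apply/imset2P/idP => [[_ w /imsetP[i iJ ->] wW ->]|tl].
  move: iJ; rewrite inE mJ -simple_length /length_refls; case: l {mJ} => [|].
    exact: long_conj.
  rewrite !in_setD => /andP[sl sr]; rewrite (reflections_conj RS) // andbT.
  apply: contra sl => /(long_conj (groupVr wW)); by rewrite conjgK.
have tr : t \in reflections rG.
  by move: tl; rewrite /length_refls; case: l {mJ} => [/(subsetP (long_refls_sub M)) //|/setDP[]].
have [v Mv tv] := reflection_root RS tr; have /reflectionsP[tW _] := tr.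
have [w wW [i vi]] := root_conj_simple RS Mv.
have E : (t ^ w)%g = s i.
  apply: (rs_inj RS); rewrite ?groupJ ?(model_in M) //.
  by rewrite (rs_conj RS tW wW tv) vi (model_refl M).
exists (s i) (w^-1)%g; rewrite ?groupV -?E ?conjgK //.
apply/imsetP; exists i => //; rewrite inE mJ -simple_length -E.
move: tl; rewrite /length_refls; case: l {mJ} => [|]; first exact: long_conj.
rewrite !in_setD => /andP[sl sr]; rewrite (reflections_conj RS) // andbT.
by apply: contra sl => /(long_conj (groupVr wW)); rewrite conjgK.
Qed.

Lemma fa_class l0 k l P : fa_ok D lng cols norms roots tab l0 k l ->
  classF_A rG s l0 k P <-> class l P.
Proof.
move=> /and5P[/eqP n4 /eqP l2 tl ln /andP[/allP ll H]].
rewrite /classF_A refls_of_lengthE //; split=> [[pP tP EP]|cP].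
  case: (only_classP tl H pP tP) => [//|[m mP /= m0]].
  have P0 : P :=: 1%g.
    rewrite EP (_ : _ :&: _ = set0) ?gen0 //; apply/eqP.
    rewrite -cards_eq0 card_length (conj_std_inv M mP); exact: m0.
  have := has_type_card RS tP (type_ok_has_type tl).
  have [j jl] : exists j, j \in l by case: l ln {tl ll H} => // j l _; exists j; rewrite mem_head.
  have jn : (j < n)%N by case/and4P: tl => _ _ /allP /(_ j jl).
  have sj : s (Ordinal jn) \in stdl l :&: reflections rG.
    rewrite inE; apply/andP; split.
      by apply/mem_gen/imsetP; exists (Ordinal jn) => //; rewrite mem_mset_mask.
    rewrite (reflectionsE RS); apply: (mem_refls_in _ (model_in M _) (model_refl M _)).
    exact: (rs_simple RS).
  rewrite P0 (_ : 1%g :&: _ = set0) ?cards0.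
    by move/esym/eqP; rewrite cards_eq0 => /eqP E; rewrite E inE in sj.
  apply/eqP; rewrite -subset0; apply/subsetP => t.
  rewrite in_setI => /andP[/set1P -> /reflectionsP[_ [a a0]]].
  by rewrite repr_mx1 => E; have := reflmx_neq1 a0; rewrite -E eqxx.
split; [exact: class_parabolic cP|exact: class_type cP|].
have [w wW E] := cP; apply/eqP; rewrite eqEsubset gen_subG subsetIl andbT.
rewrite {1}E sub_conjg gen_subG; apply/subsetP => _ /imsetP[i iS ->].
rewrite mem_conjgV; apply: mem_gen; rewrite in_setI; apply/andP; split.
  by rewrite E memJ_conjg; apply/mem_gen/imsetP; exists i.
rewrite mem_mset_mask in iS; have := ll i iS; rewrite -simple_length /length_refls.
case: (l0) => [|]; first exact: long_conj.
rewrite !in_setD => /andP[sl sr]; rewrite (reflections_conj RS) // andbT.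
by apply: contra sl => /(long_conj (groupVr wW)); rewrite conjgK.
Qed.

Lemma dagger_anti (P Q : {set gT}) : Q \subset P -> dagger rG P \subset dagger rG Q.
Proof.
move=> QP; apply: genS; apply/subsetP => t; rewrite !inE => /andP[-> /forallP H] /=.
apply/forallP => x; apply/implyP; rewrite inE => /andP[xQ xr].
by have := H x; rewrite inE (subsetP QP) //= xr.
Qed.

Lemma fb3_class l0 l P : label_ok D lng cols norms roots tab (FB3 l0) l ->
  denote rG s (FB3 l0) P <-> class l P.
Proof.
rewrite /label_ok; set l' := if l0 then _ else _ => /and4P[ok' /allP l'l tl H].
split=> [[pP tP [Q QP /(fa_class _ ok') cQ]]|cP].
  case: (only_classP tl H pP tP) => [//|[m mP /negP[]]].
  rewrite /info [_.2.1.2]/=.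
  have -> : weight n cols norms (perp_roots n cols norms roots (simples_of n m)) =
      inv (dagger rG P) by rewrite (conj_std_dagger_inv M mP).
  have -> : wp l' = inv (dagger rG Q) by rewrite (conj_std_dagger_inv M cQ).
  by rewrite -!card_length !subset_leq_card // setSI // dagger_anti.
split; [exact: class_parabolic cP|exact: class_type cP|].
have [w wW E] := cP; exists (stdl l' :^ w)%G => /=.
  rewrite E conjSg; apply: genS; apply/subsetP => _ /imsetP[i il ->].
  by apply/imsetP; exists i => //; move: il; rewrite !mem_mset_mask => /l'l.
by apply/(fa_class _ ok')/class_conj/class_self.
Qed.

Lemma label_class C l P : label_ok D lng cols norms roots tab C l ->
  denote rG s C P <-> class l P.
Proof.
case: C => //.
- by move=> Xs; apply: typ_class.
- by move=> J; apply: std_class.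
- by move=> Xs J; apply: nonstd_class.
- by move=> l0 k; apply: fa_class.
- by move=> l0; apply: fb3_class.
Qed.

(** Q is parabolic and, by closedness, P is its complement. A standard conjugate of Q thus has the
    two weights of [l1] in exchanged roles, which the table assigns to the class of [l2]. *)
Lemma partnerP l1 l2 P Q :
  perp_roots n cols norms roots (perp_simples D cols norms roots l1)
    = roots_of n roots (mask_of n l1) ->
  partner_ok D cols norms roots tab l1 l2 ->
  class l1 P -> Q :=: dagger rG P -> class l2 Q /\ concept rG P Q.
Proof.
move=> closed /tab_all part cP QP.
have pP := class_parabolic cP.
have pQ : parabolic rG Q.
  have [v vE] := parabolic_vec RS pP.
  rewrite QP vE (dagger_gp RS); last exact: Orth_root.
  exact: (parabolic_gp RS).
have PQ : P :=: dagger rG Q.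
  have [w wW E] := cP.
  rewrite QP E !(dagger_conj RS) // (dagger_stdp M) (dagger_vecs M) ?closed.
    by rewrite -(stdp_vecs M).
  exact: perp_roots_sub.
split=> //; have [m mm mQ] := parabolic_mask M pQ.
have := part m mm.
rewrite info_mask info_wt info_wp.
rewrite -(conj_std_inv M mQ) -(conj_std_dagger_inv M mQ) -PQ.
rewrite QP (conj_std_dagger_inv M cP) eqxx (inv_class cP) eqxx /= => mc.
by rewrite -QP; apply: cl_class mc mQ.
Qed.

Lemma rows_classified rows :
  rows_ok D lng cols norms roots tab rows ->
  classified_by rG s (listed [seq row_labels r | r <- rows]).
Proof.
pose r0 : row := ((Typ [::], [::]), None).
move=> /and3P[/(all_nthP r0) rowP /tab_all cov dist].
have listedP c : listed [seq row_labels r | r <- rows] c ->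
    exists2 i, (i < size rows)%N & c = row_labels (nth r0 rows i).
  elim: (rows) => //= r t IH [->|/IH[i it ->]]; first by exists 0%N.
  by exists i.+1.
have rowI i : (i < size rows)%N ->
    listed [seq row_labels r | r <- rows] (row_labels (nth r0 rows i)).
  by elim: (rows) i => //= r t IH [|i] it; [left|right; apply: IH].
have flatI (f : row -> seq (seq bool)) m : m \in flatten [seq f r | r <- rows] ->
    exists2 i, (i < size rows)%N & m \in f (nth r0 rows i).
  elim: (rows) => //= r t IH; rewrite mem_cat => /orP[mr|/IH[i it mi]].
    by exists 0%N.
  by exists i.+1.
have ok i (r := nth r0 rows i) : (i < size rows)%N -> [/\ forall P, denote rG s (row_labels r).1 P <-> class r.1.2 P,
    forall P, denote rG s (row_labels r).2 P <-> class (odflt r.1 r.2).2 P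
  & forall P Q, class r.1.2 P -> Q :=: dagger rG P ->
      class (odflt r.1 r.2).2 Q /\ concept rG P Q].
  move=> /rowP /and4P[h1 h2 /eqP h3 h4].
  by split=> [P|P|P Q]; [exact: label_class h1|exact: label_class h2|exact: partnerP].
(* The second class determines the first: Q is conjugate to the complement of the representative of
   the first class, and complements are taken once more. *)
have okC i (r := nth r0 rows i) P Q : (i < size rows)%N -> concept rG P Q ->
    class (odflt r.1 r.2).2 Q -> class r.1.2 P.
  move=> rr [_ _ QP PQ] [w wW QE]; have [_ _ H] := ok i rr.
  have [Q' Q'E] := dagger_group rG (stdl r.1.2).
  have [[w' wW' Q1] [_ _ Q1E P1E]] := H _ _ (class_self _) Q'E.
  exists (w'^-1 * w)%g; first by rewrite groupM ?groupV.
  rewrite PQ QE conjsgM (dagger_conj RS) //; congr (_ :^ w).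
  rewrite P1E Q1 (dagger_conj RS) // -conjsgM mulgV conjsg1.
  by [].
apply: (classified_by_intro RS).
- move=> c /listedP[i ir ->]; have [h1 h2 _] := ok i ir.
  split; [exists (stdl (nth r0 rows i).1.2)|exists (stdl (odflt (nth r0 rows i).1 (nth r0 rows i).2).2)];
    by [exact: (parabolic_stdp RS)|move=> P; rewrite ?h1 ?h2].
- move=> c /listedP[i ir ->]; have [h1 h2 h3] := ok i ir.
  set l := (nth r0 rows i).1.2 in h1 h3 *.
  have [Q QE] := dagger_group rG (stdl l).
  have [cQ PQ] := h3 (stdl l) Q (class_self l) QE.
  by exists (stdl l), Q; split=> //; [apply/h1/class_self|apply/h2].
- move=> P Q PQ; have [pP _ QP PQ'] := PQ.
  have [m mm mP] := parabolic_mask M pP.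
  set c := flatten [seq cl r.1.2 ++ cl (odflt r.1 r.2).2 | r <- rows] in cov.
  have := cov m mm; rewrite info_mask info_wt info_size.
  have -> : size (perp_roots n cols norms roots
      (perp_roots n cols norms roots (simples_of n m))) = size (roots_of n roots m).
    have E1 := inv_stdp M m; have E2 := dagger2_inv M m.
    have [w wW PE] := mP.
    (* P equals its double complement, hence so does its standard conjugate. *)
    have E : stdp s (mset n m) :=: dagger rG (dagger rG (stdp s (mset n m))).
      apply: (@conjsg_inj _ w) => /=; rewrite -!(dagger_conj RS) // -PE -QP.
      exact: PQ'.
    by move: E2; rewrite -E E1 => /(congr1 fst) /=.
  rewrite eqxx => /flatI[i ir]; have [h1 h2 h3] := ok i ir.
  rewrite mem_cat => mc; exists (row_labels (nth r0 rows i)); first exact: rowI.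
  case/orP: mc => mc; have cP := cl_class mc mP; split=> //.
    by left; split; [apply/h1|apply/h2; have [] := h3 P Q cP QP].
  right; split; last exact/h2.
  by apply/h1; apply: okC ir (conceptC PQ) cP.
move=> c c' P Q /listedP[i ir ->] /listedP[j jr ->] PQ.
have [h1 h2 _] := ok i ir; have [h1' h2' _] := ok j jr.
set ri := nth r0 rows i in h1 h2 *; set rj := nth r0 rows j in h1' h2' *.
move=> /h1 cP /h2 cQ; case/andP: dist.
set ws := [seq _ | r <- rows] => /(uniqP (0, 0, (0, 0))%N) uws /allP aws.
have sw : size ws = size rows by rewrite size_map.
have wsE k : (k < size rows)%N -> nth (0, 0, (0, 0), false)%N ws k =
    (row_weights D cols norms roots (nth r0 rows k), ~~ (nth r0 rows k).2).
  by move=> kr; rewrite (nth_map r0).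
split=> [/h1' cP' /h2' cQ'|/h1' cQ' /h2' cP'].
  congr row_labels; rewrite /ri /rj; congr nth; apply/esym/uws; rewrite ?inE ?size_map //.
  rewrite !(nth_map (0, 0, (0, 0), false)%N) ?sw // !wsE //=.
  by rewrite /row_weights -(inv_class cP) -(inv_class cP') -(inv_class cQ) -(inv_class cQ').
have := aws i; rewrite mem_iota sw => /(_ ir)/allP/(_ j); rewrite mem_iota => /(_ jr).
rewrite !wsE //= /row_weights /= -/ri -/rj.
rewrite -(inv_class cP) -(inv_class cP') -(inv_class cQ) -(inv_class cQ') eqxx /=.
(* Agreement after a swap forces the same row, marked [None], whose two labels are equal. *)
move=> /andP[/eqP E]; rewrite /rj -E -/ri /row_labels.
by case: (ri) => [[x y] [z|]].
Qed.

End Tables.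

Section Exceptional.
Variables (R : realType) (gT : finGroupType) (W : {group gT}) (d : nat).
Variable rG : mx_representation R W d.

Lemma row_free_scale n (x : 'I_n -> R) (a : 'I_n -> 'rV[R]_d) :
  (forall i, x i != 0) -> row_free (\matrix_i a i) -> row_free (\matrix_i (x i *: a i)).
Proof.
move=> x0 fa; have -> : \matrix_i (x i *: a i) = diag_mx (\row_i x i) *m \matrix_i a i.
  by apply/row_matrixP => i; rewrite row_mul row_diag_mx rowK mxE -scalemxAl -rowE rowK.
rewrite /row_free mxrankMfree // -/(row_free _) row_free_unit unitmxE det_diag.
by rewrite unitfE; apply/prodf_neq0 => i _; rewrite mxE.
Qed.

Variables (D : diagram) (s : 'I_D.1 -> gT).
Hypothesis W_faithful : mx_faithful rG.
Hypothesis W_type : simple_system rG s W.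

(** The required simple roots are the unit ones stretched by sqrt 2 at the first [lng] nodes;
    [gram_ok] restricts the labels to those for which all Cartan entries then lie in Z[phi]. *)
Lemma check_model lng roots :
  gram_ok D lng -> roots_ok D.1 (cartan_cols D lng) roots ->
  exists b, is_model rG s b (cartan_cols D lng) (norms_of D lng) roots.
Proof.
move=> /allP gram rok; have [a [fa aE sP WE]] := W_type.
pose x i : R := if (i < lng)%N then Num.sqrt 2 else 1.
have x0 i : x i != 0.
  by rewrite /x; case: ifP => _; rewrite ?oner_eq0 // gt_eqF // sqrtr_gt0.
have s2 : Num.sqrt 2 * Num.sqrt 2 = 2 :> R by rewrite -expr2 sqr_sqrtr.
have normE (i : 'I_D.1) : dot (x i *: a i) (x i *: a i) = x i * x i.
  by rewrite dotZl dotZr aE /cox_entry eqxx divr1 cospi opprK mulr1.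
have xx i : x i * x i = if (i < lng)%N then 2 else 1.
  by rewrite /x; case: ifP => _; rewrite ?mulr1.
exists (fun i : 'I_D.1 => x i *: a i); split=> //.
- by move=> i; have [] := sP i.
- by move=> i; have [_ ->] := sP i; rewrite reflmxZ.
- exact: row_free_scale.
- by move=> j; rewrite (nth_map 0%N) ?size_iota // size_map size_iota.
- move=> j; rewrite normE xx (nth_map 0%N) ?size_iota // nth_iota // add0n.
  by case: ifP => _; rewrite ?ev1 // /ev /= mul0r addr0.
move=> i j; rewrite normE dotZl dotZr aE.
rewrite (nth_map 0%N) ?size_iota // (nth_map 0%N) ?size_iota // !nth_iota // !add0n.
have := gram i; rewrite mem_iota ltn_ord => /(_ isT)/allP/(_ j).
rewrite mem_iota ltn_ord => /(_ isT); rewrite /entry_ok /label_ind.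
have [ij|ij] := eqVneq (i : nat) j.
  have -> : i = j by apply/ord_inj.
  by move=> _; rewrite /cox_entry eqxx divr1 cospi ev2; ring.
case: eqP => [lij|lij].
  have xij : x i = x j by rewrite /x lij.
  rewrite xij; move: (cox_entry _ _ _) => e; rewrite !inE => /andP[He e1].
  case/or4P: He e1 => /eqP -> // _.
  - by rewrite cos_pihalf ev0; ring.
  - by rewrite cos_pi3 evN1; field.
  - by rewrite evNphi /phi; field.
move: (cox_entry _ _ _) => e; rewrite !inE => /orP[] /eqP ->.
  by rewrite cos_pihalf ev0; ring.
have := cos_pi4 R; move: lij; rewrite /x; case: (i < lng)%N; case: (j < lng)%N => // _ H.
  by rewrite mulr1 mul1r mulrN H evN2; ring.
by rewrite s2 mul1r mulrN H evN1; ring.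
Qed.

Lemma check_classified lng rows : check D lng rows ->
  classified_by rG s (listed [seq row_labels r | r <- rows]).
Proof.
rewrite /check /check_cols => /andP[gram /andP[rok rows_ok]].
have [b M] := check_model gram rok.
apply: (rows_classified M W_type _ rows_ok) => j.
by rewrite (nth_map 0%N) ?size_iota // nth_iota.
Qed.

End Exceptional.

Lemma check_E6 : check (cox_diagram (TE 6)) 0 rowsE6.
Proof. by vm_compute. Qed.

Lemma check_E7 : check (cox_diagram (TE 7)) 0 rowsE7.
Proof. by vm_compute. Qed.

Lemma check_E8 : check (cox_diagram (TE 8)) 0 rowsE8.
Proof. by vm_compute. Qed.

Lemma check_F4 : check (cox_diagram TF4) 2 rowsF4.
Proof. by vm_compute. Qed.

Lemma check_H3 : check (cox_diagram (TH 3)) 0 rowsH3.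
Proof. by vm_compute. Qed.

Lemma check_H4 : check (cox_diagram (TH 4)) 0 rowsH4.
Proof. by vm_compute. Qed.

(** * Types B and D *)

Lemma down_ind (N : nat) (Q : nat -> Prop) :
  Q N -> (forall i, (i < N)%N -> Q i.+1 -> Q i) -> forall i, (i <= N)%N -> Q i.
Proof.
move=> QN Qs i iN; rewrite -(subKn iN); move: (N - i)%N (leq_subr i N) => k kN.
elim: k kN => [|k IH] kN; first by rewrite subn0.
apply: Qs; first by lia.
by rewrite (_ : (N - k.+1).+1 = N - k)%N; [apply: IH; lia|lia].
Qed.

Lemma head_cat T (x0 : T) s t : head x0 (s ++ t) = head (head x0 t) s.
Proof. by case: s. Qed.

(** The default [x0] is arbitrary so that the edges listed after a chain can take its place. *)
Lemma entry_chain k i j x0 :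
  head x0 [seq e.2 | e <- chain 1 k & (e.1 == (i.+1, j.+1)) || (e.1 == (j.+1, i.+1))] =
  if ((j == i.+1) && (i < k) || (i == j.+1) && (j < k))%N then 3%N else x0.
Proof.
elim: k x0 => [|k IH] x0; first by rewrite !andbF.
rewrite /chain -(addn1 k) iotaD map_cat filter_cat map_cat head_cat -/(chain 1 k) IH.
rewrite /= !xpair_eqE add1n addn1.
by do ?[case: ifP => ?]; rewrite /=; do ?[case: ifP => ?]; lia.
Qed.

Lemma entryA n i j : (i < n)%N -> (j < n)%N ->
  cox_entry (cox_diagram (TA n)) i.+1 j.+1 =
  if i == j then 1%N else if (j == i.+1) || (i == j.+1) then 3%N else 2%N.
Proof.
move=> ni nj; rewrite /cox_entry eqSS; case: eqP => // ij.
rewrite entry_chain; congr (if _ then _ else _); lia.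
Qed.

Lemma entryB n i j : (1 < n)%N -> (i < n)%N -> (j < n)%N ->
  cox_entry (cox_diagram (TB n)) i.+1 j.+1 =
  if i == j then 1%N else
  if (j == i.+1) || (i == j.+1) then (if maxn i j == n.-1 then 4 else 3)%N else 2%N.
Proof.
move=> n1 ni nj; rewrite /cox_entry eqSS; case: eqP => // ij.
rewrite /= -cats1 filter_cat map_cat head_cat entry_chain /= !xpair_eqE.
by do ?[case: ifP => ? /=]; lia.
Qed.

Lemma entryD n i j : (3 < n)%N -> (i < n)%N -> (j < n)%N ->
  cox_entry (cox_diagram (TD n)) i.+1 j.+1 =
  if i == j then 1%N else
  if ((j == i.+1) || (i == j.+1)) && (maxn i j < n.-1)%N
     || (minn i j == n - 3)%N && (maxn i j == n.-1) then 3%N else 2%N.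
Proof.
move=> n1 ni nj; rewrite /cox_entry eqSS; case: eqP => // ij.
rewrite /= -cats1 filter_cat map_cat head_cat entry_chain /= !xpair_eqE.
by do ?[case: ifP => ? /=]; lia.
Qed.

Section Chains.
Variables (R : realType) (d : nat).

(* The Gram matrix of A 0, ..., A (N - 1) is the Cartan matrix of type A_N. *)
Definition cartan_chain N (A : nat -> 'rV[R]_d) := forall i j, (i < N)%N -> (j < N)%N ->
  dot (A i) (A j) = (i == j)%:R *+ 2 - (j == i.+1)%:R - (i == j.+1)%:R.

(** If A_k = e_k - e_(k+1) and u = e_N, the sum telescopes to e_i: this recovers coordinate vectors
    from simple roots. *)
Definition tails N (A : nat -> 'rV[R]_d) u i := u + \sum_(i <= k < N) A k.

Lemma tails_last N A u : tails N A u N = u.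
Proof. by rewrite /tails big_geq ?addr0. Qed.

Lemma tails_step N A u i : (i < N)%N -> tails N A u i = A i + tails N A u i.+1.
Proof. by move=> iN; rewrite /tails big_ltn // addrCA. Qed.

(** The function [x] serves two situations: it is 0 when [u] is the last coordinate vector, and the
    indicator of the last index when [u] is orthogonal to the chain. *)
Lemma dot_tails N A u x i k : cartan_chain N A ->
  (forall k, (k < N)%N -> dot u (A k) = x k - (k.+1 == N)%:R) ->
  (i <= N)%N -> (k < N)%N ->
  dot (tails N A u i) (A k) = x k + (k == i)%:R - (k.+1 == i)%:R.
Proof.
move=> cA uA iN kN; move: i iN; apply: down_ind => [|i iN IH].
  by rewrite tails_last uA // (ltn_eqF kN) addr0.
rewrite tails_step // dotDl IH cA // eqSS (eq_sym i k) (eq_sym i k.+1).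
ring.
Qed.

Lemma tails_orthonormal N A u i j : cartan_chain N A -> dot u u = 1 ->
  (forall k, (k < N)%N -> dot u (A k) = - (k.+1 == N)%:R) ->
  (i <= N)%N -> (j <= N)%N ->
  dot (tails N A u i) (tails N A u j) = (i == j)%:R.
Proof.
move=> cA uu uA iN jN.
have uA' k : (k < N)%N -> dot u (A k) = 0 - (k.+1 == N)%:R by move=> /uA ->; rewrite add0r.
have base : dot (tails N A u i) u = (i == N)%:R.
  move: i iN; apply: down_ind => [|i iN IH]; first by rewrite tails_last uu eqxx.
  by rewrite tails_step // dotDl IH dotC uA // addrC subrr (ltn_eqF iN).
move: j jN; apply: down_ind => [|j jN IH]; first by rewrite tails_last.
rewrite (tails_step A u jN) dotDr IH (dot_tails (x := fun=> 0)) //.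
by rewrite add0r (eq_sym j.+1) subrK eq_sym.
Qed.

(** With [u] orthogonal to the chain, for instance 0, the vectors are not orthonormal in general,
    but their differences have the inner products of differences of an orthonormal family. This is
    the form of coordinates available in type A, where the space may have dimension n only. *)
Lemma tails_diff N A u i j k l : cartan_chain N A ->
  (forall k, (k < N)%N -> dot u (A k) = 0) ->
  (i <= N)%N -> (j <= N)%N -> (k <= N)%N -> (l <= N)%N ->
  dot (tails N A u i - tails N A u j) (tails N A u k - tails N A u l) =
  (i == k)%:R - (i == l)%:R - (j == k)%:R + (j == l)%:R.
Proof.
move=> cA uA iN jN kN lN; set v := _ - tails N A u j.
have uA' m : (m < N)%N -> dot u (A m) = (m.+1 == N)%:R - (m.+1 == N)%:R.
  by move=> /uA ->; rewrite subrr.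
have vE m : (m <= N)%N -> dot v (tails N A u m) =
    dot v u - (i == N)%:R + (j == N)%:R + (i == m)%:R - (j == m)%:R.
  move: m; apply: down_ind => [|m mN IH]; first by rewrite tails_last; ring.
  rewrite (tails_step A u mN) dotDr IH dotBl !(dot_tails cA uA') //.
  by rewrite !(eq_sym m) !(eq_sym m.+1); ring.
by rewrite dotBr !vE //; ring.
Qed.

End Chains.

Definition sg (R : realType) (x : bool) : R := if x then -1 else 1.

Lemma sg_neq0 (R : realType) x : sg R x != 0.
Proof. by case: x; rewrite /sg ?oppr_eq0 oner_eq0. Qed.

Lemma sgM (R : realType) x y : sg R x * sg R y = sg R (x (+) y).
Proof. by case: x; case: y; rewrite /sg /= ?mulrNN ?mulN1r ?mul1r ?opprK. Qed.

Lemma sg_sqr (R : realType) x : sg R x * sg R x = 1.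
Proof. by rewrite sgM addbb. Qed.

(** * Coordinate roots of types B and D and their orthogonal complements *)

Section FrameRoots.
Variables (R : realType) (d n : nat).
Implicit Types (f : 'I_n -> 'rV[R]_d) (u v : 'rV[R]_d) (x y tau : bool).

Definition sv f x i := sg R x *: f i.

(** [sh] tells whether the short roots e_i are present: type B if it is true, type D otherwise. *)
Definition frame_root (sh : bool) f v :=
  (exists i j x y, i != j /\ v = sv f x i + sv f y j) \/
  (sh /\ exists i x, v = sv f x i).

(* Roots of W(B_m) x A_1^k (or W(D_m) x A_1^k) in terms of coordinates; the
   pairs contribute e_(p c) - e_(q c), or e_(p c) + e_(q c) if [tau] is false. *)
Definition rts (Phi : 'rV[R]_d -> Prop) f tau (M : {set 'I_n}) k (p q : 'I_k -> 'I_n) v :=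
  [/\ Phi v,
      forall i, i \notin M -> i \notin codom p -> i \notin codom q -> dot v (f i) = 0
    & forall c, dot v (f (p c)) = sg R tau * dot v (f (q c))].

Definition signed_frame (S : {set 'I_n}) f i := sv f (i \in S) i.

Lemma svN f x i : - sv f x i = sv f (~~ x) i.
Proof. by rewrite /sv -scaleNr; case: x; rewrite /sg ?opprK. Qed.

Lemma sv_signed f S x i : sv (signed_frame S f) x i = sv f (x (+) (i \in S)) i.
Proof. by rewrite /sv /signed_frame /sv scalerA sgM. Qed.

Lemma signed_frameK S T f i :
  signed_frame S (signed_frame T f) i = sv f ((i \in S) (+) (i \in T)) i.
Proof. exact: sv_signed. Qed.

Lemma frame_root_signed sh S f : frame_root sh (signed_frame S f) = frame_root sh f.
Proof.
apply/funext => v; apply/propext.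
have half g T : frame_root sh (signed_frame T g) v -> frame_root sh g v.
  move=> [[i [j [x [y [ij ->]]]]]|[h [i [x ->]]]].
    left; exists i, j, (x (+) (i \in T)), (y (+) (j \in T)).
    by rewrite !sv_signed.
  by right; split=> //; exists i, (x (+) (i \in T)); rewrite sv_signed.
split; first exact: half.
suff E : f = signed_frame S (signed_frame S f) by rewrite {1}E; apply: half.
by apply/funext => i; rewrite signed_frameK addbb /sv scale1r.
Qed.

Section Orthonormal.
Variables (sh : bool) (f : 'I_n -> 'rV[R]_d).
Hypothesis f_on : Defs.orthonormal f.
Let Phi := frame_root sh f.

Lemma dot_sv x i k : dot (sv f x i) (f k) = sg R x * (i == k)%:R.
Proof. by rewrite dotZl f_on. Qed.

Lemma orthonormal_signed S : Defs.orthonormal (signed_frame S f).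
Proof.
move=> i j; rewrite dotZl dotZr f_on mulrA sgM.
by have [->|] := eqVneq i j; rewrite ?addbb ?mulr1 ?mulr0.
Qed.

Lemma dot_sv2 x y i j k :
  dot (sv f x i + sv f y j) (f k) = sg R x * (i == k)%:R + sg R y * (j == k)%:R.
Proof. by rewrite dotDl !dot_sv. Qed.

Lemma root2 x y i j : i != j -> Phi (sv f x i + sv f y j).
Proof. by move=> ij; left; exists i, j, x, y. Qed.

Lemma root_e i : sh -> Phi (f i).
Proof. by move=> h; right; split=> //; exists i, false; rewrite /sv scale1r. Qed.

Lemma root_minus i j : i != j -> Phi (f i - f j).
Proof. by move=> ij; have := root2 false true ij; rewrite /sv /sg scale1r scaleN1r. Qed.

Lemma root_plus i j : i != j -> Phi (f i + f j).
Proof. by move=> ij; have := root2 false false ij; rewrite /sv /sg !scale1r. Qed.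

Lemma root_neq0 v : Phi v -> v != 0.
Proof.
have F (i : 'I_n) x : sg R x * (i == i)%:R != 0 by rewrite eqxx mulr1 sg_neq0.
move=> [[i [j [x [y [ij ->]]]]]|[_ [i [x ->]]]].
  apply: contraNneq (F i x) => /(congr1 (fun v => dot v (f i))).
  by rewrite dot_sv2 dot0l [j == i]eq_sym (negPf ij) mulr0 addr0 => ->.
apply: contraNneq (F i x) => /(congr1 (fun v => dot v (f i))).
by rewrite dot_sv dot0l => ->.
Qed.

Section Config.
Variables (k : nat) (p q : 'I_k -> 'I_n).
Hypothesis pq_uniq : uniq (codom p ++ codom q).

Lemma p_inj : injective p.
Proof. by move: pq_uniq; rewrite cat_uniq => /and3P[/injectiveP]. Qed.

Lemma q_inj : injective q.
Proof. by move: pq_uniq; rewrite cat_uniq => /and3P[_ _ /injectiveP]. Qed.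

Lemma pq_neq c c' : (p c == q c') = false.
Proof.
move: pq_uniq; rewrite cat_uniq => /and3P[_ /hasPn H _].
by apply/eqP => E; have := H _ (codom_f q c'); rewrite -E codom_f.
Qed.

Lemma qp_neq c c' : (q c == p c') = false.
Proof. by rewrite eq_sym pq_neq. Qed.

(** The two coordinates at a pair vanish together, and a root has no more than two nonzero
    coordinates; a root meeting a pair is therefore the root of this pair up to sign. *)
Lemma pair_root tau x y i j v : i != j -> v = sv f x i + sv f y j ->
  (forall c, dot v (f (p c)) = sg R tau * dot v (f (q c))) ->
  (exists c, i = p c \/ i = q c) ->
  exists c z, v = sg R z *: (f (p c) + sg R tau *: f (q c)).
Proof.
move=> ij vE vpq [c ic]; have H := vpq c.
have vl l : dot v (f l) = sg R x * (i == l)%:R + sg R y * (j == l)%:R.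
  by rewrite vE dot_sv2.
have s0 z w : sg R z = sg R w * 0 -> False by move/eqP; rewrite mulr0 (negPf (sg_neq0 _ _)).
have ji : (j == i) = false by rewrite eq_sym (negPf ij).
exists c; case: ic => ic; move: H; rewrite !vl -!ic !(eqxx, ji, mulr1, mulr0, addr0).
  have := pq_neq c c; rewrite -ic => ->; rewrite mulr0 add0r.
  have [jq E|_] := eqVneq j (q c); last by rewrite mulr0 => /s0.
  rewrite /= mulr1 in E; exists x; rewrite vE /sv scalerDr scalerA -jq; congr (_ + _ *: _).
  by rewrite E mulrAC sg_sqr mul1r.
have := qp_neq c c; rewrite -ic => ->; rewrite mulr0 add0r.
have [jq /= E|_ /esym/eqP] := eqVneq j (p c); last first.
  by rewrite mulr0 mulf_eq0 !(negPf (sg_neq0 _ _)).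
exists y; rewrite mulr1 in E; rewrite vE /sv scalerDr scalerA -jq E addrC.
by rewrite mulrAC sg_sqr mul1r.
Qed.

Lemma rts_cases tau M v : rts Phi f tau M p q v ->
  [\/ sh /\ exists i x, i \in M /\ v = sv f x i,
      exists i j x y, [/\ i \in M, j \in M, i != j & v = sv f x i + sv f y j]
    | exists c x, v = sg R x *: (f (p c) + sg R tau *: f (q c))].
Proof.
move=> [Pv v0 vpq].
have inM i : dot v (f i) != 0 -> (i \in M) \/ (exists c, i = p c \/ i = q c).
  move=> vi; have [/codomP[c ->]|ip] := boolP (i \in codom p); first by right; exists c; left.
  have [/codomP[c ->]|iq] := boolP (i \in codom q); first by right; exists c; right.
  by left; apply: contraNT vi => iM; rewrite v0.
have pq0 c : (dot v (f (p c)) != 0) = (dot v (f (q c)) != 0).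
  by rewrite vpq mulf_eq0 (negPf (sg_neq0 _ _)).
case: Pv => [[i [j [x [y [ij vE]]]]]|[h [i [x vE]]]]; last first.
  have vi l : (dot v (f l) != 0) = (i == l).
    by rewrite vE dot_sv mulf_eq0 (negPf (sg_neq0 _ _)) /= pnatr_eq0 eqb0 negbK.
  apply: Or31; split=> //; exists i, x; split=> //.
  have /inM[//|[c ic]] : dot v (f i) != 0 by rewrite vi.
  have := pq0 c; rewrite !vi; case: ic => ->; rewrite eqxx ?pq_neq ?qp_neq //.
have vl l : dot v (f l) = sg R x * (i == l)%:R + sg R y * (j == l)%:R.
  by rewrite vE dot_sv2.
have /inM[iM|ic] : dot v (f i) != 0.
- by rewrite vl eqxx [j == i]eq_sym (negPf ij) mulr1 mulr0 addr0 sg_neq0.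
- have /inM[jM|jc] : dot v (f j) != 0.
  + by rewrite vl eqxx (negPf ij) mulr1 mulr0 add0r sg_neq0.
  + by apply: Or32; exists i, j, x, y.
  have vE' : v = sv f y j + sv f x i by rewrite vE addrC.
  have ji : j != i by rewrite eq_sym.
  by apply: Or33; apply: (pair_root ji vE' vpq jc).
by apply: Or33; apply: (pair_root ij vE vpq ic).
Qed.

Lemma dot_pair tau u c : dot u (f (p c) + sg R tau *: f (q c)) =
  dot u (f (p c)) + sg R tau * dot u (f (q c)).
Proof. by rewrite dotDr dotZr. Qed.

Lemma rts_pair tau M c : rts Phi f tau M p q (f (p c) + sg R tau *: f (q c)).
Proof.
have E : f (p c) + sg R tau *: f (q c) = sv f false (p c) + sv f tau (q c).
  by rewrite /sv scale1r.
split; first by rewrite E; apply: root2; rewrite pq_neq.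
  move=> i _ ip iq; rewrite E dot_sv2.
  have -> : (p c == i) = false by apply: contraNF ip => /eqP <-; apply: codom_f.
  have -> : (q c == i) = false by apply: contraNF iq => /eqP <-; apply: codom_f.
  by rewrite !mulr0 addr0.
move=> c'; rewrite E !dot_sv2 pq_neq qp_neq (inj_eq p_inj) (inj_eq q_inj).
by rewrite mulr0 addr0 mulr0 add0r mulrA sg_sqr.
Qed.

Lemma rts_free tau (M : {set 'I_n}) i : (forall i, i \in M -> i \notin codom p ++ codom q) ->
  i \in M -> forall v, Phi v -> (forall l, l \notin M -> dot v (f l) = 0) ->
  rts Phi f tau M p q v.
Proof.
move=> Mpq iM v Pv vM; split=> // [l lM _ _|c]; first exact: vM.
have pM : p c \notin M by apply/negP => /Mpq; rewrite mem_cat (codom_f p c).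
have qM : q c \notin M by apply/negP => /Mpq; rewrite mem_cat (codom_f q c) orbT.
by rewrite !vM ?mulr0.
Qed.

(** Complementation replaces [L] by the points outside [L] and the pairs, and the sign of each pair
    by its opposite. Without short roots a single point carries no root and imposes no condition,
    hence the restriction on [L]. *)
Lemma Orth_rts tau (L M : {set 'I_n}) :
  (forall i, i \in L -> i \notin codom p ++ codom q) ->
  (forall i, (i \in M) = (i \notin L) && (i \notin codom p ++ codom q)) ->
  sh \/ #|L| != 1%N ->
  forall v, Orth Phi (rts Phi f tau L p q) v <-> rts Phi f (~~ tau) M p q v.
Proof.
move=> Lpq ME hL v; split=> [[Pv ov]|rv].
  have vL i : i \in L -> dot v (f i) = 0.
    move=> iL; have vf w : Phi w -> (forall l, l \notin L -> dot w (f l) = 0) -> dot v w = 0.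
      by move=> Pw wL; rewrite dotC; apply: ov; apply: (rts_free _ Lpq iL).
    case: hL => [h|L1].
      apply: vf => [|l lL]; first exact: root_e.
      by rewrite f_on; case: eqP lL => // <-; rewrite iL.
    have [j jL ji] : exists2 j, j \in L & j != i.
      apply/exists_inP; apply: contraNT L1; rewrite negb_exists_in => /forall_inP H.
      apply/cards1P; exists i; apply/setP => j; rewrite inE.
      by apply/idP/eqP => [jL|-> //]; apply/eqP; have := H j jL; rewrite negbK.
    have lij l : l \notin L -> (i == l) = false /\ (j == l) = false.
      by move=> lL; split; apply: contraNF lL => /eqP <-.
    (* Orthogonality to both f_i + f_j and f_i - f_j kills the coordinate at [i]. *)
    have vp : dot v (f i + f j) = 0.
      apply: vf => [|l /lij[h1 h2]]; first by apply: root_plus; rewrite eq_sym.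
      by rewrite dotDl !f_on h1 h2 addr0.
    have vm : dot v (f i - f j) = 0.
      apply: vf => [|l /lij[h1 h2]]; first by apply: root_minus; rewrite eq_sym.
      by rewrite dotBl !f_on h1 h2 subr0.
    by move: vp vm; rewrite dotDr dotBr => ? ?; lra.
  split=> // [i iM ip iq|c].
    by apply: vL; move: iM; rewrite ME mem_cat negb_or ip iq /= andbT negbK.
  have := ov _ (rts_pair tau L c); rewrite dotC dot_pair => /eqP.
  by rewrite addr_eq0 => /eqP ->; case: (tau); rewrite /sg /= ?mulN1r ?mul1r ?opprK.
have [Pv v0 vpq] := rv; split=> // u /rts_cases.
have vL i : i \in L -> dot v (f i) = 0.
  move=> iL; have := Lpq i iL; rewrite mem_cat negb_or => /andP[ip iq].
  by apply: v0 => //; rewrite ME iL.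
case=> [[h [i [x [iL ->]]]]|[i [j [x [y [iL jL _ ->]]]]]|[c [x ->]]].
- by rewrite dotC dotZr vL ?mulr0.
- by rewrite dotC dotDr !dotZr !vL ?mulr0 ?addr0.
rewrite dotC dotZr dot_pair vpq.
by case: (tau); rewrite /sg /= ?mulN1r ?mul1r ?addrN ?addNr mulr0.
Qed.

End Config.
End Orthonormal.
End FrameRoots.

Section Pairing.
Variables (T : eqType) (n : nat) (x : 'I_n -> T) (good : pred T).
Let cls i := [set j | x j == x i].

(** [p] runs through the least points of the good level sets with two elements, [q] through their
    mates. *)
Lemma pairing : exists k (p q : 'I_k -> 'I_n),
  [/\ uniq (codom p ++ codom q),
      forall c, [/\ x (q c) = x (p c), good (x (p c)) &
        forall j, x j = x (p c) -> j = p c \/ j = q c]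
    & forall i, good (x i) -> #|cls i| = 2 -> i \in codom p ++ codom q].
Proof.
pose mate i := odflt i [pick j in cls i | j != i].
have mateP i : #|cls i| = 2 -> mate i != i /\ cls i = [set i; mate i].
  move=> /eqP/cards2P[a [b [ab E]]].
  have : i \in [set a; b] by rewrite -E inE.
  have [j ij jE] : exists2 j, j != i & cls i = [set i; j].
    have : i \in [set a; b] by rewrite -E inE.
    rewrite !inE => /orP[/eqP ia|/eqP ia]; subst i.
      by exists b; [rewrite eq_sym|exact: E].
    by exists a; [exact: ab|rewrite setUC; exact: E].
  move=> _; rewrite /mate; case: pickP => [l /andP[lc li]|/(_ j)] /=.
    split=> //; rewrite jE; congr (_ |: [set _]).
    by move: lc; rewrite jE !inE (negPf li) => /eqP.
  by rewrite ij jE !inE eqxx orbT.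
pose reps := [seq i <- enum 'I_n | [&& good (x i), #|cls i| == 2 & [forall j in cls i, i <= j]]]%N.
have repsP i : i \in reps -> [/\ good (x i), #|cls i| = 2 & forall j, x j = x i -> i <= j]%N.
  rewrite mem_filter => /andP[/and3P[gi /eqP ci /forall_inP H] _].
  by split=> // j xj; apply: H; rewrite inE xj.
have ureps : uniq reps by rewrite filter_uniq // enum_uniq.
pose p (c : 'I_(size reps)) := tnth (in_tuple reps) c; pose q c := mate (p c).
have pr c : p c \in reps by apply: mem_tnth.
have pinj : injective p.
  exact: (elimT (tuple_uniqP (in_tuple reps)) ureps).
have qc c : [/\ q c != p c, x (q c) = x (p c) &
    forall j, x j = x (p c) -> j = p c \/ j = q c].
  have [_ c2 _] := repsP _ (pr c); have [qp E] := mateP _ c2; split=> // [|j xj].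
    by have : mate (p c) \in cls (p c) by [rewrite E !inE eqxx orbT]; rewrite inE => /eqP.
  have : j \in cls (p c) by rewrite inE xj.
  by rewrite E !inE => /orP[/eqP|/eqP]; [left|right].
have pmin c j : x j = x (p c) -> (p c <= j)%N by have [_ _] := repsP _ (pr c); apply.
have same c c' : x (p c) = x (p c') -> c = c'.
  move=> E; apply/pinj/ord_inj/eqP; rewrite eqn_leq.
  by rewrite (pmin c (p c')) ?(pmin c' (p c)).
have qx c : x (q c) = x (p c) by have [] := qc c.
exists (size reps), p, q; split=> [|c|i gi ci].
- rewrite cat_uniq; apply/and3P; split; first exact/injectiveP.
    apply/hasPn => _ /codomP[c ->]; apply/codomP => -[c' E].
    have cc : c = c' by apply: same; rewrite -qx E.
    by have [] := qc c; rewrite E cc eqxx.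
  by apply/injectiveP => c c' E; apply: same; rewrite -!qx E.
- by have [_ h1 h2] := qc c; have [h3 _ _] := repsP _ (pr c).
have [mi E] := mateP i ci.
have xm : x (mate i) = x i.
  by have : mate i \in cls i by [rewrite E !inE eqxx orbT]; rewrite inE => /eqP.
have inr j : x j = x i -> (forall l, x l = x i -> j <= l)%N -> exists c, p c = j.
  move=> xj jl; have : j \in reps.
    rewrite mem_filter mem_enum xj gi andbT /=; apply/andP; split.
      by have -> : cls j = cls i by [rewrite /cls xj]; rewrite ci.
    by apply/forall_inP => l; rewrite inE xj => /eqP/jl.
  by rewrite -[reps]/(tval (in_tuple reps)) => /tnthP[c ->]; exists c.
have cl l : x l = x i -> l = i \/ l = mate i.
  move=> xl; have : l \in cls i by rewrite inE xl.
  by rewrite E !inE => /orP[/eqP|/eqP]; [left|right].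
rewrite mem_cat; have [im|mi'] := leqP i (mate i).
  have [|c <-] := inr i erefl; last by rewrite codom_f.
  by move=> l /cl[] ->.
have [|c cE] := inr (mate i) xm; first by move=> l /cl[] -> //; apply: ltnW.
have [h1 h2 h3] := qc c; rewrite cE in h1 h3.
have [|iE|iE] := h3 i; first by rewrite xm.
  by rewrite -iE eqxx in mi.
by rewrite iE codom_f orbT.
Qed.

End Pairing.

Section DoubleOrth.
Variables (R : realType) (d n : nat) (sh : bool) (f : 'I_n -> 'rV[R]_d).
Hypothesis f_on : Defs.orthonormal f.
Let Phi := frame_root sh f.
Implicit Types (u v w : 'rV[R]_d).

(** As no coordinate of [w] is negative, the roots orthogonal to [w] are, up to sign, the
    differences at equal coordinates and, at vanishing ones, the sums and the e_i. Orthogonality to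
    them leaves free the values taken once, equates the coordinates at a nonzero value taken twice,
    and kills the others. *)
Lemma Orth_Orth_vec w : (forall i, 0 <= dot w (f i)) ->
  exists k (p q : 'I_k -> 'I_n) (L : {set 'I_n}),
  [/\ uniq (codom p ++ codom q),
      forall i, i \in L -> i \notin codom p ++ codom q,
      ~~ sh -> #|[set i | (i \notin L) && (i \notin codom p ++ codom q)]| != 1%N
    & forall v, Orth Phi (Orth Phi (eq^~ w)) v <-> rts Phi f false L p q v].
Proof.
move=> w0; pose x i := dot w (f i); pose cls i := [set j | x j == x i].
have [k [p [q [upq pqP pqT]]]] := pairing x (fun t => t != 0).
(* A value taken once imposes no condition, except 0 in type B, where e_i itself is orthogonal to
   [w]. *)
pose L := [set i | (#|cls i| == 1%N) && (sh ==> (x i != 0))].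
have clsT i : i \in cls i by rewrite inE.
have L1 i : i \in L -> forall j, x j = x i -> j = i.
  rewrite inE => /andP[/cards1P[a E] _] j xj.
  have : j \in cls i by rewrite inE xj.
  by have := clsT i; rewrite E !inE => /eqP -> /eqP.
have Lpq i : i \in L -> i \notin codom p ++ codom q.
  move=> iL; apply/negP; rewrite mem_cat => /orP[] /codomP[c ic].
    have [xq _ _] := pqP c; have := L1 i iL (q c); rewrite ic xq => /(_ erefl) E.
    by have := pq_neq upq c c; rewrite E eqxx.
  have [xq _ _] := pqP c; have := L1 i iL (p c); rewrite ic xq => /(_ erefl) E.
  by have := pq_neq upq c c; rewrite E eqxx.
pose al u := Orth Phi (eq^~ w) u.
have alm i j : x i = x j -> i != j -> al (f i - f j).
  move=> xij ij; split; first exact: root_minus.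
  by move=> _ ->; rewrite dotBr -/(x i) -/(x j) xij subrr.
have alp i j : x i = 0 -> x j = 0 -> i != j -> al (f i + f j).
  move=> xi xj ij; split; first exact: root_plus.
  by move=> _ ->; rewrite dotDr -/(x i) -/(x j) xi xj addr0.
have ale i : sh -> x i = 0 -> al (f i).
  by move=> h xi; split; [apply: root_e|move=> _ ->].
have alC u : al u -> (sh /\ exists l y, x l = 0 /\ u = sv f y l) \/
    exists l m y z, [/\ l != m, x l = x m, (y == z) ==> (x l == 0)
                      & u = sv f y l + sv f z m].
  move=> [[[l [m [y [z [lm ->]]]]]|[h [l [y ->]]]] /(_ w erefl)].
    rewrite dotDr !dotZr -/(x l) -/(x m) => E; right; exists l, m, y, z.
    have := w0 l; have := w0 m; rewrite -/(x l) -/(x m) => xm xl.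
    move: E; case: (y) (z) => [] [] /= E; split=> //; rewrite ?implybT //=; lra.
  rewrite dotZr => /eqP; rewrite mulf_eq0 (negPf (sg_neq0 _ _)) => /eqP xl.
  by left; split=> //; exists l, y.
exists k, p, q, L; split=> // [nsh|v].
  apply/cards1P => -[i E].
  have : i \in [set i | (i \notin L) && (i \notin codom p ++ codom q)] by rewrite E set11.
  rewrite inE => /andP[iL ipq].
  have ci : #|cls i| != 1%N by move: iL; rewrite inE (negPf nsh) /= andbT.
  have [j ji xj] : exists2 j, j != i & x j = x i.
    apply: contrapT => H; case/negP: ci; apply/cards1P; exists i.
    apply/setP => j; rewrite !inE; apply/eqP/eqP => [xj|-> //].
    by apply: contrapT => /eqP ji; apply: H; exists j.
  have : j \in [set i | (i \notin L) && (i \notin codom p ++ codom q)].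
    rewrite inE; apply/andP; split; first by rewrite inE /cls xj -/(cls i) (negPf ci).
    apply/negP; rewrite mem_cat => /orP[] /codomP[c jc]; have [xq g H] := pqP c.
      have [iE|iE] : i = p c \/ i = q c by apply: H; rewrite -xj jc.
        by rewrite iE jc eqxx in ji.
      by move: ipq; rewrite mem_cat iE codom_f orbT.
    have [iE|iE] : i = p c \/ i = q c by apply: H; rewrite -xj jc xq.
      by move: ipq; rewrite mem_cat iE codom_f.
    by rewrite iE jc eqxx in ji.
  by rewrite E inE (negPf ji).
split=> [[Pv ov]|[Pv v0 vpq]].
  split=> // [i iL ip iq|c]; last first.
    have [xq g _] := pqP c; have := ov (f (p c) - f (q c)).
    rewrite dotC dotBr mul1r => H; apply/eqP; rewrite -subr_eq0; apply/eqP/H/alm => //.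
    by rewrite pq_neq.
  have ipq : i \notin codom p ++ codom q by rewrite mem_cat negb_or ip.
  have zero j : j != i -> al (f i + f j) -> al (f i - f j) -> dot v (f i) = 0.
    move=> ji /ov Hp /ov Hm; move: Hp Hm; rewrite !(dotC _ v) dotDr dotBr => ? ?; lra.
  have [xi|xi] := eqVneq (x i) 0.
    have [h|h] := boolP sh; first by rewrite dotC; apply/ov/ale.
    have [j ji xj] : exists2 j, j != i & x j = x i.
      apply: contrapT => H; case/negP: iL; rewrite inE (negPf h) andbT.
      apply/cards1P; exists i; apply/setP => j; rewrite !inE.
      apply/eqP/eqP => [xj|-> //].
      by apply: contrapT => /eqP ji; apply: H; exists j.
    by apply: (zero j ji); [apply: alp|apply: alm]; rewrite ?xj // eq_sym.
  (* A nonzero value outside [L] and the pairs is taken at least three times. Then [v] has equal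
     coordinates at three points, while a root has at most two nonzero ones. *)
  have ci : (2 < #|cls i|)%N.
    rewrite ltn_neqAle; apply/andP; split.
      by apply: contra ipq => /eqP ci; apply: pqT.
    rewrite ltn_neqAle; apply/andP; split.
      by apply: contra iL => /eqP ci; rewrite inE -ci xi implybT.
    by apply/card_gt0P; exists i.
  have [j [l [jc lc jl]]] : exists j l, [/\ j \in cls i :\ i, l \in cls i :\ i & j != l].
    by apply/card_gt1P; move: ci; rewrite (cardsD1 i (cls i)) clsT.
  move: jc lc; rewrite !inE => /andP[ji /eqP xj] /andP[li /eqP xl].
  have eqc a b : x a = x b -> a != b -> dot v (f a) = dot v (f b).
    move=> xab ab; apply/eqP; rewrite -subr_eq0 -dotBr dotC; apply/eqP/ov.
    exact: alm.
  have vj := eqc j i xj ji; have vl := eqc l i xl li.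
  apply/eqP; apply: contraT => vi.
  case: (Pv) => [[a [b [y [z [ab vE]]]]]|[_ [a [y vE]]]].
    have H m : dot v (f m) != 0 -> m = a \/ m = b.
      rewrite vE dot_sv2 //; have [->|am] := eqVneq a m; first by left.
      by have [->|bm] := eqVneq b m; [right|rewrite !mulr0 addr0 eqxx].
    have vj' : dot v (f j) != 0 by rewrite vj.
    have vl' : dot v (f l) != 0 by rewrite vl.
    move: ji li jl; case: (H i vi) => ->; case: (H j vj') => ->; case: (H l vl') => ->;
      by rewrite ?eqxx.
  have H m : dot v (f m) != 0 -> m = a.
    by rewrite vE dot_sv //; have [->|am] := eqVneq a m; rewrite ?mulr0 ?eqxx.
  have vj' : dot v (f j) != 0 by rewrite vj.
  by move: ji; rewrite (H i vi) (H j vj') eqxx.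
split=> // u /alC alu.
have zL i : i \in L -> dot u (f i) = 0.
  move=> iL; have iL' := iL; move: iL'; rewrite inE => /andP[_ xi].
  case: alu => [[h [l [y [xl ->]]]]|[l [m [y [z [lm xlm _ ->]]]]]].
    rewrite dot_sv //; case: eqP => [li|]; last by rewrite mulr0.
    by move: xi; rewrite h -li xl eqxx.
  rewrite dot_sv2 //; case: eqP => [li|_].
    by have := L1 i iL m; rewrite -xlm li => /(_ erefl) mi; rewrite li mi eqxx in lm.
  case: eqP => [mi|_]; last by rewrite !mulr0 addr0.
  by have := L1 i iL l; rewrite xlm mi => /(_ erefl) li; rewrite li mi eqxx in lm.
have zp c : dot u (f (p c)) + dot u (f (q c)) = 0.
  have [xq g H] := pqP c; have pq := pq_neq upq c c.
  case: alu => [[h [l [y [xl ->]]]]|[l [m [y [z [lm xlm yz ->]]]]]].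
    rewrite !dot_sv //; have -> : (l == p c) = false.
      by apply: contraNF g => /eqP <-; rewrite xl.
    have -> : (l == q c) = false by apply: contraNF g => /eqP lq; rewrite -xq -lq xl.
    by rewrite !mulr0 addr0.
  rewrite !dot_sv2 //.
  have yz' : x l = x (p c) -> sg R y + sg R z = 0.
    move=> xl; move: yz; rewrite xl (negPf g); case: (y) (z) => [] [] //= _.
      by rewrite addNr.
    by rewrite addrN.
  have Hl := H l; have Hm := H m; rewrite -xlm in Hm.
  have [lp|lp] := eqVneq l (p c).
    have [|mp|mq] := Hm; first by rewrite lp.
      by rewrite lp mp eqxx in lm.
    by rewrite lp mq pq (qp_neq upq) eqxx !mulr0 !mulr1 addr0 add0r yz' // lp.
  have [lq|lq] := eqVneq l (q c).
    have [|mp|mq] := Hm; first by rewrite lq.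
      by rewrite mp pq eqxx !mulr0 !mulr1 addr0 add0r addrC yz' // lq.
    by rewrite lq mq eqxx in lm.
  have [mp|mp] := eqVneq m (p c).
    have [|lE|lE] := Hl; first by rewrite xlm mp.
      by rewrite lE eqxx in lp.
    by rewrite lE eqxx in lq.
  have [mq|mq] := eqVneq m (q c).
    have [|lE|lE] := Hl; first by rewrite xlm mq.
      by rewrite lE eqxx in lp.
    by rewrite lE eqxx in lq.
  by rewrite !mulr0 !addr0.
have : rts Phi f false L p q v by split.
case/(rts_cases f_on upq) => [[_ [i [y [iL ->]]]]|[i [j [y [z [iL jL _ ->]]]]]|[c [y ->]]].
- by rewrite dotZr zL ?mulr0.
- by rewrite dotDr !dotZr !zL ?mulr0 ?addr0.
by rewrite dotZr dotDr dotZr mul1r zp mulr0.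
Qed.

End DoubleOrth.

Lemma perm_of_uniq (T : finType) (s t : seq T) :
  uniq s -> uniq t -> size s = size t -> exists sigma : {perm T}, map sigma s = t.
Proof.
elim: s t => [|x s IH] [|y t] // => [_ _ _|/= /andP[xs us] /andP[yt ut] [st]].
  by exists 1%g.
have [sigma E] := IH t us ut st.
exists (sigma * tperm (sigma x) y)%g; rewrite permM tpermL; congr (_ :: _).
rewrite -E; apply/eq_in_map => z zs; rewrite permM tpermD //.
  by rewrite (inj_eq perm_inj); apply: contraNneq xs => ->.
by apply: contraNneq yt => ->; rewrite -E map_f.
Qed.

Lemma card_symdiff (T : finType) (A B : {set T}) :
  odd #|[set i | (i \in A) (+) (i \in B)]| = odd (#|A| + #|B|).
Proof.
have E : [set i | (i \in A) (+) (i \in B)] = (A :\: B) :|: (B :\: A).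
  by apply/setP => i; rewrite !inE; case: (i \in A); case: (i \in B).
rewrite E cardsU (_ : _ :&: _ = set0) ?cards0 ?subn0; last first.
  by apply/setP => i; rewrite !inE; case: (i \in A); case: (i \in B).
rewrite -(cardsID B A) -(cardsID A B) (setIC B A) !oddD.
by case: (odd #|A :&: B|); case: (odd #|A :\: B|); case: (odd #|B :\: A|).
Qed.

(** * W as a group of signed permutations *)

Section SignedGroup.
Variables (R : realType) (gT : finGroupType) (W : {group gT}) (d : nat).
Variable rG : mx_representation R W d.
Variables (n : nat) (s : 'I_n -> gT) (b e : 'I_n -> 'rV[R]_d) (sh : bool).
Hypothesis e_on : Defs.orthonormal e.
Let Phi := frame_root sh e.
Hypothesis RS : root_system rG s b Phi.
Implicit Types (S T M L : {set 'I_n}) (u v : 'rV[R]_d) (P Q : {group gT}).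

Local Notation sf S := (signed_frame S e).
Local Notation gp := (gp rG).

Definition signed_perm (N : 'M[R]_d) (sigma : {perm 'I_n}) (eps : 'I_n -> bool) :=
  (forall i, e i *m N = sv e (eps i) (sigma i)) /\ (sh \/ \prod_i sg R (eps i) = 1).

Lemma svF i : sv e false i = e i.
Proof. exact: scale1r. Qed.

Lemma reflmx_root2 x y i j k : i != j -> e k *m reflmx (sv e x i + sv e y j) =
  sv e (~~ (x (+) y) && ((k == i) || (k == j))) (tperm i j k).
Proof.
move=> ij; have ji : (j == i) = false by rewrite eq_sym (negPf ij).
rewrite reflmxE; set v := sv e x i + sv e y j.
have ve l : dot v (e l) = sg R x * (i == l)%:R + sg R y * (j == l)%:R by apply: dot_sv2.
have vk : dot (e k) v = sg R x * (i == k)%:R + sg R y * (j == k)%:R by rewrite dotC ve.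
have vv : dot v v = 2.
  rewrite {2}/v dotDr !dotZr !ve !eqxx (negPf ij) ji.
  by rewrite !mulr0 !mulr1 addr0 add0r !sg_sqr.
rewrite vv vk mulrC mulKf ?pnatr_eq0 // /v /sv.
case: tpermP => [->|->|/eqP ki /eqP kj].
- rewrite eqxx ji mulr0 mulr1 addr0 scalerDr !scalerA sg_sqr scale1r opprD addNKr.
  by rewrite andbT sgM -scaleNr; case: (x (+) y); rewrite /sg ?opprK.
- rewrite eqxx (negPf ij) mulr0 mulr1 add0r scalerDr !scalerA sg_sqr scale1r orbT andbT.
  rewrite opprD addrCA subrr addr0 sgM addbC -scaleNr.
  by case: (x (+) y); rewrite /sg ?opprK.
rewrite [i == k]eq_sym [j == k]eq_sym (negPf ki) (negPf kj) !mulr0 addr0 scale0r.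
by rewrite subr0 andbF scale1r.
Qed.

Lemma reflmx_root1 i k : e k *m reflmx (e i) = sv e (k == i) k.
Proof.
rewrite reflmxE /sv !e_on eqxx divr1; case: eqP => [->|ki].
  by rewrite mulr1 -[X in X - _]scale1r -scalerBl /sg; congr (_ *: _); ring.
by rewrite mulr0 scale0r subr0 scale1r.
Qed.

Lemma reflmx_signed v : Phi v -> exists sigma eps, signed_perm (reflmx v) sigma eps.
Proof.
move=> [[i [j [x [y [ij ->]]]]]|[h [i [x ->]]]].
  exists (tperm i j), (fun k => ~~ (x (+) y) && ((k == i) || (k == j))).
  split=> [k|]; first exact: reflmx_root2.
  right; rewrite (bigD1 i) //= (bigD1 j) /= 1?eq_sym // big1 => [|k /andP[ki kj]].
    by rewrite !eqxx orbT !andbT mulr1 sg_sqr.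
  by rewrite (negPf ki) (negPf kj) andbF.
exists 1%g, (fun k => k == i); split; last by left.
by move=> k; rewrite reflmxZ ?sg_neq0 // perm1 reflmx_root1.
Qed.

Lemma W_signed w : w \in W -> exists sigma eps, signed_perm (rG w) sigma eps.
Proof.
move: w; apply: (rs_gen_ind RS) => [|w i wW [sigma [eps [H1 H2]]]].
  exists 1%g, xpred0; split; first by move=> i; rewrite repr_mx1 mulmx1 perm1 /sv scale1r.
  by right; rewrite big1.
have [tau [del [G1 G2]]] := reflmx_signed (rs_simple RS i).
exists (sigma * tau)%g, (fun k => eps k (+) del (sigma k)); split=> [k|].
  rewrite repr_mxM ?(rs_in RS) // (rs_refl RS) mulmxA H1 /sv -scalemxAl G1 /sv.
  by rewrite scalerA sgM permM.
case: H2 => [|H2]; first by left.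
case: G2 => [|G2]; first by left.
right; under eq_bigr do rewrite -sgM.
rewrite big_split /= H2 mul1r; apply: etrans G2.
by rewrite [RHS](reindex_inj (@perm_inj _ sigma)).
Qed.

Lemma W_refl_e v : Phi v -> exists2 w, w \in W & rG w = reflmx v.
Proof. exact: (Phi_refl RS). Qed.

(** In type B signs are changed one at a time by the reflections in e_i; in type D two at a time, by
    the product of the reflections in e_i - e_j and e_i + e_j. *)
Lemma W_flip S : sh \/ ~~ odd #|S| ->
  exists2 w, w \in W & forall i, e i *m rG w = sf S i.
Proof.
have [m] := ubnP #|S|; elim: m S => // m IH S /ltnSE Sm hS.
have [->|[i iS]] := set_0Vmem S.
  by exists 1%g => // i; rewrite repr_mx1 mulmx1 /signed_frame inE /sv scale1r.
case: hS => [h|ev].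
  have [||w wW wE] := IH (S :\ i); first by move: Sm; rewrite (cardsD1 i S) iS; lia.
    by left.
  have [t tW tE] := W_refl_e (root_e e i h).
  exists (w * t)%g => [|k]; first exact: groupM.
  rewrite repr_mxM // mulmxA wE tE /signed_frame /sv -scalemxAl reflmx_root1.
  rewrite scalerA sgM in_setD1; congr (sg R _ *: _).
  by have [->|] := eqVneq k i; rewrite ?iS ?addbF.
have [j jS] : exists j, j \in S :\ i.
  apply/set0Pn; apply: contraNneq ev => Si.
  by rewrite (cardsD1 i S) iS Si cards0.
have [||w wW wE] := IH (S :\ i :\ j).
- by move: Sm; rewrite (cardsD1 i S) iS (cardsD1 j (S :\ i)) jS; lia.
- by right; move: ev; rewrite (cardsD1 i S) iS (cardsD1 j (S :\ i)) jS /= negbK.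
have ij : i != j by move: jS; rewrite !inE eq_sym => /andP[].
have ji : (j == i) = false by rewrite eq_sym (negPf ij).
have [t tW tE] := W_refl_e (root2 sh e false true ij).
have [t' tW' tE'] := W_refl_e (root2 sh e false false ij).
exists (w * (t * t'))%g => [|k]; first by rewrite !groupM.
rewrite !repr_mxM ?groupM // !mulmxA wE tE tE' [sf _ k]/(sg R _ *: e k) -!scalemxAl.
rewrite reflmx_root2 //= svF reflmx_root2 //= tpermK.
rewrite scalerA sgM !in_setD1.
have jS' : j \in S by move: jS; rewrite inE => /andP[].
congr (sg R _ *: _); case: tpermP => [->|->|/eqP ki /eqP kj].
- by rewrite iS eqxx /= andbF eqxx orbT.
- by rewrite jS' !eqxx.
by rewrite (negPf ki) (negPf kj) addbF.
Qed.

Lemma W_perm (sigma : {perm 'I_n}) :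
  exists2 w, w \in W & forall i, e i *m rG w = e (sigma i).
Proof.
have [ts -> dts] := prod_tpermP sigma.
elim: ts dts => [_|[i j] ts IH /= /andP[ij /IH[w wW wE]]].
  by exists 1%g => // i; rewrite repr_mx1 mulmx1 big_nil perm1.
have [t tW tE] := W_refl_e (root2 sh e false true ij).
exists (t * w)%g => [|k]; first exact: groupM.
rewrite repr_mxM // mulmxA tE reflmx_root2 //= svF wE.
by rewrite big_cons permM.
Qed.

Lemma gp_rts_conj f f' tau M k (p q : 'I_k -> 'I_n) w :
  w \in W -> (forall i, f i *m rG w = f' i) ->
  gp (rts Phi f tau M p q) :^ w = gp (rts Phi f' tau M p q) :> {set gT}.
Proof.
move=> wW ff'; rewrite (gp_conj RS) //; congr (gval _); apply: eq_gp => v.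
have PhiE : Phi (v *m rG w^-1%g) <-> Phi v.
  split=> [/(rs_stable RS wW)|]; first by rewrite repr_mxKV.
  exact: (rs_stable RS (groupVr wW)).
split=> -[Pv v0 vpq]; split; try exact/PhiE.
- by move=> i iM ip iq; rewrite -ff' -(dot_mulV RS) ?v0.
- by move=> c; rewrite -!ff' -!(dot_mulV RS).
- by move=> i iM ip iq; rewrite (dot_mulV RS) // ff' v0.
by move=> c; rewrite !(dot_mulV RS) // !ff'.
Qed.

Lemma rts_reindex f tau M k (p q : 'I_k -> 'I_n) (sigma : {perm 'I_n}) v :
  rts Phi (f \o sigma) tau M p q v <->
  rts Phi f tau [set sigma i | i in M] (sigma \o p) (sigma \o q) v.
Proof.
have cd (r : 'I_k -> 'I_n) i : (sigma i \in codom (sigma \o r)) = (i \in codom r).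
  apply/codomP/codomP => -[c E]; exists c; last by rewrite E.
  exact: perm_inj E.
split=> -[Pv v0 vpq]; split=> // i.
  rewrite -[i](permKV sigma) mem_imset ?cd; last exact: perm_inj.
  exact: v0.
by move=> iM ip iq; apply: v0; rewrite ?cd // mem_imset //; apply: perm_inj.
Qed.

(** Outside the pairs [rts] only requires certain coordinates to vanish, so only the signs at the
    points of the pairs matter. *)
Lemma rts_signs S S' tau M k (p q : 'I_k -> 'I_n) :
  (forall i, i \in codom p ++ codom q -> (i \in S) = (i \in S')) ->
  forall v, rts Phi (sf S) tau M p q v -> rts Phi (sf S') tau M p q v.
Proof.
move=> SS v [Pv v0 vpq]; split=> // [i iM ip iq|c].
  have := v0 i iM ip iq; rewrite !dotZr => /eqP; rewrite mulf_eq0 (negPf (sg_neq0 _ _)).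
  by move=> /eqP ->; rewrite mulr0.
have := vpq c; rewrite /signed_frame /sv !SS // mem_cat codom_f ?orbT //.
Qed.

Lemma eq_rts_signs S S' tau M k (p q : 'I_k -> 'I_n) :
  (forall i, i \in codom p ++ codom q -> (i \in S) = (i \in S')) ->
  gp (rts Phi (sf S) tau M p q) = gp (rts Phi (sf S') tau M p q).
Proof.
move=> SS; apply: eq_gp => v; split; first exact: rts_signs.
by apply: rts_signs => i /SS.
Qed.

Definition configuration m k M (p q : 'I_k -> 'I_n) :=
  #|M| = m /\ uniq (enum M ++ codom p ++ codom q).

(** A permutation matches the points and a sign change then matches the signs. In type D only an
    even number of signs can be changed, but a point outside the pairs absorbs one more. *)
Lemma gp_rts_transport S S' m k M M' (p q p' q' : 'I_k -> 'I_n) :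
  configuration m M p q -> configuration m M' p' q' ->
  [\/ sh, ~~ odd (#|S| + #|S'|) | exists i, i \notin codom p' ++ codom q'] ->
  exists2 w, w \in W &
    gp (rts Phi (sf S) true M p q) :^ w = gp (rts Phi (sf S') true M' p' q') :> {set gT}.
Proof.
move=> [cM uM] [cM' uM'] cond.
have [|sigma sE] := perm_of_uniq uM uM'.
  by rewrite !size_cat !size_codom -!cardE cM cM'.
have [E1 /eqP] : map sigma (enum M) = enum M' /\
    map sigma (codom p ++ codom q) == codom p' ++ codom q'.
  move/eqP: sE; rewrite map_cat eqseq_cat ?size_map -?cardE ?cM ?cM' //.
  by move=> /andP[/eqP -> ->].
rewrite map_cat => /eqP; rewrite eqseq_cat ?size_map ?size_codom // => /andP[/eqP E2 /eqP E3].
have EM : [set sigma i | i in M] = M'.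
  apply/setP => i; rewrite -[RHS]mem_enum -E1; apply/imsetP/mapP => -[j jM ->]; exists j => //.
    by rewrite mem_enum.
  by rewrite mem_enum in jM.
have Ecod (r r' : 'I_k -> 'I_n) : map sigma (codom r) = codom r' -> sigma \o r = r'.
  rewrite /codom /image_mem -map_comp => E; apply/funext => c.
  by have /eq_in_map := E; apply; rewrite mem_enum.
have [w1 w1W w1E] := W_perm sigma.
have step1 : gp (rts Phi (sf S) true M p q) :^ w1 =
    gp (rts Phi (sf [set sigma i | i in S]) true M' p' q') :> {set gT}.
  rewrite (gp_rts_conj (f' := sf [set sigma i | i in S] \o sigma) _ _ _ _ w1W) => [|i].
    congr (gval _); apply: eq_gp => v; rewrite rts_reindex EM.
    by rewrite (Ecod _ _ E2) (Ecod _ _ E3).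
  rewrite /= /signed_frame /sv -scalemxAl w1E mem_imset //; exact: perm_inj.
have cS : #|[set sigma i | i in S]| = #|S| by rewrite card_imset //; apply: perm_inj.
set S1 := [set sigma i | i in S] in step1 cS.
have step2 S2 : sh \/ ~~ odd (#|S1| + #|S2|) -> exists2 w, w \in W &
    gp (rts Phi (sf S) true M p q) :^ w = gp (rts Phi (sf S2) true M' p' q') :> {set gT}.
  rewrite -card_symdiff => /W_flip[w2 w2W w2E].
  exists (w1 * w2)%g; first exact: groupM.
  rewrite conjsgM step1; apply: gp_rts_conj => // i.
  rewrite /signed_frame /sv -scalemxAl w2E /signed_frame /sv scalerA sgM inE.
  by rewrite addbA addbb.
case: cond => [h|ev|[i0 i0P]].
- by apply: step2; left.
- by apply: step2; right; rewrite cS.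
have [od|ev] := boolP (odd (#|S1| + #|S'|)); last by apply: step2; right.
have [|w wW E] := step2 [set i | (i \in S') (+) (i \in [set i0])].
  right; rewrite oddD card_symdiff cards1 oddD; move: od; rewrite oddD.
  by case: (odd _); case: (odd _).
exists w => //; apply: etrans E _; congr (gval _); apply: eq_rts_signs => i iP.
by rewrite inE in_set1; case: eqP => [ii|]; [rewrite -ii iP in i0P|rewrite addbF].
Qed.

End SignedGroup.

(** * Concepts of types B and D in coordinates *)

Section SignedConcepts.
Variables (R : realType) (gT : finGroupType) (W : {group gT}) (d : nat).
Variable rG : mx_representation R W d.
Variables (n : nat) (s : 'I_n -> gT) (b e : 'I_n -> 'rV[R]_d) (sh : bool).
Hypothesis e_on : Defs.orthonormal e.
Let Phi := frame_root sh e.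
Hypothesis RS : root_system rG s b Phi.
Implicit Types (S T M L : {set 'I_n}) (u v : 'rV[R]_d) (P Q : {group gT}).

Local Notation sf S := (signed_frame S e).
Local Notation gp := (gp rG).
Local Notation pts p q := (codom p ++ codom q).

(** Negating the vectors at the points of [q] turns sums into differences. *)
Lemma rts_flip S L k (p q : 'I_k -> 'I_n) v : uniq (pts p q) ->
  rts Phi (sf S) false L p q v <->
  rts Phi (sf [set i | (i \in S) (+) (i \in codom q)]) true L p q v.
Proof.
move=> upq.
have pE c : (p c \in codom q) = false.
  by apply/codomP => -[c' E]; have := pq_neq upq c c'; rewrite E eqxx.
have s1 (x : R) : sg R true * x = - x by rewrite /sg mulN1r.
have s0 (x : R) : sg R false * x = x by rewrite /sg mul1r.
split=> -[Pv v0 vpq]; split=> // [i iM ip iq|c].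
- by have := v0 i iM ip iq; rewrite /signed_frame inE (negPf iq) addbF.
- have := vpq c; rewrite /signed_frame !inE pE codom_f addbT addbF s0 s1 => ->.
  by rewrite -svN dotNr opprK.
- by have := v0 i iM ip iq; rewrite /signed_frame inE (negPf iq) addbF.
have := vpq c; rewrite /signed_frame !inE pE codom_f addbT addbF s0 s1 => ->.
by rewrite -svN dotNr opprK.
Qed.

Lemma rts_single f tau L k (p q : 'I_k -> 'I_n) v : Defs.orthonormal f ->
  Phi = frame_root sh f -> uniq (pts p q) -> ~~ sh -> #|L| = 1%N ->
  (forall i, i \in L -> i \notin pts p q) ->
  rts Phi f tau L p q v <-> rts Phi f tau set0 p q v.
Proof.
move=> f_on PhiE upq /negPf nsh /eqP/cards1P[j ->] jpq; split=> rv; last first.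
  by have [Pv v0 vpq] := rv; split=> // i _; apply: v0; rewrite inE.
have [Pv v0 vpq] := rv; split=> // i _ ip iq.
have := rv; rewrite PhiE => /(rts_cases f_on upq) [[h]|[a [a' [x [y [aj a'j aa' _]]]]]|].
- by rewrite h in nsh.
- by move: aj a'j aa'; rewrite !inE => /eqP -> /eqP ->; rewrite eqxx.
move=> [c [x ->]]; rewrite dotZl dotDl dotZl !f_on.
have -> : (p c == i) = false by apply: contraNF ip => /eqP <-; apply: codom_f.
have -> : (q c == i) = false by apply: contraNF iq => /eqP <-; apply: codom_f.
by rewrite mulr0 addr0 mulr0.
Qed.

(* The groups of type B_m A_1^k, or D_m A_1^k; in type D_n with n = 2 k and
   m = 0, [par] is false for (A_1^k)^+ and true for (A_1^k)^-. *)
Definition pair_class par m k P := exists S M (p q : 'I_k -> 'I_n),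
  [/\ configuration m M p q, sh \/ odd #|S| = par
    & P = gp (rts Phi (sf S) true M p q)].

Lemma pair_class_conj par m k P w : w \in W -> pair_class par m k P -> pair_class par m k (P :^ w)%G.
Proof.
move=> wW [S [M [p [q [[cM uM] Sp ->]]]]].
have [sigma [eps [wE weps]]] := W_signed e_on RS wW.
pose T := [set i | (i \in S) (+) eps i].
pose T' := [set sigma i | i in T].
exists T', [set sigma i | i in M], (sigma \o p), (sigma \o q); split.
- split; first by rewrite card_imset //; apply: perm_inj.
  have E : uniq (map sigma (enum M) ++ map sigma (codom p) ++ map sigma (codom q)).
    by rewrite -!map_cat map_inj_uniq //; apply: perm_inj.
  have Ec (r : 'I_k -> 'I_n) : codom (sigma \o r) = map sigma (codom r) by exact: map_comp.
  rewrite !Ec (perm_uniq (s2 := map sigma (enum M) ++ map sigma (codom p) ++ map sigma (codom q))) //.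
  rewrite perm_cat2r.
  apply: uniq_perm; rewrite ?enum_uniq ?map_inj_uniq ?enum_uniq //; first exact: perm_inj.
  move=> i; rewrite mem_enum; apply/imsetP/mapP => -[j jM ->]; exists j => //.
    by rewrite mem_enum.
  by rewrite -mem_enum.
- case: Sp => [|Sp]; [by left|case: weps => [|weps]; [by left|right]].
  rewrite card_imset; last exact: perm_inj.
  have ce : odd #|[set i | eps i]| = false.
    move: weps; rewrite (bigID eps) /= mulrC big1 ?mul1r; last first.
      by move=> i; rewrite /sg => /negPf ->.
    rewrite (eq_bigr (fun=> -1)) => [|i]; last by rewrite /sg => ->.
    rewrite prodr_const cardsE -signr_odd => /eqP H.
    apply/negbTE; apply: contraTN H => ->; rewrite /= expr1.
    by rewrite eq_sym -subr_eq0 opprK -mulr2n pnatr_eq0.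
  have -> : T = [set i | (i \in S) (+) (i \in [set i | eps i])].
    by apply/setP => i; rewrite !inE.
  by rewrite card_symdiff oddD ce addbF.
apply/val_inj; rewrite /= (gp_rts_conj (f' := sf T' \o sigma) RS) // => [|i].
  by congr (gval _); apply: eq_gp => v; rewrite rts_reindex.
rewrite /= /signed_frame /sv -scalemxAl wE /sv scalerA sgM mem_imset ?inE //.
exact: perm_inj.
Qed.

(** A sign change at a point outside the pairs alters the parity of [S] but not the group; in type B
    the parity is not prescribed at all. *)
Lemma pair_class_parity par par' m k P : sh \/ (k.*2 < n)%N -> pair_class par m k P -> pair_class par' m k P.
Proof.
move=> H [S [M [p [q [cf Sp ->]]]]].
case: H => [h|kn]; first by exists S, M, p, q; split=> //; left.
have [i ip] : exists i, i \notin pts p q.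
  apply: contrapT => nex; move: kn; rewrite ltnNge => /negP; apply.
  have <- : #|[set i in pts p q]| = n.
    rewrite (_ : [set i in pts p q] = setT) ?cardsT ?card_ord //.
    apply/setP => i; rewrite !inE; apply/negbNE/negP => ip.
    by apply: nex; exists i.
  have [_] := cf; rewrite cat_uniq => /and3P[_ _ /card_uniqP H].
  by rewrite cardsE H size_cat !size_codom !card_ord addnn.
have [|] := boolP (odd #|S| == par') => [/eqP Sp'|Sp'].
  by exists S, M, p, q; split=> //; right.
exists [set j | (j \in S) (+) (j \in [set i])], M, p, q; split=> //.
  by right; rewrite card_symdiff cards1 addn1 /=; case: (odd _) par' Sp' => -[].
apply: eq_rts_signs => j jp; rewrite !inE; case: eqP => [ji|]; last by rewrite addbF.
by rewrite -ji jp in ip.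
Qed.

Lemma pair_class_transport par m k P P' : pair_class par m k P -> pair_class par m k P' -> Defs.conjugate W P P'.
Proof.
move=> [S [M [p [q [cf Sp ->]]]]] [S' [M' [p' [q' [cf' Sp' ->]]]]].
have [|w wW E] := gp_rts_transport e_on RS (S := S) (S' := S') cf cf'.
  case: Sp => [h|E]; first exact: Or31.
  case: Sp' => [h|E']; first exact: Or31.
  by apply: Or32; rewrite oddD E E' addbb.
by exists w.
Qed.

Lemma exists_configuration m k : (m + k.*2 <= n)%N ->
  exists M (p q : 'I_k -> 'I_n), configuration m M p q.
Proof.
move=> mk.
have pn (c : 'I_k) : (m + c < n)%N by have := ltn_ord c; lia.
have qn (c : 'I_k) : (m + k + c < n)%N by have := ltn_ord c; lia.
have mn : (m <= n)%N by lia.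
exists [set i : 'I_n | i < m]%N, (fun c => Ordinal (pn c)), (fun c => Ordinal (qn c)).
have pl i : i \in codom (fun c => Ordinal (pn c)) -> (m <= i < m + k)%N.
  by case/codomP => c -> /=; have := ltn_ord c; lia.
have ql i : i \in codom (fun c => Ordinal (qn c)) -> (m + k <= i)%N.
  by case/codomP => c -> /=; lia.
split.
  have -> : [set i : 'I_n | i < m]%N = [set widen_ord mn i | i : 'I_m].
    apply/setP => i; rewrite inE; apply/idP/imsetP => [im|[j _ ->]]; last exact: (ltn_ord j).
    by exists (Ordinal im) => //; apply: val_inj.
  by rewrite card_imset ?card_ord // => i j /(congr1 val) /= /val_inj.
rewrite !cat_uniq enum_uniq /=; apply/and3P; split.
- apply/hasPn => i; rewrite mem_cat => /orP[/pl|/ql] h; rewrite /= mem_enum inE; lia.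
- by apply/injectiveP => c c' /(congr1 val) /= /addnI/val_inj.
apply/andP; split; last by apply/injectiveP => c c' /(congr1 val) /= /addnI/val_inj.
by apply/hasPn => i /ql h; apply/negP => /pl; lia.
Qed.

Definition rest k M (p q : 'I_k -> 'I_n) := [set i | (i \notin M) && (i \notin pts p q)].

Lemma card_rest m k M (p q : 'I_k -> 'I_n) : configuration m M p q ->
  n = (m + #|rest M p q| + k.*2)%N.
Proof.
move=> [cM uM]; have [upq Mpq] : uniq (pts p q) /\ ~~ has (mem (enum M)) (pts p q).
  by move: uM; rewrite cat_uniq => /and3P[].
have E : rest M p q = ~: (M :|: [set i in pts p q]).
  by apply/setP => i; rewrite !inE negb_or.
have := cardsC (M :|: [set i in pts p q]); rewrite -E card_ord cardsU cM.
rewrite (_ : _ :&: _ = set0) ?cards0 ?subn0; last first.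
  apply/setP => i; rewrite !inE; apply/andP => -[iM ip].
  by move/hasPn: Mpq => /(_ i ip); rewrite /= mem_enum iM.
by rewrite cardsE (card_uniqP upq) size_cat !size_codom card_ord addnn; lia.
Qed.

Lemma configuration_pts m k M (p q : 'I_k -> 'I_n) : configuration m M p q ->
  uniq (pts p q) /\ forall i, i \in M -> i \notin pts p q.
Proof.
move=> [_]; rewrite cat_uniq => /and3P[_ /hasPn H upq]; split=> // i iM.
by apply/negP => /H; rewrite /= mem_enum iM.
Qed.

Lemma configuration_intro k M (p q : 'I_k -> 'I_n) : uniq (pts p q) ->
  (forall i, i \in M -> i \notin pts p q) -> configuration #|M| M p q.
Proof.
move=> upq Mpq; split=> //; rewrite cat_uniq enum_uniq upq andbT /=.
by apply/hasPn => i ip; apply/negP; rewrite /= mem_enum => /Mpq; rewrite ip.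
Qed.

Lemma rest_pts k M (p q : 'I_k -> 'I_n) i : i \in rest M p q -> i \notin pts p q.
Proof. by rewrite inE => /andP[]. Qed.

Lemma fix_gp Psi u : (forall v, Psi v -> Phi v) ->
  (forall w, w \in gp Psi -> u *m rG w = u) <-> (forall v, Psi v -> dot v u = 0).
Proof.
move=> PP; split=> [H v Pv|H w wP]; last first.
  by apply: gp_fix wP _ H => v /PP/(rs_neq0 RS).
have [t tW tv] := Phi_refl RS (PP v Pv); rewrite dotC; apply/eqP.
rewrite -reflmx_fix ?(rs_neq0 RS (PP v Pv)) // -tv H //.
by apply: mem_gen; apply: mem_refls_in tv.
Qed.

Lemma signed_PhiE S : Phi = frame_root sh (sf S).
Proof. by rewrite frame_root_signed. Qed.

Lemma signed_on S : Defs.orthonormal (sf S).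
Proof. exact: orthonormal_signed. Qed.

Section Fixed.
Variables (f : 'I_n -> 'rV[R]_d) (M : {set 'I_n}) (m k : nat) (p q : 'I_k -> 'I_n).
Hypothesis f_on : Defs.orthonormal f.
Hypothesis PhiE : Phi = frame_root sh f.
Hypothesis cf : configuration m M p q.
Hypothesis hm : sh \/ m != 1%N.
Let upq := (configuration_pts cf).1.
Let Mpq := (configuration_pts cf).2.
Let F u := forall v, rts Phi f true M p q v -> dot v u = 0.

Lemma fixed_in i u : i \in M -> F u -> dot u (f i) = 0.
Proof.
move=> iM Fu; have Fv v : Phi v -> (forall l, l \notin M -> dot v (f l) = 0) -> dot v u = 0.
  by rewrite PhiE => Pv vM; apply: Fu; rewrite PhiE; apply: (rts_free _ Mpq iM Pv vM).
case: hm => [h|m1].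
  rewrite dotC; apply: Fv => [|l lM]; first by rewrite PhiE; apply: root_e.
  by rewrite f_on; case: eqP lM => // <-; rewrite iM.
have [j jM ji] : exists2 j, j \in M & j != i.
  apply/exists_inP; apply: contraNT m1; rewrite negb_exists_in => /forall_inP H.
  have [<- _] := cf; apply/cards1P; exists i; apply/setP => j; rewrite inE.
  by apply/idP/eqP => [jM|-> //]; apply/eqP; have := H j jM; rewrite negbK.
have lij l : l \notin M -> (i == l) = false /\ (j == l) = false.
  by move=> lM; split; apply: contraNF lM => /eqP <-.
have vp : dot (f i + f j) u = 0.
  apply: Fv => [|l /lij[h1 h2]]; first by rewrite PhiE; apply: root_plus; rewrite eq_sym.
  by rewrite dotDl !f_on h1 h2 addr0.
have vm : dot (f i - f j) u = 0.
  apply: Fv => [|l /lij[h1 h2]]; first by rewrite PhiE; apply: root_minus; rewrite eq_sym.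
  by rewrite dotBl !f_on h1 h2 subr0.
by move: vp vm; rewrite dotDl dotBl ![dot _ u]dotC => ? ?; lra.
Qed.

(** A vector fixed by the group whose coordinates vanish exactly on [M]. It reveals [M] and, if [M]
    is empty, the signs of the frame at the pairs. *)
Definition fixed_sum := \sum_(j | j \notin M) f j.

Lemma dot_fixed_sum i : dot fixed_sum (f i) = (i \notin M)%:R.
Proof.
rewrite /fixed_sum dot_suml (eq_bigr (fun j => (j == i)%:R)) => [|j _]; last exact: f_on.
have [iM|iM] := boolP (i \in M).
  by apply: big1 => j jM; case: eqP jM => // ->; rewrite iM.
by rewrite (bigD1 i) //= eqxx big1 ?addr0 // => j /andP[_ /negPf ->].
Qed.

Lemma fixed_sumP : F fixed_sum.
Proof.
move=> v; rewrite PhiE => /(rts_cases f_on upq)[[_ [i [x [iM ->]]]]|[i [j [x [y [iM jM _ ->]]]]]|].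
- by rewrite dotZl dotC dot_fixed_sum iM mulr0.
- by rewrite dotDl !dotZl ![dot (f _) _]dotC !dot_fixed_sum iM jM !mulr0 addr0.
move=> [c [x ->]]; rewrite dotZl dotDl dotZl ![dot (f _) _]dotC !dot_fixed_sum.
have pM : p c \notin M by apply/negP => /Mpq; rewrite mem_cat (codom_f p c).
have qM : q c \notin M by apply/negP => /Mpq; rewrite mem_cat (codom_f q c) orbT.
by rewrite pM qM /sg mulr1 addrN mulr0.
Qed.

Lemma fixed_frame i : F (f i) <-> i \in rest M p q.
Proof.
split=> [Fi|]; last first.
  rewrite inE mem_cat negb_or => /and3P[iM ip iq] v [_ v0 _]; exact: v0.
rewrite inE; apply/andP; split.
  apply/negP => iM; have := fixed_in iM Fi; rewrite f_on eqxx => /eqP.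
  by rewrite oner_eq0.
have H c : dot (f (p c) + sg R true *: f (q c)) (f i) = 0.
  apply: Fi; rewrite PhiE; exact: rts_pair.
rewrite mem_cat negb_or; apply/andP; split; apply/negP => /codomP[c E]; have := H c.
  rewrite dotDl dotZl !f_on E eqxx qp_neq // mulr0 addr0 => /eqP; by rewrite oner_eq0.
rewrite dotDl dotZl !f_on E eqxx pq_neq // mulr1 add0r => /eqP.
by rewrite (negPf (sg_neq0 _ _)).
Qed.

Lemma fixed_pair u c : F u -> dot u (f (p c)) = dot u (f (q c)).
Proof.
move=> Fu; have : dot (f (p c) + sg R true *: f (q c)) u = 0.
  by apply: Fu; rewrite PhiE; apply: rts_pair.
rewrite dotDl dotZl /sg mulN1r ![dot (f _) u]dotC => /eqP; rewrite subr_eq0 => /eqP; exact.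
Qed.

End Fixed.

(** [M] consists of the points where all fixed vectors vanish, and the points outside [M] and the
    pairs are those whose basis vector is fixed; counting gives [m] and [k]. *)
Lemma pair_class_inj par par' m m' k k' P : sh \/ m != 1%N -> sh \/ m' != 1%N ->
  pair_class par m k P -> pair_class par' m' k' P -> (m = m' /\ k = k').
Proof.
move=> hm hm' [S [M [p [q [cf _ PE]]]]] [S' [M' [p' [q' [cf' _]]]]].
have PP T L j (r r' : 'I_j -> 'I_n) v : rts Phi (sf T) true L r r' v -> Phi v by case.
rewrite PE => E.
have FE u : (forall v, rts Phi (sf S) true M p q v -> dot v u = 0) <->
    (forall v, rts Phi (sf S') true M' p' q' v -> dot v u = 0).
  rewrite -!fix_gp //; try exact: PP.
  by rewrite E.
have sub T T' L L' j j' (r1 r2 : 'I_j -> 'I_n) (r1' r2' : 'I_j' -> 'I_n) l :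
    configuration l L r1 r2 -> sh \/ l != 1%N -> configuration #|L'| L' r1' r2' ->
    (forall u, (forall v, rts Phi (sf T') true L' r1' r2' v -> dot v u = 0) ->
      (forall v, rts Phi (sf T) true L r1 r2 v -> dot v u = 0)) -> L \subset L'.
  move=> cL hl cL' H; apply/subsetP => i iL.
  have := fixed_in (signed_on T) (signed_PhiE T) cL hl iL
    (H _ (fixed_sumP (signed_on T') (signed_PhiE T') cL')).
  have : dot (fixed_sum (sf T') L') (sf T' i) = (i \notin L')%:R.
    by apply: dot_fixed_sum; apply: signed_on.
  rewrite !dotZr; case: (i \in L') => //= h1 /eqP; rewrite mulf_eq0 (negPf (sg_neq0 _ _)) /=.
  by move/eqP => h2; move: h1; rewrite h2 mulr0 => /esym/eqP; rewrite oner_eq0.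
have cM : #|M| = m by case: cf.
have cM' : #|M'| = m' by case: cf'.
have cf2 : configuration #|M| M p q by rewrite cM.
have cf2' : configuration #|M'| M' p' q' by rewrite cM'.
have MM : M = M'.
  apply/eqP; rewrite eqEsubset; apply/andP; split.
    by apply: (sub S S' _ _ _ _ _ _ _ _ _ cf hm cf2') => u Fu; apply/FE.
  by apply: (sub S' S _ _ _ _ _ _ _ _ _ cf' hm' cf2) => u Fu; apply/FE.
have RR : rest M p q = rest M' p' q'.
  have FZ T L j (r r' : 'I_j -> 'I_n) T' i :
      (forall v, rts Phi (sf T) true L r r' v -> dot v (sf T' i) = 0) <->
      (forall v, rts Phi (sf T) true L r r' v -> dot v (e i) = 0).
    split=> H v /H; last by rewrite dotZr => ->; rewrite mulr0.
    by rewrite dotZr => /eqP; rewrite mulf_eq0 (negPf (sg_neq0 _ _)) => /eqP.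
  by apply/setP => i; apply/idP/idP;
    [rewrite -(fixed_frame (signed_on S) (signed_PhiE S) cf hm) -(fixed_frame (signed_on S') (signed_PhiE S') cf' hm')
    |rewrite -(fixed_frame (signed_on S') (signed_PhiE S') cf' hm') -(fixed_frame (signed_on S) (signed_PhiE S) cf hm)];
    rewrite FZ => /FE; rewrite FZ.
have E1 := card_rest cf; have := card_rest cf'; rewrite -RR -cM' -MM cM => E2.
split=> //; lia.
Qed.

(** The sum of the first frame is fixed, and its coordinates in the second frame are the signs of
    the symmetric difference of [S] and [S']. They agree at the two points of each pair of the
    second group, and these pairs fill all points, so the symmetric difference is even. *)
Lemma pair_class_parity_inj par par' k P : ~~ sh -> n = k.*2 ->
  pair_class par 0 k P -> pair_class par' 0 k P -> par = par'.
Proof.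
move=> nsh nk [S [M [p [q [cf hS PE]]]]] [S' [M' [p' [q' [cf' hS' PE']]]]].
have {}hS : odd #|S| = par by case: hS => // h; rewrite h in nsh.
have {}hS' : odd #|S'| = par' by case: hS' => // h; rewrite h in nsh.
have M0 : M = set0 by apply: cards0_eq; case: cf.
have PP T L j (r r' : 'I_j -> 'I_n) v : rts Phi (sf T) true L r r' v -> Phi v by case.
have Fu v : rts Phi (sf S') true M' p' q' v -> dot v (fixed_sum (sf S) M) = 0.
  move: v; apply/(fix_gp _ (PP _ _ _ _ _)); rewrite -PE' PE; apply/fix_gp; first exact: PP.
  exact: fixed_sumP (signed_on S) (signed_PhiE S) cf.
have us i : dot (fixed_sum (sf S) M) (sf S' i) = sg R ((i \in S) (+) (i \in S')).
  have := dot_fixed_sum M (signed_on S) i; rewrite M0 inE /= => E.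
  rewrite dotZr; have -> : dot (fixed_sum (sf S) set0) (e i) = sg R (i \in S).
    move: E; rewrite dotZr => /(congr1 (fun x => sg R (i \in S) * x)).
    by rewrite mulrA sg_sqr mul1r mulr1.
  by rewrite mulrC sgM.
have sg_inj x y : sg R x = sg R y -> x = y.
  case: x; case: y => //; rewrite /sg => /eqP.
    by rewrite eq_sym -subr_eq0 opprK -mulr2n pnatr_eq0.
  by rewrite -subr_eq0 opprK -mulr2n pnatr_eq0.
have pq c : ((p' c \in S) (+) (p' c \in S')) = ((q' c \in S) (+) (q' c \in S')).
  by apply: sg_inj; rewrite -!us; apply: (fixed_pair (signed_on S') (signed_PhiE S') cf').
have [upq _] := configuration_pts cf'.
have all_pts i : i \in pts p' q'.
  have := card_rest cf'; rewrite {1}nk => /eqP; rewrite add0n -{1}[k.*2]add0n eqn_add2r eq_sym.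
  have -> : M' = set0 by apply: cards0_eq; case: cf'.
  by rewrite cards_eq0 => /eqP/setP/(_ i); rewrite !inE /= => /negbFE.
apply/eqP; rewrite -hS -hS' -negb_add -oddD -card_symdiff.
rewrite -sum1_card big_mkcond /= -big_enum /=.
have perm : perm_eq (enum 'I_n) (pts p' q').
  apply: uniq_perm => //; first exact: enum_uniq.
  by move=> i; rewrite mem_enum all_pts.
rewrite (perm_big _ perm) big_cat /= /codom /image_mem !big_map.
rewrite [X in (_ + X)%N](eq_bigr (fun c => if p' c \in [set i | (i \in S) (+) (i \in S')] then 1 else 0)%N).
  by rewrite addnn odd_double.
by move=> c _; rewrite !inE pq.
Qed.

Lemma concept_configuration S m k M (p q : 'I_k -> 'I_n) : configuration m M p q ->
  [\/ sh, m != 1%N /\ #|rest M p q| != 1%N | m = 0%N /\ #|rest M p q| = 1%N] ->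
  concept rG (gp (rts Phi (sf S) true M p q)) (gp (rts Phi (sf S) false (rest M p q) p q)).
Proof.
move=> cf; have [upq Mpq] := configuration_pts cf; set L := rest M p q => H.
have [f_on PhiE] := (signed_on S, signed_PhiE S).
have OM : sh \/ m != 1%N ->
    forall v, Orth Phi (rts Phi (sf S) true M p q) v <-> rts Phi (sf S) false L p q v.
  move=> hm v; have [cM _] := cf; rewrite -cM in hm.
  by rewrite PhiE; apply: (Orth_rts f_on upq _ Mpq) => // i; rewrite inE.
have ME i : (i \in M) = (i \notin L) && (i \notin pts p q).
  rewrite inE; have [iM|iM] := boolP (i \in M); first by rewrite Mpq.
  by case: (i \in pts p q).
have sub tau N v : rts Phi (sf S) tau N p q v -> Phi v by case.
apply: (gp_concept RS (Psi := rts Phi (sf S) true M p q) (Psi' := rts Phi (sf S) false L p q)) => //.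
- exact: sub.
- exact: sub.
- by apply: eq_gp => v; apply: OM; case: H => [|[]|[->]]; [left|right|right].
apply: eq_gp => v; have [h|/norP[nsh]] := boolP (sh || (#|L| != 1%N)).
  rewrite PhiE; apply: (Orth_rts f_on upq _ (@rest_pts _ M p q) ME).
  by move/orP: h.
rewrite negbK => /eqP L1.
have M0 : M = set0.
  apply: cards0_eq; have [-> _] := cf; case: H => [h|[_]|[]//]; first by rewrite h in nsh.
  by rewrite L1.
have ext Psi Psi' u : (forall v, Psi v <-> Psi' v) -> Orth Phi Psi u -> Orth Phi Psi' u.
  by move=> E [Pu ou]; split=> // x /E/ou.
have single := rts_single _ _ f_on PhiE upq nsh L1 (@rest_pts _ M p q).
rewrite M0 -single.
have <- : Orth Phi (rts Phi (sf S) false set0 p q) v <-> rts Phi (sf S) true L p q v.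
  rewrite PhiE; apply: (Orth_rts f_on upq) => [i|i|]; rewrite ?inE ?cards0 ?M0 ?inE //.
  by right.
by split; apply: ext => u; rewrite single.
Qed.

(** P and Q share their pairs, with differences in one and sums in the other. Writing the sums as
    differences takes one more sign change for each of the [k] pairs, whence the parity of Q. *)
Lemma concept_normal_form P Q : concept rG P Q -> exists par m l k,
  [/\ pair_class par m k P, pair_class (par (+) odd k) l k Q &
      (n = (m + l + k.*2)%N /\ (sh \/ m != 1%N /\ l != 1%N)) \/
      [/\ ~~ sh, n = k.*2.+1, m = 0%N & l = 0%N]].
Proof.
move=> /(concept_gp RS)[v _ [QE PE]].
(* The sign changes that make the coordinates of [v] nonnegative. *)
pose S := [set i | dot v (e i) < 0]; have [f_on PhiE] := (signed_on S, signed_PhiE S).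
have v0 i : 0 <= dot v (sf S i).
  rewrite /signed_frame /sv dotZr inE /sg; case: ltP => [h|h]; rewrite ?mul1r // mulN1r.
  by rewrite oppr_ge0 ltW.
have [k [p [q [L [upq Lpq hM OE]]]]] := Orth_Orth_vec sh f_on v0.
rewrite -/(rest L p q) -PhiE in hM OE.
pose M := rest L p q.
have [Mpq MLpq] : (forall i, i \in M -> i \notin pts p q) /\
    (forall i, i \in M :|: L -> i \notin pts p q).
  split=> i; first exact: rest_pts.
  by rewrite in_setU => /orP[/rest_pts|/Lpq].
have cM := configuration_intro upq Mpq; have cL := configuration_intro upq Lpq.
have cML := configuration_intro upq MLpq.
have c0 : configuration 0 set0 p q.
  by rewrite -(cards0 'I_n); apply: (configuration_intro upq) => i; rewrite inE.
have nE := card_rest cL; rewrite -/M in nE.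
pose T := [set i | (i \in S) (+) (i \in codom q)].
have TP : odd #|T| = odd #|S| (+) odd k.
  have -> : T = [set i | (i \in S) (+) (i \in [set j in codom q])].
    by apply/setP => i; rewrite !inE.
  have /card_uniqP ucq : uniq (codom q) by move: upq; rewrite cat_uniq => /and3P[].
  by rewrite card_symdiff oddD (cardsE (mem (codom q))) ucq size_codom card_ord.
have Qcls (N : {set 'I_n}) : configuration #|N| N p q ->
    (forall v, rts Phi (sf S) false L p q v <-> rts Phi (sf S) false N p q v) ->
    pair_class (odd #|S| (+) odd k) #|N| k Q.
  move=> cN EN; exists T, N, p, q; split; rewrite ?TP //; first by right.
  by rewrite QE; apply: eq_gp => u; rewrite OE EN rts_flip.
have Pcls (N N' : {set 'I_n}) : configuration #|N| N p q -> sh \/ #|N'| != 1%N ->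
    (forall i, i \in N' -> i \notin pts p q) ->
    (forall i, (i \in N) = (i \notin N') && (i \notin pts p q)) ->
    (forall v, rts Phi (sf S) false L p q v <-> rts Phi (sf S) false N' p q v) ->
    P = gp (rts Phi (sf S) true N p q).
  move=> cN hN' N'pq NE EN; rewrite PE; apply: eq_gp => u.
  rewrite [X in rts X]PhiE -(Orth_rts f_on upq false N'pq NE hN') -PhiE.
  by split=> -[Pu ou]; split=> // x; [move/EN/OE|move/OE/EN]; apply: ou.
have [h|/norP[nsh]] := boolP (sh || (#|L| != 1%N)).
  exists (odd #|S|), #|M|, #|L|, k; split; last first.
  - left; split; first by rewrite {1}nE; lia.
    have [hs|nsh] := boolP sh; [by left|right].
    by rewrite hM //; move: h; rewrite (negPf nsh).
  - exact: Qcls.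
  exists S, M, p, q; split=> //; first by right.
  by apply: (Pcls M L) => //; [apply/orP|move=> i; rewrite inE].
(* In type D a single point of [L] carries no root and passes to the other side: it joins [M],
   unless [M] is empty, which is the case n = 2k + 1. *)
rewrite negbK => /eqP L1.
have single tau N N1 Npq := rts_single (L := N) tau _ f_on PhiE upq nsh N1 Npq.
have Q0 : pair_class (odd #|S| (+) odd k) 0 k Q.
  rewrite -(cards0 'I_n); apply: Qcls => [|u]; first by rewrite cards0.
  exact: single.
have P1 : P = gp (rts Phi (sf S) true (M :|: L) p q).
  apply: (Pcls _ set0) => // [|i|i|u].
  - by right; rewrite cards0.
  - by rewrite inE.
  - rewrite !inE; have [iL|iL] := boolP (i \in L); first by rewrite orbT Lpq.
    by rewrite orbF.
  exact: single.
have cardML : #|M :|: L| = #|M|.+1.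
  rewrite cardsU L1 (_ : M :&: L = set0) ?cards0 ?subn0 ?addn1 //.
  by apply/setP => i; rewrite !inE; case: (i \in L); rewrite ?andbF.
have [M0|M0] := eqVneq #|M| 0%N.
  exists (odd #|S|), 0%N, 0%N, k; split=> //; last first.
    by right; split=> //; rewrite {1}nE M0 L1; lia.
  exists S, set0, p, q; split=> //; first by right.
  rewrite P1; apply: eq_gp => u; apply: single => //.
  by rewrite cardML M0.
exists (odd #|S|), #|M :|: L|, 0%N, k; split=> //.
  by exists S, (M :|: L), p, q; split=> //; right.
left; split; first by rewrite {1}nE cardML; lia.
by right; rewrite cardML; split=> //; case: #|M| M0.
Qed.

Lemma exists_concept par m l k : (0 < n)%N -> n = (m + l + k.*2)%N ->
  [\/ sh, m != 1%N /\ l != 1%N | m = 0%N /\ l = 1%N] ->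
  exists P Q : {group gT}, [/\ concept rG P Q, pair_class par m k P & pair_class (par (+) odd k) l k Q].
Proof.
move=> npos nE H; have [|M [p [q cf]]] := @exists_configuration m k; first by lia.
have [upq Mpq] := configuration_pts cf.
have rl : #|rest M p q| = l by have := card_rest cf; lia.
have [S Sp] : exists S, sh \/ odd #|S| = par.
  case: par; last by exists set0; rewrite cards0; right.
  by exists [set Ordinal npos]; rewrite cards1; right.
exists (gp (rts Phi (sf S) true M p q)), (gp (rts Phi (sf S) false (rest M p q) p q)).
split; first by apply: (concept_configuration _ cf); rewrite rl.
  by exists S, M, p, q.
exists [set i | (i \in S) (+) (i \in codom q)], (rest M p q), p, q; split.
- by rewrite -{1}rl; apply: configuration_intro (@rest_pts _ M p q).
- case: Sp => [|Sp]; [by left|right].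
  have -> : [set i | (i \in S) (+) (i \in codom q)] =
      [set i | (i \in S) (+) (i \in [set j in codom q])].
    by apply/setP => i; rewrite !inE.
  have /card_uniqP ucq : uniq (codom q) by move: upq; rewrite cat_uniq => /and3P[].
  by rewrite card_symdiff oddD (cardsE (mem (codom q))) ucq size_codom card_ord Sp.
by apply: eq_gp => v; rewrite rts_flip.
Qed.

Lemma pair_class_one par k P : ~~ sh -> pair_class par 1 k P -> pair_class par 0 k P.
Proof.
move=> nsh [S [M [p [q [cf Sp ->]]]]]; have [upq Mpq] := configuration_pts cf.
exists S, set0, p, q; split=> //.
  by rewrite -(cards0 'I_n); apply: configuration_intro => // i; rewrite inE.
apply: eq_gp => v; apply: rts_single => //; first exact: signed_on.
  exact: signed_PhiE.
by case: cf.
Qed.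

Lemma pair_class_parabolic_class par m k P : pair_class par m k P -> parabolic rG P ->
  is_parabolic_class rG (pair_class par m k).
Proof.
move=> cP pP; exists P => // Q; split=> [cQ|[w wW E]]; first exact: pair_class_transport cP cQ.
by have := pair_class_conj wW cP; rewrite (_ : (P :^ w)%G = Q) //; apply: val_inj.
Qed.

End SignedConcepts.

(** * Coordinates and simple systems of types B and D *)

Section FrameSystem.
Variables (R : realType) (d n : nat).
Implicit Types (e b : 'I_n -> 'rV[R]_d) (sh : bool).

(* The simple roots [b] of type B_n ([sh]) or D_n in terms of coordinates. *)
Definition frame_simple sh e b :=
  [/\ forall i j : 'I_n, j = i.+1 :> nat -> b i = e i - e j,
      sh -> forall i : 'I_n, i.+1 = n -> b i = e i
    & ~~ sh -> forall i j : 'I_n, j = i.+1 :> nat -> j.+1 = n -> b j = e i + e j].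

(** Equal reflections make the simple roots proportional, and the inner products force the factors
    to be one common sign. In type D the root e_(n-2) - e_(n-1) links the two end roots e_(n-1) -
    e_n and e_(n-1) + e_n, so three points are required. The classes thus do not depend on the
    frame. *)
Lemma frame_unique sh e e' b b' : Defs.orthonormal e -> Defs.orthonormal e' ->
  frame_simple sh e b -> frame_simple sh e' b' -> (1 < n)%N -> sh || (2 < n)%N ->
  (forall i, reflmx (b i) = reflmx (b' i)) ->
  exists x, forall i, e' i = sg R x *: e i.
Proof.
move=> e_on e'_on [H1 H2 H3] [H1' H2' H3'] n1 n2 bb'.
have neq (i j : 'I_n) : j = i.+1 :> nat -> (i == j) = false /\ (j == i) = false.
  by move=> ij; split; apply/eqP => /(congr1 val) /=; lia.
have b0 (i j : 'I_n) : j = i.+1 :> nat -> e i - e j != 0.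
  move=> ij; apply/eqP => /(congr1 (fun v => dot v (e i))).
  rewrite dotBl dot0l !e_on eqxx (neq _ _ ij).2 subr0 => /eqP; by rewrite oner_eq0.
have zE (i j : 'I_n) : j = i.+1 :> nat -> exists z, e' i - e' j = z *: (e i - e j).
  move=> ij; have := bb' i; rewrite (H1 _ _ ij) (H1' _ _ ij) => /(reflmx_inj (b0 _ _ ij)).
  by case=> z _ ->; exists z.
have sgE (z : R) : z * z = 1 -> exists x, z = sg R x.
  move=> zz; have /eqP : (z - 1) * (z + 1) = 0 by rewrite -[RHS](subrr (z * z)) {2}zz; ring.
  rewrite mulf_eq0 subr_eq0 addr_eq0 => /orP[/eqP ->|/eqP ->].
    by exists false.
  by exists true.
have lastP : exists x, forall i : 'I_n, i.+1 = n -> e' i = sg R x *: e i.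
  have n0 : (n.-1 < n)%N by lia.
  pose l : 'I_n := Ordinal n0.
  have lE (i : 'I_n) : i.+1 = n -> i = l by move=> ni; apply: val_inj => /=; lia.
  suff [x E] : exists x, e' l = sg R x *: e l by exists x => i /lE ->.
  have ln : l.+1 = n by rewrite /=; lia.
  have [h|nh] := boolP sh.
    have el0 : e l != 0.
      by rewrite -dot_eq0 e_on eqxx oner_eq0.
    have := bb' l; rewrite H2 // H2' // => /(reflmx_inj el0)[z _ E].
    have [|x zx] := sgE z; last by exists x; rewrite E zx.
    by have := e'_on l l; rewrite E dotZl dotZr e_on eqxx mulr1.
  have {n2} n2 : (2 < n)%N by rewrite (negPf nh) in n2.
  have n3 : (n.-2 < n)%N by lia. have n4 : ((n - 3) < n)%N by lia.
  pose i : 'I_n := Ordinal n3; pose h : 'I_n := Ordinal n4.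
  have il : l = i.+1 :> nat by rewrite /=; lia.
  have hi : i = h.+1 :> nat by rewrite /=; lia.
  have [il1 il2] := neq _ _ il; have [hi1 hi2] := neq _ _ hi.
  have [hl1 hl2] : (h == l) = false /\ (l == h) = false.
    by split; apply/eqP => /(congr1 val) /=; lia.
  have [z1 E1] := zE _ _ il; have [z3 E3] := zE _ _ hi.
  have [z2 E2] : exists z, e' i + e' l = z *: (e i + e l).
    have s0 : e i + e l != 0.
      apply/eqP => /(congr1 (fun v => dot v (e i))).
      rewrite dotDl dot0l !e_on eqxx il2 addr0 => /eqP; by rewrite oner_eq0.
    have := bb' l; rewrite (H3 nh _ _ il ln) (H3' nh _ _ il ln) => /(reflmx_inj s0).
    by case=> z _ ->; exists z.
  have D1 : dot (e' h - e' i) (e' i - e' l) = dot (e h - e i) (e i - e l).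
    by rewrite !dotBl !dotBr !e_on !e'_on.
  have D2 : dot (e' h - e' i) (e' i + e' l) = dot (e h - e i) (e i + e l).
    by rewrite !dotBl !dotDr !e_on !e'_on.
  have D3 : dot (e' i - e' l) (e' i - e' l) = dot (e i - e l) (e i - e l).
    by rewrite !dotBl !dotBr !e_on !e'_on.
  have Z0 : dot (e h - e i) (e i - e l) = -1.
    by rewrite !dotBl !dotBr !e_on !eqxx hi1 hl1 il1 /=; ring.
  have Z1 : dot (e h - e i) (e i + e l) = -1.
    by rewrite !dotBl !dotDr !e_on !eqxx hi1 hl1 il1 /=; ring.
  have Z2 : dot (e i - e l) (e i - e l) = 2.
    by rewrite !dotBl !dotBr !e_on !eqxx il1 il2 /=; ring.
  move: D1 D2 D3; rewrite E1 E2 E3 !dotZl !dotZr Z0 Z1 Z2 => D1 D2 D3.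
  have z12 : z1 = z2.
    have z31 : z3 * z1 = 1 by lra.
    have z32 : z3 * z2 = 1 by lra.
    by rewrite -[z1]mul1r -z32 mulrAC z31 mul1r.
  have [|x zx] := sgE z1; first by lra.
  exists x; have E : e' l *+ 2 = (z1 *: e l) *+ 2.
    have -> : e' l *+ 2 = (e' i + e' l) - (e' i - e' l).
      by apply/rowP => c; rewrite mulr2n !mxE; ring.
    by rewrite E1 E2 -z12; apply/rowP => c; rewrite mulr2n !mxE; ring.
  have := congr1 (fun v => 2^-1 *: v) E.
  rewrite -!scaler_nat [_ *: (2%:R *: e' l)]scalerA [_ *: (2%:R *: (_ *: e l))]scalerA.
  by rewrite mulVf ?pnatr_eq0 // !scale1r zx.
have [x xl] := lastP; exists x.
suff H : forall k, (k <= n.-1)%N -> forall i : 'I_n, i = k :> nat -> e' i = sg R x *: e i.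
  by move=> i; apply: (H i) => //; have := ltn_ord i; lia.
apply: down_ind => [i ik|k kn IH i ik]; first by apply: xl; lia.
have jn : (i.+1 < n)%N by lia.
pose j : 'I_n := Ordinal jn; have Ej := IH j (congr1 S ik).
have ij : j = i.+1 :> nat by [].
have [z zij] := zE i j ij; have [ne1 ne2] := neq _ _ ij.
have : dot (e' i - e' j) (e' j) = -1 by rewrite dotBl !e'_on eqxx ne1 sub0r.
rewrite zij Ej dotZl dotZr dotBl !e_on eqxx ne1 sub0r mulrN1 mulrN => /oppr_inj zx.
have {}zx : z = sg R x by rewrite -[z]mulr1 -(sg_sqr R x) mulrA zx mul1r.
by rewrite -[e' i](subrK (e' j)) zij Ej zx -scalerDr subrK.
Qed.

Section Cone.
Variables (b : 'I_n -> 'rV[R]_d).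

Definition cone v := exists2 c : 'rV_n, v = c *m \matrix_i b i & forall i, 0 <= c 0 i.

Lemma cone0 : cone 0.
Proof. by exists 0; rewrite ?mul0mx // => i; rewrite mxE. Qed.

Lemma coneD u v : cone u -> cone v -> cone (u + v).
Proof.
move=> [x -> x0] [y -> y0]; exists (x + y); rewrite ?mulmxDl // => i.
by rewrite mxE addr_ge0.
Qed.

Lemma cone_simple i : cone (b i).
Proof.
exists (delta_mx 0 i) => [|j]; first by rewrite -rowE rowK.
by rewrite mxE; apply: ler0n.
Qed.

Variables (sh : bool) (e : 'I_n -> 'rV[R]_d).
Hypotheses (e_on : Defs.orthonormal e) (fs : frame_simple sh e b) (n1 : (1 < n)%N).

Lemma cone_minus (i j : 'I_n) : (i <= j)%N -> cone (e i - e j).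
Proof.
move=> ij; have [m mE] : exists m, (j = i + m :> nat)%N by exists (j - i)%N; lia.
elim: m i mE {ij} => [|m IH] i mE.
  by rewrite (_ : i = j) ?subrr; [apply: cone0|apply: val_inj; rewrite /=; lia].
have i1 : (i.+1 < n)%N by have := ltn_ord j; lia.
rewrite -(subrKA (e (Ordinal i1))); apply: coneD; last by apply: IH => /=; lia.
by have [H _ _] := fs; rewrite -H //; apply: cone_simple.
Qed.

Lemma cone_sign v : frame_root sh e v -> cone v \/ cone (- v).
Proof.
have [H1 H2 H3] := fs; have n0 : (n.-1 < n)%N by lia.
have n2 : (n.-2 < n)%N by lia.
pose l : 'I_n := Ordinal n0; pose h : 'I_n := Ordinal n2.
have ln : l.+1 = n by rewrite /=; lia.
have le i : sh -> cone (e i).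
  move=> s; rewrite -[e i](subrK (e l)); apply: coneD.
    by apply: cone_minus; rewrite /=; have := ltn_ord i; lia.
  by rewrite -H2 //; apply: cone_simple.
have plus (i j : 'I_n) : (i < j)%N -> cone (e i + e j).
  move=> ij; have [s|s] := boolP sh; first by apply: coneD; apply: le.
  (* [h] and [l] are the last two points, and i < j ensures that [i] does not come after [h]. *)
  have -> : e i + e j = (e i - e h) + (e j - e l) + (e h + e l).
    by apply/rowP => c; rewrite !mxE; ring.
  apply: coneD; last by rewrite -H3 //=; [apply: cone_simple|lia].
  by apply: coneD; apply: cone_minus; rewrite /=; have := ltn_ord j; lia.
move=> [[i [j [x [y [ij ->]]]]]|[s [i [x ->]]]]; last first.
  by have := le i s; case: x; rewrite /sv /sg ?scaleN1r ?scale1r ?opprK; auto.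
wlog lij : i j x y ij / (i < j)%N => [H|].
  have := ij; rewrite -(inj_eq val_inj) neq_ltn => /orP[|ji]; first exact: H.
  by rewrite addrC; apply: H; rewrite // eq_sym.
have [P Mi] := (plus i j lij, cone_minus (ltnW lij)).
by case: x; case: y; rewrite /sv /sg ?scaleN1r ?scale1r ?opprD ?opprK ?[- e i + e j]addrC; auto.
Qed.

End Cone.

End FrameSystem.

Section FrameRootSystem.
Variables (R : realType) (gT : finGroupType) (W : {group gT}) (d : nat).
Variable rG : mx_representation R W d.
Variables (n : nat) (s : 'I_n -> gT) (b e : 'I_n -> 'rV[R]_d) (sh : bool).
Hypothesis e_on : Defs.orthonormal e.
Hypothesis fs : frame_simple sh e b.
Hypothesis n1 : (1 < n)%N.

Lemma frame_root_refl r v : frame_root sh e r -> frame_root sh e v ->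
  frame_root sh e (v *m reflmx r).
Proof.
move=> /(reflmx_signed e_on)[sigma [eps [H _]]].
have E x i : sv e x i *m reflmx r = sv e (x (+) eps i) (sigma i).
  by rewrite /sv -scalemxAl H /sv scalerA sgM.
move=> [[i [j [x [y [ij ->]]]]]|[h [i [x ->]]]].
  left; exists (sigma i), (sigma j), (x (+) eps i), (y (+) eps j).
  by rewrite mulmxDl !E (inj_eq perm_inj).
by right; split=> //; exists (sigma i), (x (+) eps i); rewrite E.
Qed.

Lemma frame_simple_root i : frame_root sh e (b i) /\ dot (b i) (e i) = 1.
Proof.
have [H1 H2 H3] := fs; have neq (k j : 'I_n) : j = k.+1 :> nat -> k != j.
  by move=> kj; apply/eqP => /(congr1 val) /=; lia.
have [i1|i1] := ltnP i.+1 n.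
  pose j : 'I_n := Ordinal i1; rewrite (H1 i j) //; split; first exact/root_minus/neq.
  by rewrite dotBl !e_on eqxx eq_sym (negPf (neq i j _)) // subr0.
have ni : i.+1 = n by have := ltn_ord i; lia.
have [h|h] := boolP sh.
  by rewrite H2 //; split; [apply: root_e|rewrite e_on eqxx].
have i0 : (i.-1 < n)%N by lia.
have ji : i = (Ordinal i0).+1 :> nat by rewrite /=; lia.
rewrite (H3 h _ _ ji) //; split; first exact/root_plus/neq.
by rewrite dotDl !e_on eqxx (negPf (neq _ _ ji)) add0r.
Qed.

Lemma signed_root_system : mx_faithful rG -> W :=: <<[set s i | i : 'I_n]>>%g ->
  (forall i, s i \in W /\ rG (s i) = reflmx (b i)) -> row_free (\matrix_i b i) ->
  root_system rG s b (frame_root sh e).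
Proof.
move=> faith gen sP fb; split=> //.
- by move=> i; case: (sP i).
- by move=> i; case: (sP i).
- by move=> i; case: (frame_simple_root i).
- exact: root_neq0.
- by move=> v i; apply: frame_root_refl; case: (frame_simple_root i).
- move=> v /(cone_sign fs n1)[[c -> c0]|[c E c0]]; first by exists c; auto.
  exists (- c); first by rewrite mulNmx -E opprK.
  by right=> i; rewrite mxE oppr_le0.
move=> i x Px; have xE : dot (x *: b i) (e i) = x.
  by rewrite dotZl (frame_simple_root i).2 mulr1.
have x0 : x != 0 by apply: contraNneq (root_neq0 e_on Px) => ->; rewrite scale0r.
have sgx (y : bool) (z : bool) : x = sg R y * z%:R -> x = 1 \/ x = -1.
  case: z => [|E]; last by rewrite E mulr0 eqxx in x0.
  by case: y => ->; rewrite /sg mulr1; auto.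
case: Px => [[k [l [y [z [kl E]]]]]|[_ [k [y E]]]]; move: xE; rewrite E.
  rewrite dot_sv2 //; case: (eqVneq k i) => [<-|_].
    by rewrite [l == k]eq_sym (negPf kl) mulr0 addr0 => /esym/(sgx y true).
  by rewrite mulr0 add0r => /esym/sgx.
by rewrite dot_sv // => /esym/sgx.
Qed.

End FrameRootSystem.

Section FrameClasses.
Variables (R : realType) (gT : finGroupType) (W : {group gT}) (d : nat).
Variable rG : mx_representation R W d.
Variables (n : nat) (s : 'I_n -> gT) (b e : 'I_n -> 'rV[R]_d) (sh : bool).
Hypothesis e_on : Defs.orthonormal e.
Let Phi := frame_root sh e.
Hypothesis RS : root_system rG s b Phi.
Hypothesis fs : frame_simple sh e b.
Hypothesis n1 : (1 < n)%N.
Hypothesis n2 : sh || (2 < n)%N.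
Implicit Types (S T M L : {set 'I_n}) (u v : 'rV[R]_d) (P Q : {group gT}).

Local Notation sf S := (signed_frame S e).
Local Notation gp := (gp rG).
Local Notation pair_class := (pair_class rG e sh).

Lemma frame_rigid (e' : 'I_n -> 'rV[R]_d) : Defs.orthonormal e' -> frame_chain rG s e' ->
  (sh -> forall i : 'I_n, i.+1 = n -> rG (s i) = reflmx (e' i)) ->
  (~~ sh -> forall i j : 'I_n, j = i.+1 :> nat -> j.+1 = n -> rG (s j) = reflmx (e' i + e' j)) ->
  exists x, e' = fun i => sg R x *: e i.
Proof.
move=> e'_on H1 H2 H3; suff [b' fs' bb'] : exists2 b', frame_simple sh e' b' &
    forall i, reflmx (b i) = reflmx (b' i).
  have [x E] := frame_unique e_on e'_on fs fs' n1 n2 bb'.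
  by exists x; apply/funext.
pose nx k (i : 'I_n) : 'I_n := odflt i (insub k).
have nxE (i j : 'I_n) k : j = k :> nat -> nx k i = j by rewrite /nx => <-; rewrite valK.
exists (fun i : 'I_n => if (i.+1 < n)%N then e' i - e' (nx i.+1 i) else
                 if sh then e' i else e' (nx i.-1 i) + e' i).
  split=> [i j ij|h i ni|h i j ij nj].
  - by rewrite -ij ltn_ord (nxE i j).
  - by rewrite -{2}ni ltnn h.
  by rewrite -{2}nj ltnn (negPf h) (nxE j i) // ij.
move=> i; rewrite -(rs_refl RS); case: ltnP => [i1|i1].
  by apply: H1; rewrite (nxE i (Ordinal i1)).
have ni : i.+1 = n by have := ltn_ord i; lia.
have [h|h] := boolP sh; first exact: H2.
have i0 : (i.-1 < n)%N by lia.
by rewrite (nxE i (Ordinal i0)) //; apply: H3 => //=; lia.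
Qed.

Lemma frameB_rigid e' : sh -> frameB rG s e' -> exists x, e' = fun i => sg R x *: e i.
Proof. by move=> h [e'_on H1 H2]; apply: frame_rigid => // /negP. Qed.

Lemma frameD_rigid e' : ~~ sh -> frameD rG s e' -> exists x, e' = fun i => sg R x *: e i.
Proof. by move=> h [e'_on H1 H2]; apply: frame_rigid => // /(negP h). Qed.

Lemma frameB_frame : sh -> frameB rG s e.
Proof.
have [H1 H2 _] := fs => h; split=> // [i j ij|i ni]; rewrite (rs_refl RS).
  by rewrite (H1 i j).
by rewrite H2.
Qed.

Lemma frameD_frame : ~~ sh -> frameD rG s e.
Proof.
have [H1 _ H2] := fs => h; split=> // [i j ij|i j ij nj]; rewrite (rs_refl RS).
  by rewrite (H1 i j).
by rewrite (H2 h i j).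
Qed.

Lemma rts_scale f x tau M k (p q : 'I_k -> 'I_n) v :
  rts Phi (fun i => sg R x *: f i) tau M p q v <-> rts Phi f tau M p q v.
Proof.
have inj (y z : R) : sg R x * y = sg R x * z -> y = z.
  by move=> /(congr1 (fun t => sg R x * t)); rewrite !mulrA sg_sqr !mul1r.
split=> -[Pv v0 vpq]; split=> // [i iM ip iq|c].
- by apply: inj; rewrite -dotZr v0 // mulr0.
- by have := vpq c; rewrite !dotZr mulrCA => /inj.
- by rewrite dotZr v0 // mulr0.
by rewrite !dotZr mulrCA vpq.
Qed.

Lemma gen_refls_in A Psi : (forall v, A v -> Psi v) ->
  (forall v t, Psi v -> t \in W -> rG t = reflmx v -> t \in <<refls_in rG A>>%g) ->
  <<refls_in rG A>>%g = gp Psi.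
Proof.
move=> AP PA; apply/eqP; rewrite eqEsubset gen_subG; apply/andP; split.
  apply/subsetP => t /refls_inP[tW [v Av tv]].
  by apply: mem_gen; apply: mem_refls_in tv => //; apply: AP.
by rewrite gen_subG; apply/subsetP => t /refls_inP[tW [v Pv tv]]; apply: PA tv.
Qed.

Section Generators.
Variables (f : 'I_n -> 'rV[R]_d) (m k : nat) (M : {set 'I_n}) (p q : 'I_k -> 'I_n).
Hypothesis f_on : Defs.orthonormal f.
Hypothesis PhiE : Phi = frame_root sh f.
Hypothesis cf : configuration m M p q.
Let upq := (configuration_pts cf).1.
Let Mpq := (configuration_pts cf).2.

Lemma rts_sign_pair i j x y : i \in M -> j \in M -> i != j ->
  rts Phi f true M p q (sv f x i + sv f y j).
Proof.
move=> iM jM ij; rewrite PhiE; apply: (rts_free _ Mpq iM); first exact: root2.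
move=> l lM; rewrite dot_sv2 //.
have -> : (i == l) = false by apply: contraNF lM => /eqP <-.
have -> : (j == l) = false by apply: contraNF lM => /eqP <-.
by rewrite !mulr0 addr0.
Qed.

Lemma rts_pair_minus c : rts Phi f true M p q (f (p c) - f (q c)).
Proof.
by have := rts_pair sh f_on upq true M c; rewrite -PhiE {1}/sg scaleN1r.
Qed.

Lemma sv_pair_norm x y i j : exists z, sv f x i + sv f y j =
  sg R z *: (if x (+) y then f i - f j else f i + f j).
Proof.
by exists x; case: x; case: y; rewrite /sv /sg /= ?scaleN1r ?scale1r ?opprD ?opprK.
Qed.

Lemma gen_rootsD : ~~ sh -> <<refls_in rG (rootsD f M p q)>>%g = gp (rts Phi f true M p q).
Proof.
move=> nsh; apply: gen_refls_in => [v [i j iM jM ij|i j iM jM ij|c]|v t].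
- by have := rts_sign_pair false false iM jM ij; rewrite /sv /sg !scale1r.
- by have := rts_sign_pair false true iM jM ij; rewrite /sv /sg scale1r scaleN1r.
- exact: rts_pair_minus.
rewrite PhiE => /(rts_cases f_on upq)[[h]|[i [j [x [y [iM jM ij ->]]]]]|[c [x ->]]] tW.
- by rewrite h in nsh.
- have [z ->] := sv_pair_norm x y i j; rewrite reflmxZ ?sg_neq0 // => tE.
  apply: mem_gen; apply: mem_refls_in tE => //.
  by case: (x (+) y); [apply: rootsD_minus|apply: rootsD_plus].
rewrite reflmxZ ?sg_neq0 // /sg scaleN1r => tE.
by apply: mem_gen; apply: mem_refls_in tE => //; apply: rootsD_pair.
Qed.

Lemma gen_rootsB : sh -> <<refls_in rG (rootsB f M p q)>>%g = gp (rts Phi f true M p q).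
Proof.
move=> h; apply: gen_refls_in => [v [i iM|i j iM jM ij|c]|v t].
- rewrite PhiE; apply: (rts_free _ Mpq iM); first exact: root_e.
  by move=> l lM; rewrite f_on; case: eqP lM => // <-; rewrite iM.
- by have := rts_sign_pair false true iM jM ij; rewrite /sv /sg scale1r scaleN1r.
- exact: rts_pair_minus.
rewrite PhiE => /(rts_cases f_on upq)[[_ [i [x [iM ->]]]]|[i [j [x [y [iM jM ij ->]]]]]|[c [x ->]]] tW.
- rewrite /sv reflmxZ ?sg_neq0 // => tE.
  by apply: mem_gen; apply: mem_refls_in tE => //; apply: rootsB_sign.
- have [z ->] := sv_pair_norm x y i j; rewrite reflmxZ ?sg_neq0 // => tE.
  case: (x (+) y) tE => tE.
    by apply: mem_gen; apply: mem_refls_in tE => //; apply: rootsB_perm.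
  (* [rootsB] lists no e_i + e_j: its reflection is that of e_i - e_j conjugated by the sign change
     at [j]. *)
  have PhiM : Phi (f i - f j) by rewrite PhiE; apply: root_minus.
  have PhiJ : Phi (f j) by rewrite PhiE; apply: root_e.
  have [t1 t1W t1E] := Phi_refl RS PhiM; have [t2 t2W t2E] := Phi_refl RS PhiJ.
  have -> : t = (t1 ^ t2)%g.
    apply: (rs_inj RS); rewrite ?groupJ // (rs_conj RS t1W t2W t1E) tE t2E.
    rewrite mulmxBl !reflmx_root1 // !eqxx (negPf ij) /sv /sg scale1r scaleN1r opprK //.
  apply: groupJ; apply: mem_gen; first by apply: mem_refls_in t1E => //; apply: rootsB_perm.
  by apply: mem_refls_in t2E => //; apply: rootsB_sign.
rewrite reflmxZ ?sg_neq0 // /sg scaleN1r => tE.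
by apply: mem_gen; apply: mem_refls_in tE => //; apply: rootsB_pair.
Qed.

End Generators.

Lemma pair_classP S m k P : (exists M (p q : 'I_k -> 'I_n), configuration m M p q /\
    exists2 w, w \in W & P :=: gp (rts Phi (sf S) true M p q) :^ w) <->
  pair_class (odd #|S|) m k P.
Proof.
split=> [[M [p [q [cf [w wW PE]]]]]|cP].
  have -> : P = (gp (rts Phi (sf S) true M p q) :^ w)%G by apply: val_inj.
  by apply: (pair_class_conj e_on RS wW); exists S, M, p, q; split=> //; right.
have [S' [M [p [q [cf Sp PE]]]]] := cP.
exists M, p, q; split=> //.
have cS : pair_class (odd #|S|) m k (gp (rts Phi (sf S) true M p q)).
  by exists S, M, p, q; split=> //; right.
exact: (pair_class_transport e_on RS cS cP).
Qed.

Lemma sign_scale_frame (f : 'I_n -> 'rV[R]_d) x :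
  Defs.orthonormal f -> Phi = frame_root sh f ->
  Defs.orthonormal (fun i => sg R x *: f i) /\
  Phi = frame_root sh (fun i => sg R x *: f i).
Proof.
move=> f_on PhiE; have E : (fun i => sg R x *: f i) =
    signed_frame (if x then setT else set0) f.
  by apply/funext => i; rewrite /signed_frame /sv; case: x; rewrite inE.
by rewrite E frame_root_signed; split=> //; apply: orthonormal_signed.
Qed.

End FrameClasses.

(** * Labels in types B and D *)

Section FrameTypes.
Variables (R : realType) (gT : finGroupType) (W : {group gT}) (d : nat).
Variable rG : mx_representation R W d.
Variables (n : nat) (s : 'I_n -> gT) (b e : 'I_n -> 'rV[R]_d) (sh : bool).
Hypothesis e_on : Defs.orthonormal e.
Let Phi := frame_root sh e.
Hypothesis RS : root_system rG s b Phi.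
Hypothesis fs : frame_simple sh e b.
Hypothesis n1 : (1 < n)%N.
Hypothesis n2 : sh || (2 < n)%N.
Implicit Types (S T M L : {set 'I_n}) (u v : 'rV[R]_d) (P Q : {group gT}).

Local Notation sf S := (signed_frame S e).
Local Notation gp := (gp rG).
Local Notation pair_class := (pair_class rG e sh).

Let frame0 : sf set0 = e.
Proof. by apply/funext => i; rewrite /signed_frame /sv inE scale1r. Qed.

Let e_scaled x : Defs.orthonormal (fun i => sg R x *: e i) /\ Phi = frame_root sh (fun i => sg R x *: e i).
Proof. exact: (sign_scale_frame x e_on (erefl Phi)). Qed.

Lemma classB_cls m k P : sh -> classB rG s m k P <-> pair_class false m k P.
Proof.
move=> h; rewrite -[false]/(odd 0) -(cards0 'I_n) -(pair_classP e_on RS) frame0.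
split=> [[e' [M [p [q [fB cf [w wW PE]]]]]]|[M [p [q [cf [w wW PE]]]]]].
  have [x xE] := frameB_rigid e_on RS fs n1 n2 h fB; have [x_on xPhi] := e_scaled x.
  exists M, p, q; split=> //; exists w => //.
  rewrite PE xE (gen_rootsB RS x_on xPhi cf h).
  by congr (gval _ :^ w); apply: eq_gp => v; apply: rts_scale.
exists e, M, p, q; split=> //; first exact: frameB_frame RS _ _.
by exists w => //; rewrite PE (gen_rootsB RS e_on (erefl Phi) cf h).
Qed.

Lemma classD_cls m k P : ~~ sh -> classD rG s m k P <-> pair_class false m k P.
Proof.
move=> h; rewrite -[false]/(odd 0) -(cards0 'I_n) -(pair_classP e_on RS) frame0.
split=> [[e' [M [p [q [fB cf [w wW PE]]]]]]|[M [p [q [cf [w wW PE]]]]]].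
  have [x xE] := frameD_rigid e_on RS fs n1 n2 h fB; have [x_on xPhi] := e_scaled x.
  exists M, p, q; split=> //; exists w => //.
  rewrite PE xE (gen_rootsD rG x_on xPhi cf h).
  by congr (gval _ :^ w); apply: eq_gp => v; apply: rts_scale.
exists e, M, p, q; split=> //; first exact: frameD_frame RS _ _.
by exists w => //; rewrite PE (gen_rootsD rG e_on (erefl Phi) cf h).
Qed.

Lemma configuration0 k M (p q : 'I_k -> 'I_n) : configuration 0 M p q -> M = set0.
Proof. by move=> [cM _]; apply: cards0_eq. Qed.

Lemma classDplus_cls k P : ~~ sh -> classDplus rG s k P <-> pair_class false 0 k P.
Proof.
move=> h; rewrite -(classD_cls 0 k P h); split=> [[e' [p [q [fD cf H]]]]|].
  by exists e', set0, p, q.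
move=> [e' [M [p [q [fD cf H]]]]]; have M0 := configuration0 cf.
by exists e', p, q; move: cf H; rewrite M0.
Qed.

Lemma sign_changeE j (f : 'I_n -> 'rV[R]_d) : sign_change j f = signed_frame [set j] f.
Proof.
apply/funext => i; rewrite /sign_change /signed_frame /sv inE /sg.
by case: eqP; rewrite ?scaleN1r ?scale1r.
Qed.

Lemma classDminus_cls k P : ~~ sh -> classDminus rG s k P <-> pair_class true 0 k P.
Proof.
move=> h; have n0 : (0 < n)%N by lia.
have on j : Defs.orthonormal (sf [set j]) by apply: orthonormal_signed.
have phi j : Phi = frame_root sh (sf [set j]) by rewrite frame_root_signed.
split=> [[e' [j [p [q [fD cf [w wW PE]]]]]]|].
  have [x xE] := frameD_rigid e_on RS fs n1 n2 h fD.
  rewrite -[true]/(odd 1) -(cards1 j) -(pair_classP e_on RS).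
  exists set0, p, q; split=> //; exists w => //; rewrite PE xE.
  have -> : sign_change j (fun i => sg R x *: e i) = fun i => sg R x *: sf [set j] i.
    apply/funext => i; rewrite sign_changeE /signed_frame /sv !scalerA mulrC //.
  have [x_on xPhi] := sign_scale_frame x (on j) (phi j).
  rewrite (gen_rootsD rG x_on xPhi cf h).
  by congr (gval _ :^ w); apply: eq_gp => v; apply: rts_scale.
pose j := Ordinal n0; rewrite -[true]/(odd 1) -(cards1 j) -(pair_classP e_on RS).
move=> [M [p [q [cf [w wW PE]]]]]; have M0 := configuration0 cf; subst M.
exists e, j, p, q; split=> //; first exact: frameD_frame RS _ _.
by exists w => //; rewrite PE sign_changeE (gen_rootsD rG (on j) (phi j) cf h).
Qed.

(** The parity distinguishes classes only when the pairs use up all points; otherwise both parities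
    give the same class and share one label. *)
Definition labD (par : bool) m k :=
  if (k.*2 < n)%N then DA m k else if par then DMinus k else DPlus k.

Definition lab par m k := if sh then BA m k else labD par m k.

Lemma denote_lab par m k P : (m + k.*2 <= n)%N ->
  denote rG s (lab par m k) P <-> pair_class par m k P.
Proof.
move=> mk; have [h|h] : sh \/ ~~ sh by case: (sh); auto.
  have -> : lab par m k = BA m k by rewrite /lab h.
  by apply: (iff_trans (classB_cls m k P h)); split; apply: pair_class_parity; left.
have -> : lab par m k = labD par m k by rewrite /lab (negPf h).
rewrite /labD; case: ltnP => kn.
  by apply: (iff_trans (classD_cls m k P h)); split; apply: pair_class_parity; right.
have -> : m = 0%N by lia.
by case: par; [apply: classDminus_cls|apply: classDplus_cls].
Qed.

(** The second alternative is type D with one point outside the pairs, on either side of which a D_1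
    would stand. *)
Definition lab_ok m l k :=
  (n = (m + l + k.*2)%N /\ (sh \/ m != 1%N /\ l != 1%N)) \/
  [/\ ~~ sh, n = k.*2.+1, m = 0%N & l = 0%N].

Lemma lab_okP m l k : lab_ok m l k ->
  [/\ (m + k.*2 <= n)%N, (l + k.*2 <= n)%N, sh \/ m != 1%N & sh \/ l != 1%N].
Proof.
by case=> [[nE H]|[_ nE -> ->]]; split; (try lia); case: H => [h|[? ?]]; auto; right.
Qed.

Lemma lab_inj par par' m m' k k' P : (m + k.*2 <= n)%N -> (m' + k'.*2 <= n)%N ->
  sh \/ m != 1%N -> sh \/ m' != 1%N ->
  denote rG s (lab par m k) P -> denote rG s (lab par' m' k') P ->
  lab par m k = lab par' m' k'.
Proof.
move=> mk mk' hm hm' /(denote_lab _ _ mk) cP /(denote_lab _ _ mk') cP'.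
have [mm kk] := pair_class_inj e_on RS hm hm' cP cP'; subst m' k'.
rewrite /lab; have [h|h] := boolP sh => //; rewrite /labD; case: ltnP => // kn.
have nk : n = k.*2 by lia.
have m0 : m = 0%N by lia.
by rewrite m0 in cP cP'; rewrite (pair_class_parity_inj e_on RS h nk cP cP').
Qed.

Lemma exists_lab_concept par m l k : lab_ok m l k -> exists P Q : {group gT},
  [/\ concept rG P Q, denote rG s (lab par m k) P &
      denote rG s (lab (par (+) odd k) l k) Q].
Proof.
move=> ok; have [mk lk hm hl] := lab_okP ok; have n0 : (0 < n)%N by lia.
case: ok => [[nE H]|[nsh nE m0 l0]].
  have [|P [Q [PQ cP cQ]]] := exists_concept e_on RS par n0 nE.
    by case: H => [h|[? ?]]; [apply: Or31|apply: Or32].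
  by exists P, Q; split=> //; apply/denote_lab.
subst m l; have nE1 : n = (0 + 1 + k.*2)%N by lia.
have [|P [Q [PQ cP cQ]]] := exists_concept e_on RS par n0 nE1.
  exact: Or33.
by exists P, Q; split=> //; apply/denote_lab => //; apply: pair_class_one cQ.
Qed.

Lemma classified_by_lab (L : label * label -> Prop) :
  (forall c, L c -> exists par m l k,
     lab_ok m l k /\ c = (lab par m k, lab (par (+) odd k) l k)) ->
  (forall par m l k, lab_ok m l k -> L (lab par m k, lab (par (+) odd k) l k) \/
     L (lab (par (+) odd k) l k, lab par m k)) ->
  classified_by rG s L.
Proof.
move=> Lok okL; apply: (classified_by_intro RS) => [c Lc|c Lc|P Q PQ|c c' P Q Lc Lc' PQ].
- have [par [m [l [k [ok ->]]]]] := Lok _ Lc; have [mk lk hm hl] := lab_okP ok.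
  have [P [Q [[pP pQ _ _] dP dQ]]] := exists_lab_concept par ok.
  have cl (pr : bool) m' Q' : (m' + k.*2 <= n)%N -> denote rG s (lab pr m' k) Q' ->
      parabolic rG Q' -> is_parabolic_class rG (denote rG s (lab pr m' k)).
    move=> mk' /(denote_lab _ _ mk') cQ' pQ'.
    have [P0 pP0 H] := pair_class_parabolic_class e_on RS cQ' pQ'.
    by exists P0 => // X; rewrite denote_lab.
  by split; [apply: cl dP pP|apply: cl dQ pQ].
- have [par [m [l [k [ok ->]]]]] := Lok _ Lc; exact: exists_lab_concept.
- have [par [m [l [k [cP cQ ok]]]]] := concept_normal_form e_on RS PQ.
  have [mk lk hm hl] := lab_okP ok.
  have [dP dQ] : denote rG s (lab par m k) P /\ denote rG s (lab (par (+) odd k) l k) Q.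
    by split; apply/denote_lab.
  by case: (okL par m l k ok) => Lc; [exists (lab par m k, lab (par (+) odd k) l k)
    |exists (lab (par (+) odd k) l k, lab par m k)] => //; split=> //; [left|right].
have [par [m [l [k [ok ->]]]]] := Lok _ Lc; have [mk lk hm hl] := lab_okP ok.
have [par' [m' [l' [k' [ok' ->]]]]] := Lok _ Lc'; have [mk' lk' hm' hl'] := lab_okP ok'.
move=> /= dP dQ; split=> dP' dQ'; congr (_, _).
- exact: lab_inj dP' dP.
- exact: lab_inj dQ' dQ.
- exact: lab_inj dP' dQ.
exact: lab_inj dQ' dP.
Qed.

Lemma typeB_classified : sh -> classified_by rG s (concept_list (TB n)).
Proof.
move=> h; apply: classified_by_lab => [c [m [l [k [nE ->]]]]|par m l k ok].
  by exists false, m, l, k; rewrite /lab h; split=> //; left; split=> //; left.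
left; rewrite /lab h; exists m, l, k; split=> //.
by case: ok => [[]|[]] //; rewrite h.
Qed.

Lemma typeD_classified : ~~ sh -> classified_by rG s (concept_list (TD n)).
Proof.
move=> h; have E par m k : lab par m k = labD par m k by rewrite /lab (negPf h).
apply: classified_by_lab => [c|par m l k ok].
  have D1 k : n = k.*2 -> (k.*2 < n)%N = false by move=> ->; rewrite ltnn.
  case=> [[m [l [k [nE m1 l1 ml ->]]]]|[k nE ->]|[k [nE ok lc]]|[k [nE ok ->]]].
  - exists false, m, l, k; split; first by left; split=> //; right.
    rewrite !E /labD; suff -> : (k.*2 < n)%N by [].
    by move: ml; rewrite xpair_eqE; lia.
  - exists false, 0%N, 0%N, k; split; first by right.
    by rewrite !E /labD nE ltnSn.
  - have ok0 : lab_ok 0 0 k by left; split; [lia|right].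
    by case: lc => [|[]//] ->; [exists false, 0%N, 0%N, k|exists true, 0%N, 0%N, k];
      rewrite !E /labD (D1 k nE) (negPf ok).
  exists false, 0%N, 0%N, k; rewrite !E /labD (D1 k nE) ok; split=> //.
  by left; split; [lia|right].
rewrite !E /labD; case: ltnP => kn.
  case: ok => [[nE [H|[m1 l1]]]|[_ nE -> ->]]; first by rewrite H in h.
    left; apply: Or41; exists m, l, k; split=> //.
    by apply/eqP => -[m0 l0]; lia.
  by left; apply: Or42; exists k.
have nk : n = k.*2 by case: (lab_okP ok); lia.
case: (boolP (odd k)) => odk.
  case: par; [right|left]; rewrite /=; apply: Or44; exists k; split=> //.
left; rewrite addbF; apply: Or43; exists k; split=> //.
by case: par; [right; left|left].
Qed.

End FrameTypes.

Section FrameFromType.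
Variables (R : realType) (gT : finGroupType) (W : {group gT}) (d : nat).
Variable rG : mx_representation R W d.
Hypothesis W_faithful : mx_faithful rG.
Local Notation r2 := (Num.sqrt 2 : R).

(** [u] stands for the last coordinate vector: the last simple root in type B, and half of the
    difference of the last two in type D. *)
Lemma exists_frame n (sh : bool) (b : 'I_n -> 'rV[R]_d) u : (0 < n)%N ->
  (forall i j : 'I_n, (i < n.-1)%N -> (j < n.-1)%N -> dot (b i) (b j) =
     (i == j)%:R *+ 2 - (j == i.+1 :> nat)%:R - (i == j.+1 :> nat)%:R) ->
  dot u u = 1 -> (forall k : 'I_n, (k < n.-1)%N -> dot u (b k) = - (k.+1 == n.-1)%:R) ->
  (sh -> forall i : 'I_n, i.+1 = n -> b i = u) ->
  (~~ sh -> forall i j : 'I_n, j = i.+1 :> nat -> j.+1 = n -> b j = b i + u *+ 2) ->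
  exists2 e, Defs.orthonormal e & frame_simple sh e b.
Proof.
move=> n0 gram uu ub bB bD.
pose A k := if insub k is Some i then b i else 0.
have AE (i : 'I_n) : A i = b i by rewrite /A valK.
have cA : cartan_chain n.-1 A.
  move=> i j iN jN; have ni : (i < n)%N by lia. have nj : (j < n)%N by lia.
  by rewrite (AE (Ordinal ni)) (AE (Ordinal nj)) gram.
have uA k : (k < n.-1)%N -> dot u (A k) = - (k.+1 == n.-1)%:R.
  move=> kN; have nk : (k < n)%N by lia.
  by rewrite (AE (Ordinal nk)) ub.
pose e (i : 'I_n) := tails n.-1 A u i.
have eS (i j : 'I_n) : j = i.+1 :> nat -> b i = e i - e j.
  move=> ij; rewrite /e tails_step; last by have := ltn_ord j; lia.
  by rewrite -ij addrK AE.
have el (i : 'I_n) : i.+1 = n -> e i = u.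
  by move=> ni; rewrite /e (_ : i = n.-1 :> nat) ?tails_last //; lia.
exists e => [i j|].
  rewrite /e tails_orthonormal //; last first.
  - by have := ltn_ord j; lia.
  by have := ltn_ord i; lia.
split=> // [h i ni|h i j ij nj]; first by rewrite bB // el.
by rewrite (bD h i j) // (eS i j) // (el j nj) mulr2n addrA subrK.
Qed.

Lemma r2_sqr : r2 * r2 = 2.
Proof. by rewrite -expr2 sqr_sqrtr. Qed.

Lemma r2_neq0 : r2 != 0.
Proof. by rewrite sqrtr_eq0 -ltNge. Qed.

Lemma frame_root_system n (s : 'I_n -> gT) (a b e : 'I_n -> 'rV[R]_d) x sh : (1 < n)%N ->
  row_free (\matrix_i a i) -> (forall i, s i \in W /\ rG (s i) = reflmx (a i)) ->
  W :=: <<[set s i | i : 'I_n]>>%g -> (forall i, x i != 0) ->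
  (forall i, b i = x i *: a i) -> Defs.orthonormal e -> frame_simple sh e b ->
  root_system rG s b (frame_root sh e).
Proof.
move=> n1 fa sP WE x0 bE e_on fs; apply: (signed_root_system e_on fs n1) => //.
  by move=> i; rewrite bE reflmxZ.
by under eq_mx do rewrite bE; apply: row_free_scale.
Qed.

Lemma typeB_classification n (s : 'I_n -> gT) : (1 < n)%N ->
  @simple_system R gT W d rG (cox_diagram (TB n)) s W ->
  classified_by rG s (concept_list (TB n)).
Proof.
move=> n1 [a [fa aa sP WE]]; have n0 : (n.-1 < n)%N by lia.
pose l : 'I_n := Ordinal n0.
have dotE (i j : 'I_n) m : cox_entry (cox_diagram (TB n)) i.+1 j.+1 = m ->
    dot (a i) (a j) = - cos (pi / m%:R) by move=> <-; apply: aa.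
(* The roots e_i - e_(i+1) have squared length 2, while the last one, e_n, keeps length 1. *)
pose x (i : 'I_n) : R := if i.+1 == n then 1 else r2.
pose b i := x i *: a i.
have bE (i : 'I_n) : (i < n.-1)%N -> b i = r2 *: a i.
  by move=> iN; rewrite /b /x ifF //; apply/eqP; lia.
have [e e_on fs] : exists2 e, Defs.orthonormal e & frame_simple true e b.
  apply: (@exists_frame n true b (a l)); first by lia.
  - move=> i j iN jN; rewrite !bE // dotZl dotZr mulrA r2_sqr.
    rewrite (dotE i j _ (entryB n1 (ltn_ord i) (ltn_ord j))) -[i == j]/(i == j :> nat).
    have [ij|ij] := eqVneq (i : nat) j.
      by rewrite divr1 cospi ij !ltn_eqF //=; ring.
    have -> : (maxn i j == n.-1) = false by apply/eqP; lia.
    have [ji|ji] := eqVneq (j : nat) i.+1.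
      rewrite cos_pi3 (_ : (i == j.+1 :> nat) = false); last by apply/eqP; lia.
      by rewrite /=; field.
    have [ij'|ij'] := eqVneq (i : nat) j.+1; last by rewrite cos_pihalf /=; ring.
    by rewrite cos_pi3 /=; field.
  - by rewrite (dotE l l 1%N) ?divr1 ?cospi ?opprK // entryB ?ltn_ord // eqxx.
  - move=> k kN; rewrite bE // dotZr (dotE l k _ (entryB n1 (ltn_ord l) (ltn_ord k))) /=.
    rewrite ifF; last by apply/eqP; lia.
    rewrite (_ : (k == n.-1.+1 :> nat) = false) /=; last by apply/eqP; lia.
    rewrite (_ : (maxn n.-1 k == n.-1) = true); last by apply/eqP; lia.
    rewrite eq_sym; case: eqP => _; last by rewrite cos_pihalf /=; ring.
    by rewrite mulrN cos_pi4.
  - move=> _ i ni; rewrite /b /x ni eqxx scale1r; congr (a _).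
    by apply: val_inj => /=; lia.
  by [].
apply: (typeB_classified e_on _ fs n1) => //.
apply: (frame_root_system n1 fa sP WE _ (fun=> erefl) e_on fs) => i.
by rewrite /x; case: ifP; rewrite ?oner_eq0 ?r2_neq0.
Qed.

Lemma typeD_classification n (s : 'I_n -> gT) : (3 < n)%N ->
  @simple_system R gT W d rG (cox_diagram (TD n)) s W ->
  classified_by rG s (concept_list (TD n)).
Proof.
move=> n3 [a [fa aa sP WE]]; have n0 : (n.-1 < n)%N by lia.
have n2 : (n.-2 < n)%N by lia.
pose l : 'I_n := Ordinal n0; pose h : 'I_n := Ordinal n2.
have dotE (i j : 'I_n) m : cox_entry (cox_diagram (TD n)) i.+1 j.+1 = m ->
    dot (a i) (a j) = - cos (pi / m%:R) by move=> <-; apply: aa.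
have dE (i j : 'I_n) := dotE i j _ (entryD n3 (ltn_ord i) (ltn_ord j)).
have d1 i : dot (a i) (a i) = 1.
  by rewrite dE eqxx divr1 cospi opprK.
pose b i := r2 *: a i; pose u := (r2 / 2) *: (a l - a h).
have ulE : u *+ 2 = b l - b h.
  rewrite -scaler_nat scalerA mulrC divfK ?pnatr_eq0 //; exact: scalerBr.
have [e e_on fs] : exists2 e, Defs.orthonormal e & frame_simple false e b.
  apply: (@exists_frame n false b u); first by lia.
  - move=> i j iN jN; rewrite /b dotZl dotZr mulrA r2_sqr dE -[i == j]/(i == j :> nat).
    have [ij|ij] := eqVneq (i : nat) j.
      by rewrite divr1 cospi ij !ltn_eqF //=; ring.
    have [-> ->] : (maxn i j < n.-1)%N = true /\ (maxn i j == n.-1) = false.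
      by split; [|apply/eqP]; lia.
    rewrite andbT andbF orbF.
    have [ji|ji] := eqVneq (j : nat) i.+1.
      rewrite cos_pi3 (_ : (i == j.+1 :> nat) = false); last by apply/eqP; lia.
      by rewrite /=; field.
    have [ij'|ij'] := eqVneq (i : nat) j.+1; last by rewrite cos_pihalf /=; ring.
    by rewrite cos_pi3 /=; field.
  - have lh : dot (a l) (a h) = 0.
      rewrite dE /= !ifF ?cos_pihalf ?oppr0 //; last by apply/eqP; lia.
      by apply/negbTE; lia.
    rewrite /u dotZl dotZr !dotBl !dotBr !d1 [dot (a h) _]dotC lh.
    by have := r2_sqr; move: r2 => z zz; lra.
  - move=> k kN; rewrite /u /b dotZl dotZr mulrA (_ : r2 / 2 * r2 = 1); last first.
      by rewrite mulrAC r2_sqr divff ?pnatr_eq0.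
    rewrite mul1r dotBl !dE /=.
    have [kh|kh] := eqVneq (k : nat) n.-2.
      rewrite kh ifF; last by apply/eqP; lia.
      rewrite ifF; last by apply/negbTE; lia.
      by rewrite cos_pihalf divr1 cospi (_ : (n.-2.+1 == n.-1) = true); [rewrite /=; ring|apply/eqP; lia].
    rewrite (_ : (k.+1 == n.-1) = false); last by apply/eqP; lia.
    rewrite ifF; last by apply/eqP; lia.
    have [k3|k3] := eqVneq (k : nat) (n - 3)%N.
      rewrite k3 ifT; last by lia.
      by rewrite ifT; [rewrite /=; ring|lia].
    rewrite ifF; last by apply/negbTE; lia.
    by rewrite ifF; [rewrite /=; ring|apply/negbTE; lia].
  - by [].
  move=> _ i j ij nj.
  have -> : j = l by apply: val_inj => /=; lia.
  have -> : i = h by apply: val_inj => /=; lia.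
  by rewrite ulE addrC subrK.
have n1 : (1 < n)%N by lia.
apply: (typeD_classified e_on _ fs n1) => //; last by rewrite /=; lia.
exact: (frame_root_system n1 fa sP WE (fun=> r2_neq0) (fun=> erefl) e_on fs).
Qed.

End FrameFromType.

(** * Types A and I_2(m) *)

Lemma product_diagram1 X : product_diagram [:: X] = cox_diagram X.
Proof.
by rewrite /product_diagram /= /diagram_sum /= addn0 cats0; case: (cox_diagram X).
Qed.

(** * The concept formed by W and the trivial subgroup *)

Section Extremes.
Variables (R : realType) (gT : finGroupType) (W : {group gT}) (d : nat).
Variable rG : mx_representation R W d.
Variables (n : nat) (s : 'I_n -> gT) (a : 'I_n -> 'rV[R]_d).
Variable Phi : 'rV[R]_d -> Prop.
Hypothesis RS : root_system rG s a Phi.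
Implicit Types (P Q : {group gT}).

Local Notation gp := (gp rG).

Lemma has_type1 X (P : {set gT}) : has_type rG [:: X] P <->
  exists t : 'I_(cox_rank X) -> gT, @simple_system R gT W d rG (cox_diagram X) t P.
Proof. by rewrite /has_type product_diagram1. Qed.

Lemma stdpT : stdp s setT = W :> {set gT}.
Proof.
rewrite (rs_gen RS); congr <<_>>%g; apply/setP => x.
by apply/imsetP/imsetP => -[i _ ->]; exists i.
Qed.

Lemma stdp0 : stdp s set0 = 1%g :> {set gT}.
Proof. by rewrite /stdp /= imset0 gen0. Qed.

Lemma gp_Phi : gp Phi = W :> {set gT}.
Proof.
apply/eqP; rewrite eqEsubset gp_sub /= (rs_gen RS) gen_subG.
apply/subsetP => _ /imsetP[i _ ->]; apply: mem_gen.
exact: mem_refls_in (rs_simple RS i) (rs_in RS i) (rs_refl RS i).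
Qed.

Lemma gp_False Psi : (forall v, ~ Psi v) -> gp Psi = 1%g :> {set gT}.
Proof.
move=> H; rewrite /gp /= (_ : refls_in rG Psi = set0) ?gen0 //.
by apply/setP => t; rewrite in_set0; apply/negP => /refls_inP[_ [b /H]].
Qed.

Lemma concept_full P Q : P :=: W -> Q :=: 1%g -> concept rG P Q.
Proof.
move=> PE QE; apply: (gp_concept RS (Psi := Phi) (Psi' := fun=> False)) => //.
- apply: eq_gp => v; split=> // -[Pv /(_ v Pv)/eqP].
  by rewrite dot_eq0 (negPf (rs_neq0 RS Pv)).
- by apply: eq_gp => v; split=> [[]|].
- by rewrite PE gp_Phi.
by rewrite QE gp_False // => v.
Qed.

Lemma concept_triv P Q : concept rG P Q -> P :=: 1%g -> Q :=: W.
Proof.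
move=> [_ _ -> _] ->; have [_ _ _ E] := @concept_full W 1%G erefl erefl.
by rewrite [RHS]E.
Qed.

Lemma parabolic_rank P r (c : 'I_r -> 'rV[R]_d) : parabolic rG P -> generated_by rG c P ->
  (r <= n)%N /\ (r = n -> P :=: W).
Proof.
move=> /(parabolic_std RS)[J [w wW E]] gc.
have gJ := generated_by_conj RS wW (stdp_generated RS J); rewrite -E in gJ.
have JE := generated_by_rank gc gJ; split.
  by rewrite JE -[X in (_ <= X)%N]card_ord; apply: max_card.
move=> rn; have JT : J = setT.
  by apply/eqP; rewrite eqEcard subsetT cardsT card_ord -JE rn leqnn.
by rewrite E JT stdpT conjGid.
Qed.

Lemma has_type_full X P : has_type rG [:: X] W -> cox_rank X = n ->
  denote rG s (Typ [:: X]) P <-> P :=: W.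
Proof.
move=> tW rn; split=> [[pP [t /simple_system_generated[c gc _]]]|PE].
  apply: (parabolic_rank pP gc).2; by rewrite product_diagram1.
rewrite /= PE; split=> //; rewrite -stdpT; exact: (parabolic_stdp RS).
Qed.

Lemma has_type_nil P : denote rG s (Typ [::]) P <-> P :=: 1%g.
Proof.
have E0 (t : 'I_0 -> gT) : <<[set t i | i : 'I_0]>>%g = 1%g :> {set gT}.
  rewrite (_ : [set t i | i : 'I_0] = set0) ?gen0 //.
  by apply/setP => x; rewrite in_set0; apply/imsetP => -[[]].
split=> [[_ [t [c [_ _ _ ->]]]]|PE]; first exact: E0.
rewrite /= PE; split; first by rewrite -stdp0; apply: (parabolic_stdp RS).
exists (fun=> 1%g), (fun=> 0); split; rewrite ?E0 //; try by case.
by rewrite /row_free -leqn0 rank_leq_row.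
Qed.

Lemma full_class X : has_type rG [:: X] W -> cox_rank X = n ->
  is_parabolic_class rG (denote rG s (Typ [:: X])) /\
  is_parabolic_class rG (denote rG s (Typ [::])).
Proof.
move=> tW rn; split.
  exists W; first by rewrite -stdpT; apply: (parabolic_stdp RS).
  move=> P; rewrite has_type_full //; split=> [PE|[w wW ->]]; last by rewrite conjGid.
  by exists 1%g; rewrite // conjsg1.
exists 1%G; first by have := parabolic_stdp RS set0; rewrite stdp0.
move=> P; rewrite has_type_nil //; split=> [PE|[w wW ->]]; last exact: conjs1g.
by exists 1%g; rewrite // conjsg1.
Qed.

End Extremes.

(** * Roots of dihedral groups *)

Section Rotation.
Variables (R : realType) (d : nat) (e0 e1 : 'rV[R]_d) (m : nat).
Hypotheses (e00 : dot e0 e0 = 1) (e11 : dot e1 e1 = 1) (e01 : dot e0 e1 = 0).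
Hypothesis m1 : (1 < m)%N.
Let th : R := pi / m%:R.

Definition rt x := cos x *: e0 + sin x *: e1.

Lemma dot_rt x y : dot (rt x) (rt y) = cos (x - y).
Proof.
rewrite /rt !dotDl !dotDr !dotZl !dotZr e00 e11 e01 [dot e1 e0]dotC e01 cosB.
by ring.
Qed.

Lemma rtDpi x : rt (x + pi) = - rt x.
Proof. by rewrite /rt cosDpi sinDpi !scaleNr opprD. Qed.

Lemma rt_refl x y : rt x *m reflmx (rt y) = - rt (2 * y - x).
Proof.
rewrite reflmxE !dot_rt subrr cos0 divr1.
have -> : 2 * y - x = y - (x - y) by ring.
rewrite (_ : rt x = rt (y + (x - y))); last by congr rt; ring.
move: (x - y) => z; rewrite /rt cosD sinD cosB sinB.
by apply/rowP => i; rewrite !mxE; ring.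
Qed.

Definition rt_idx k := rt (k%:R * th).

Lemma th_m : m%:R * th = pi.
Proof. by rewrite /th mulrC divfK // pnatr_eq0; lia. Qed.

Lemma rt_idxD k : rt_idx (k + m) = - rt_idx k.
Proof. by rewrite /rt_idx natrD mulrDl th_m rtDpi. Qed.

(** The index [k] goes to 2j - k, up to sign and multiples of [m]; for [m] even this keeps its
    parity. *)
Lemma rt_idx_refl k j : (k < m)%N -> (j < m)%N ->
  exists k' x, [/\ (k' < m)%N, rt_idx k *m reflmx (rt_idx j) = sg R x *: rt_idx k' &
    ~~ odd m -> odd k' = odd k].
Proof.
move=> km jm; rewrite rt_refl.
have [h|h] := leqP k (2 * j).
  have -> : 2 * (j%:R * th) - k%:R * th = (2 * j - k)%:R * th.
    by rewrite natrB // natrM; ring.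
  rewrite -/(rt_idx _); have [h'|h'] := ltnP (2 * j - k) m.
    exists (2 * j - k)%N, true; rewrite /sg scaleN1r; split=> // _.
    by rewrite oddB // oddM.
  exists (2 * j - k - m)%N, false; rewrite /sg scale1r; split=> [||/negPf om].
  - lia.
  - by rewrite -{1}(subnK h') rt_idxD opprK.
  by rewrite oddB // om addbF oddB // oddM.
exists (m + 2 * j - k)%N, false; rewrite /sg scale1r; split=> [||/negPf om].
- lia.
- rewrite -rtDpi /rt_idx natrB ?natrD ?natrM -?th_m; last by lia.
  by congr rt; ring.
have mk : (k <= m + 2 * j)%N by lia.
by rewrite oddB // oddD om oddM.
Qed.

Definition rt_root v := exists k x, (k < m)%N /\ v = sg R x *: rt_idx k.

Lemma th_gt0 : 0 < th.
Proof. by rewrite divr_gt0 ?pi_gt0 // ltr0n; lia. Qed.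

Lemma sin_th_gt0 : 0 < sin th.
Proof.
by apply: sin_gt0_pi; rewrite th_gt0 -th_m -[X in X < _]mul1r ltr_pM2r ?th_gt0 // ltr1n.
Qed.

Lemma rt_idx0 : rt_idx 0 = e0.
Proof. by rewrite /rt_idx mul0r /rt cos0 sin0 scale1r scale0r addr0. Qed.

Lemma rt_idx_last : rt_idx m.-1 = - cos th *: e0 + sin th *: e1.
Proof.
have mE : m.-1%:R * th = pi - th.
  by rewrite -th_m -[X in X%:R * th - _](prednK (ltnW m1)) -natr1; ring.
rewrite /rt_idx mE /rt cosB sinB cospi sinpi.
by congr (_ *: _ + _ *: _); ring.
Qed.

Lemma angle_range k : (k < m)%N -> 0 <= k%:R * th < pi.
Proof.
move=> km; have h := th_gt0; rewrite mulr_ge0 ?ler0n ?ltW //=.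
by rewrite -th_m ltr_pM2r // ltr_nat.
Qed.

Lemma dot_rt_idx k j : (j <= k)%N -> dot (rt_idx k) (rt_idx j) = cos ((k - j)%:R * th).
Proof. by move=> jk; rewrite dot_rt -mulrBl natrB. Qed.

Lemma dot_idx1 k : dot (rt_idx k) (rt_idx k) = 1.
Proof. by rewrite dot_rt subrr cos0. Qed.

Lemma rt_idx_neq0 k : rt_idx k != 0.
Proof. by rewrite -dot_eq0 dot_idx1 oner_eq0. Qed.

Lemma rt_idx_inj k j x : (k < m)%N -> (j < m)%N -> rt_idx k = sg R x *: rt_idx j -> k = j.
Proof.
wlog jk : k j / (j <= k)%N => [H km jm E|km jm].
  have [h|h] := leqP j k; first exact: H E.
  symmetry; apply: H => //; first exact: ltnW.
  by rewrite E scalerA sg_sqr scale1r.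
move/(congr1 (fun v => dot v (rt_idx j))); rewrite dotZl dot_idx1 mulr1 dot_rt_idx // => E.
have kjm : (k - j < m)%N by lia.
have s0 : sin ((k - j)%:R * th) = 0.
  by apply: cos1sin0; rewrite E; case: (x); rewrite /sg ?normrN normr1.
have [] := posnP (k - j)%N; first by lia.
move=> kj0; have /sin_gt0_pi : 0 < (k - j)%:R * th < pi.
  by have /andP[_ ->] := angle_range kjm; rewrite mulr_gt0 ?th_gt0 // ltr0n.
by rewrite s0 ltxx.
Qed.

(** Subtraction being truncated, the sum of the two differences is the distance of the indices;
    orthogonality means a distance of m/2. *)
Lemma dot_rt_idx0 k j : (k < m)%N -> (j < m)%N ->
  dot (rt_idx k) (rt_idx j) = 0 <-> ((k - j) + (j - k)).*2 = m.
Proof.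
wlog jk : k j / (j <= k)%N => [H km jm|km jm].
  have [h|h] := leqP j k; first exact: H.
  by rewrite dotC addnC; apply: H => //; apply: ltnW.
have kjm : (k - j < m)%N by lia.
have hp : m%:R * th / 2 = pi / 2 by rewrite th_m.
have -> : (j - k)%N = 0%N by lia.
rewrite addn0 dot_rt_idx //; split=> [E|E].
  have : (k - j)%:R * th = pi / 2.
    apply: cos_inj; rewrite ?in_itv /= ?E ?cos_pihalf //.
      by have /andP[-> /ltW ->] := angle_range kjm.
    by have := pi_gt0 R; move=> ?; apply/andP; split; lra.
  rewrite -hp mulrAC => /(mulIf (lt0r_neq0 th_gt0)) E'.
  apply/eqP; rewrite -(eqr_nat R) -muln2 natrM E' divfK ?pnatr_eq0 //.
suff -> : (k - j)%:R * th = pi / 2 by rewrite cos_pihalf.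
rewrite -hp; have -> : m%:R = (k - j)%:R * 2 :> R by rewrite -natrM muln2 E.
by field.
Qed.

End Rotation.

Section Dihedral.
Variables (R : realType) (gT : finGroupType) (W : {group gT}) (d : nat).
Variable rG : mx_representation R W d.
Variables (m : nat) (s : 'I_2 -> gT) (e0 e1 : 'rV[R]_d).
Hypotheses (e00 : dot e0 e0 = 1) (e11 : dot e1 e1 = 1) (e01 : dot e0 e1 = 0).
Hypothesis m1 : (1 < m)%N.
Let th : R := pi / m%:R.
Let Phi := rt_root e0 e1 m.

(** The simple roots are at the angle pi - pi / m, hence are the first and the last of the [m] root
    directions. *)
Definition node_idx (i : 'I_2) := if i == ord0 then 0%N else m.-1.
Let a i := rt_idx e0 e1 m (node_idx i).

Hypothesis W_faithful : mx_faithful rG.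
Hypothesis W_gen : W :=: <<[set s i | i : 'I_2]>>%g.
Hypothesis s_refl : forall i, s i \in W /\ rG (s i) = reflmx (a i).
Hypothesis a_free : row_free (\matrix_i a i).
Implicit Types (P Q : {group gT}).
Local Notation rho := (rt_idx e0 e1 m).
Local Notation gp := (gp rG).

Lemma node_idx_lt i : (node_idx i < m)%N.
Proof. by rewrite /node_idx; case: ifP => _; lia. Qed.

Lemma I2P (i : 'I_2) : i = ord0 \/ i = ord_max.
Proof. by case: i => [[|[|//]]] p; [left|right]; apply: val_inj. Qed.

Lemma dihedral_root_system : root_system rG s a Phi.
Proof.
have th0 : 0 < th by apply: th_gt0.
have thm : m%:R * th = pi by apply: th_m.
have sth : 0 < sin th by apply: sin_th_gt0.
split=> //.
- by move=> i; case: (s_refl i).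
- by move=> i; case: (s_refl i).
- by move=> i; exists (node_idx i), false; rewrite node_idx_lt /sg scale1r.
- by move=> v [k [x [_ ->]]]; rewrite scaler_eq0 (negPf (sg_neq0 _ _)) rt_idx_neq0.
- move=> v i [k [x [km ->]]].
  have [k' [y [k'm E _]]] := rt_idx_refl e00 e11 e01 m1 km (node_idx_lt i).
  by exists k', (x (+) y); rewrite -scalemxAl E scalerA sgM.
- move=> v [k [x [km ->]]].
  (* Law of sines: the unit vector at the angle [k%:R * th] decomposed along the directions 0 and
     [pi - th]. *)
  pose c := \row_(i < 2) ((if i == ord0 then sin (k%:R * th + th) else sin (k%:R * th)) / sin th).
  have cE : rho k = c *m \matrix_i a i.
    rewrite mulmx_sum_row big_ord_recl big_ord1 !rowK !mxE /= /a /node_idx /=.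
    rewrite rt_idx0 rt_idx_last // /rt_idx /rt sinD; apply/rowP => i; rewrite !mxE.
    by field; apply: lt0r_neq0.
  have c0 i : 0 <= c 0 i.
    have /andP[k0 kpi] := angle_range R m1 km.
    rewrite mxE divr_ge0 ?(ltW sth) //; case: ifP => _; apply: sin_ge0_pi.
      rewrite addr_ge0 ?(ltW th0) //= -thm -[X in _ + X]mul1r -mulrDl ler_pM2r //.
      by rewrite natr1 ler_nat.
    by rewrite k0 ltW.
  case: x; rewrite /sg ?scale1r ?scaleN1r cE; last by exists c; auto.
  exists (- c); first by rewrite mulNmx.
  by right=> i; rewrite mxE oppr_le0.
move=> i x [k [y [km E]]]; have : dot (x *: a i) (x *: a i) = 1.
  by rewrite E dotZl dotZr dot_idx1 // mulr1 sg_sqr.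
rewrite dotZl dotZr dot_idx1 // mulr1 => xx.
have /eqP : (x - 1) * (x + 1) = 0 by rewrite -[RHS](subrr (x * x)) {2}xx; ring.
by rewrite mulf_eq0 subr_eq0 addr_eq0 => /orP[/eqP ->|/eqP ->]; [left|right].
Qed.
Let RS := dihedral_root_system.

Lemma gp_line u (Psi : 'rV[R]_d -> Prop) :
  (forall v, Psi v <-> exists x, v = sg R x *: u) -> gp Psi = gp (eq^~ u).
Proof.
move=> H; apply/val_inj; rewrite /=; congr <<_>>%g.
apply/setP => t; apply/refls_inP/refls_inP => -[tW [v Pv tv]]; split=> //.
  by have [x E] := (H v).1 Pv; exists u; rewrite // tv E reflmxZ ?sg_neq0.
by exists u => //; [apply/H; exists false; rewrite /sg scale1r|rewrite tv Pv].
Qed.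

Lemma gp_opp u : gp (eq^~ (- u)) = gp (eq^~ u).
Proof.
apply/val_inj; rewrite /=; congr <<_>>%g.
apply/setP => t; apply/refls_inP/refls_inP => -[tW [_ -> tv]]; split=> //.
  by exists u; rewrite // tv reflmxN.
by exists (- u); rewrite // tv reflmxN.
Qed.

Lemma stdp1_gp i : stdp s [set i] = gp (eq^~ (a i)) :> {set gT}.
Proof.
have [sW sE] := s_refl i; rewrite /stdp /=; congr <<_>>%g; rewrite imset_set1.
apply/setP => t; rewrite inE; apply/eqP/refls_inP => [->|[tW [_ -> tE]]].
  by split=> //; exists (a i).
by apply: (rs_inj RS); rewrite // tE.
Qed.

Lemma Orth_idx j k : (j < m)%N -> (k < m)%N -> ((k - j) + (j - k)).*2 = m ->
  gp (Orth Phi (eq^~ (rho j))) = gp (eq^~ (rho k)).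
Proof.
move=> jm km jk; apply: gp_line => v; split=> [[[l [x [lm ->]]] /(_ _ erefl)]|[x ->]].
  rewrite dotZr => /eqP; rewrite mulf_eq0 (negPf (sg_neq0 _ _)) /= => /eqP.
  move=> /(dot_rt_idx0 e00 e11 e01 m1 jm lm) lE; exists x.
  congr (_ *: rho _); lia.
split; first by exists k, x.
move=> _ ->; rewrite dotZr; apply/eqP; rewrite mulf_eq0; apply/orP; right; apply/eqP.
by apply/(dot_rt_idx0 e00 e11 e01 m1 jm km); rewrite addnC.
Qed.

Lemma Orth_odd j : odd m -> (j < m)%N -> gp (Orth Phi (eq^~ (rho j))) = 1%g :> {set gT}.
Proof.
move=> om jm; apply: gp_False => v [[l [x [lm ->]]] /(_ _ erefl)].
rewrite dotZr => /eqP; rewrite mulf_eq0 (negPf (sg_neq0 _ _)) /= => /eqP.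
by move=> /(dot_rt_idx0 e00 e11 e01 m1 jm lm) lE; rewrite -lE odd_double in om.
Qed.

(** For two indices of the same parity, the reflection in the root halfway between them exchanges
    the roots up to sign. *)
Lemma conj_idx k : ~~ odd m -> (k < m)%N -> exists2 w, w \in W &
  gp (eq^~ (rho k)) = stdp s [set if odd k then ord_max else ord0] :^ w :> {set gT}.
Proof.
move=> em km; set i := if _ then _ else _.
have par : odd (k + node_idx i) = false.
  by rewrite /i /node_idx; case: (boolP (odd k)) => ok; rewrite oddD ?ok ?(negPf ok) //=; lia.
pose j := (k + node_idx i)./2.
have jE : j.*2 = (k + node_idx i)%N by rewrite -[RHS]odd_double_half par.
have jm : (j < m)%N by have := node_idx_lt i; lia.
have [t tW tE] : exists2 t, t \in W & rG t = reflmx (rho j).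
  by apply: (Phi_refl RS); exists j, false; rewrite /sg scale1r.
have E : a i *m rG t = - rho k.
  rewrite tE /a rt_refl //; congr (- rt _ _ _).
  rewrite mulrA -mulrBl; congr (_ * _); rewrite -natrM mul2n jE natrD; ring.
exists t => //; rewrite stdp1_gp (gp_conj RS) //; congr (gval _); symmetry.
rewrite -gp_opp; apply: eq_gp => v.
by split=> [H|->]; [rewrite -E -H repr_mxKV|rewrite -E repr_mxK].
Qed.

Lemma orbit_idx k w : (k < m)%N -> w \in W -> exists k' x,
  [/\ (k' < m)%N, rho k *m rG w = sg R x *: rho k' & ~~ odd m -> odd k' = odd k].
Proof.
move=> km; move: w; apply: (rs_gen_ind RS) => [|w i wW [k' [x [k'm E par]]]].
  by exists k, false; rewrite repr_mx1 mulmx1 /sg scale1r.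
have [k2 [y [k2m E2 par2]]] := rt_idx_refl e00 e11 e01 m1 k'm (node_idx_lt i).
exists k2, (x (+) y); split=> // [|om]; last by rewrite par2 ?par.
rewrite repr_mxM ?(rs_in RS) // mulmxA E (rs_refl RS) -scalemxAl [rho k' *m _]E2.
by rewrite scalerA sgM.
Qed.

Lemma odd_node_idx i : ~~ odd m -> odd (node_idx i) = (i != ord0).
Proof. by rewrite /node_idx => em; case: eqP => //= _; lia. Qed.

(** Equality of ranks leaves only two singletons. For [m] even, W preserves the parity of the index
    of a root, and the two simple roots have different parities; for [m] odd they are conjugate,
    which explains the hypothesis. *)
Lemma stdp_conj_inj (J J' : {set 'I_2}) w w' : ~~ odd m \/ (J = setT \/ J = set0) ->
  w \in W -> w' \in W -> stdp s J :^ w = stdp s J' :^ w' :> {set gT} -> J = J'.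
Proof.
move=> hJ wW w'W E.
have gJ := generated_by_conj RS wW (stdp_generated RS J).
have gJ' := generated_by_conj RS w'W (stdp_generated RS J'); rewrite E in gJ.
have cJ := generated_by_rank gJ gJ'.
case: hJ => [em|[J0|J0]]; last first.
- by apply/esym/eqP; rewrite J0 -cards_eq0 -cJ J0 cards0.
- apply/esym/eqP; rewrite J0 eqEcard subsetT -cJ J0 leqnn //.
have [J1|J1] := boolP (#|J| == 1%N); last first.
  have : #|J| = 0%N \/ #|J| = 2%N.
    by have := max_card (mem J); rewrite card_ord; case: #|J| J1 => [|[|[|]]]; auto.
  case=> c; first by rewrite (cards0_eq c) (cards0_eq (etrans (esym cJ) c)).
  have full (K : {set 'I_2}) : #|K| = 2%N -> K = setT.
    by move=> cK; apply/eqP; rewrite eqEcard subsetT cardsT card_ord cK.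
  have JT := full J c; have JT' := full J' (etrans (esym cJ) c).
  by rewrite JT JT'.
have /cards1P[i iJ] := J1; have /cards1P[i' iJ'] : #|J'| == 1%N by rewrite -cJ.
have sP : (s i ^ w)%g \in stdp s J' :^ w'.
  by rewrite -E memJ_conjg; apply/mem_gen/imset_f; rewrite iJ inE.
have Pi : Phi (a i *m rG w) := rs_stable RS wW (rs_simple RS i).
have [x xE] := generated_by_root gJ' sP (rs_neq0 RS Pi) (rs_conj RS (rs_in RS i) wW (rs_refl RS i)).
have {}xE : a i *m rG w = (\sum_j x 0 j) *: (a i' *m rG w').
  rewrite xE mulmx_sum_row scaler_suml; apply: eq_bigr => j _; rewrite rowK.
  by have := enum_valP j; rewrite {2}iJ' inE => /eqP ->.
rewrite xE in Pi; have Pi' := rs_stable RS w'W (rs_simple RS i').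
have [y yE] : exists y, a i *m rG w = sg R y *: (a i' *m rG w').
  by rewrite xE; have [->|->] := Phi_reduced RS Pi' Pi; [exists false|exists true].
have [k [z [km kE kp]]] := orbit_idx (node_idx_lt i) wW.
have [k' [z' [k'm k'E k'p]]] := orbit_idx (node_idx_lt i') w'W.
have kk : k = k'.
  apply: (rt_idx_inj e00 e11 e01 m1 (x := z (+) (y (+) z')) km k'm).
  have : sg R z *: (sg R z *: rho k) = sg R z *: (sg R y *: (sg R z' *: rho k')).
    by rewrite -kE -k'E -yE.
  by rewrite !scalerA sg_sqr scale1r !sgM addbA.
have : (i == ord0) = (i' == ord0).
  by apply: negb_inj; rewrite -!(odd_node_idx _ em) -kp // -k'p // kk.
rewrite iJ iJ'; have [->|->] := I2P i; have [->|->] := I2P i' => //=.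
Qed.

Definition labI (J : {set 'I_2}) :=
  if J == setT then Typ [:: TI m] else if J == set0 then Typ [::] else
  if ord0 \in J then Std [:: 1%N] else Std [:: 2%N].

Lemma labIT : labI setT = Typ [:: TI m].
Proof. by rewrite /labI eqxx. Qed.

Lemma labI0 : labI set0 = Typ [::].
Proof. by rewrite /labI eqxx ifF //; apply/negbTE; rewrite eqEcard cardsT cards0 card_ord andbF. Qed.

Lemma labI1 (i : 'I_2) : labI [set i] = Std [:: i.+1].
Proof.
rewrite /labI ifF; last by apply/negbTE; rewrite eqEcard cardsT cards1 card_ord andbF.
rewrite ifF; last by apply/negbTE; rewrite -cards_eq0 cards1.
by rewrite inE; have [->|->] := I2P i.
Qed.

Lemma set2P (J : {set 'I_2}) : [\/ J = setT, J = set0 | exists i, J = [set i]].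
Proof.
have [c|[c|c]] : #|J| = 0%N \/ #|J| = 1%N \/ #|J| = 2%N.
- by have := max_card (mem J); rewrite card_ord; case: #|J| => [|[|[|]]]; auto.
- by apply: Or32; apply: cards0_eq.
- by apply: Or33; move/eqP/cards1P: c.
by apply: Or31; apply/eqP; rewrite eqEcard subsetT cardsT card_ord c.
Qed.

Hypothesis W_TI : has_type rG [:: TI m] W.

Lemma denote_labI J P : denote rG s (labI J) P <-> exists2 w, w \in W & P :=: stdp s J :^ w.
Proof.
case: (set2P J) => [->|->|[i ->]].
- rewrite labIT (has_type_full RS) // (stdpT RS); split=> [PE|[w wW ->]].
    by exists 1%g; rewrite // conjsg1.
  by rewrite conjGid.
- rewrite labI0 (has_type_nil RS) stdp0; split=> [PE|[w wW ->]]; last exact: conjs1g.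
  by exists 1%g; rewrite // conjsg1.
rewrite labI1 /= /conj_of_gen /stdp /= (_ : simples s [:: i.+1] = [set s j | j in [set i]]) //.
apply/setP => t; apply/imsetP/imsetP => -[j jE ->]; exists j => //.
  by move: jE; rewrite !inE eqSS => /eqP ji; apply/eqP/val_inj.
by move: jE; rewrite !inE => /eqP ->.
Qed.

(** For [m] even, the index of the root orthogonal to the simple root of [i]: m/2 steps from the
    index 0, or from m - 1. *)
Definition partner (i : 'I_2) := if i == ord0 then m./2 else m./2.-1.

Definition partner_node i : 'I_2 := if odd (partner i) then ord_max else ord0.

Lemma concept_node i : ~~ odd m -> (partner i < m)%N /\
  concept rG (stdp s [set i]) (gp (eq^~ (rho (partner i)))).
Proof.
move=> em; have mE : m = m./2.*2 by rewrite -[LHS]odd_double_half (negPf em).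
have pm : (partner i < m)%N by rewrite /partner; case: ifP; lia.
have pE : ((partner i - node_idx i) + (node_idx i - partner i)).*2 = m.
  by rewrite /partner /node_idx; case: ifP => _; lia.
split=> //; have im := node_idx_lt i.
apply: (gp_concept RS (Psi := eq^~ (a i)) (Psi' := eq^~ (rho (partner i)))).
- by move=> _ ->; apply: (rs_simple RS).
- by move=> _ ->; exists (partner i), false; rewrite /sg scale1r.
- exact: Orth_idx.
- by rewrite (@Orth_idx _ (node_idx i)) // addnC.
- exact: stdp1_gp.
by [].
Qed.

Definition okI (J J' : {set 'I_2}) := J = setT /\ J' = set0 \/
  ~~ odd m /\ exists i, J = [set i] /\ J' = [set partner_node i].

Lemma concept_nodes P Q : concept rG P Q -> exists J J', [/\ okI J J' \/ okI J' J,
  exists2 w, w \in W & P :=: stdp s J :^ w & exists2 w, w \in W & Q :=: stdp s J' :^ w].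
Proof.
move=> PQ; have [pP _ QE PE] := PQ; have [J [w wW JE]] := parabolic_std RS pP.
have triv P' Q' : concept rG P' Q' -> P' :=: 1%g -> exists2 w, w \in W & Q' :=: stdp s setT :^ w.
  by move=> c /(concept_triv RS c) ->; exists 1%g; rewrite ?conjsg1 ?(stdpT RS).
case: (set2P J) => [JT|J0|[i Ji]].
- exists setT, set0; split; first by left; left.
    by exists w; rewrite -?JT.
  exists 1%g; rewrite // conjsg1 stdp0.
  have [_ _ E1 _] := @concept_full _ _ _ _ _ _ _ _ _ RS W 1%G erefl erefl.
  by rewrite QE JE JT (stdpT RS) conjGid.
- have P1 : P :=: 1%g by rewrite JE J0 stdp0 conjs1g.
  exists set0, setT; split; [by right; left| |exact: triv PQ P1].
  by exists 1%g; rewrite // conjsg1 stdp0.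
have PQw := concept_conj RS (groupVr wW) PQ.
have PwE : P :^ w^-1 = stdp s [set i] by rewrite JE Ji conjsgK.
have [_ _ QwE PwE'] := PQw; rewrite /= in QwE PwE'.
(* For [m] odd no two roots are orthogonal, so the complement of a subgroup of rank 1 is trivial,
   and the complement of that is W. *)
have [om|em] := boolP (odd m).
  have Q1 : Q :^ w^-1 = 1%g.
    rewrite QwE PwE stdp1_gp (dagger_gp RS); last by move=> _ ->; apply: (rs_simple RS).
    exact: Orth_odd (node_idx_lt i).
  have := concept_triv RS (conceptC PQw) Q1; rewrite /= PwE => E.
  have := @stdp_conj_inj setT [set i] 1%g 1%g (or_intror (or_introl erefl)) (group1 W) (group1 W).
  rewrite !conjsg1 (stdpT RS) E => /(_ erefl)/(congr1 (fun A : {set _} => #|A|)).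
  by rewrite cardsT card_ord cards1.
have [pm [_ _ QE' _]] := concept_node i em.
have [x xW xE] := conj_idx em pm; rewrite -/(partner_node i) in xE.
exists [set i], [set partner_node i]; split.
- by left; right; split=> //; exists i.
- by exists w; rewrite // JE Ji.
exists (x * w)%g; first exact: groupM.
by rewrite conjsgM -xE QE' -PwE -QwE conjsgKV.
Qed.

Lemma exists_nodes J J' : okI J J' -> exists P Q : {group gT}, [/\ concept rG P Q,
  exists2 w, w \in W & P :=: stdp s J :^ w & exists2 w, w \in W & Q :=: stdp s J' :^ w].
Proof.
case=> [[-> ->]|[em [i [-> ->]]]].
  exists W, 1%G; split; first exact: (concept_full RS).
    by exists 1%g; rewrite // conjsg1 (stdpT RS).
  by exists 1%g; rewrite // conjsg1 stdp0.
have [pm c] := concept_node i em; eexists; eexists; split; first exact: c.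
  by exists 1%g; rewrite // conjsg1.
exact: conj_idx.
Qed.

Lemma okI_inj J J' : okI J J' ->
  (~~ odd m \/ (J = setT \/ J = set0)) /\ (~~ odd m \/ (J' = setT \/ J' = set0)).
Proof. by case=> [[-> ->]|[em _]]; auto. Qed.

Lemma labI_inj J J' P : ~~ odd m \/ (J = setT \/ J = set0) ->
  denote rG s (labI J) P -> denote rG s (labI J') P -> labI J' = labI J.
Proof.
move=> h /denote_labI[w wW PE] /denote_labI[w' w'W PE'].
by congr labI; apply/esym; apply: (stdp_conj_inj h wW w'W); rewrite -PE -PE'.
Qed.

Lemma classified_by_labI (L : label * label -> Prop) :
  (forall c, L c -> exists J J', okI J J' /\ c = (labI J, labI J')) ->
  (forall J J', okI J J' -> L (labI J, labI J') \/ L (labI J', labI J)) ->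
  classified_by rG s L.
Proof.
move=> Lok okL; apply: (classified_by_intro RS) => [c Lc|c Lc|P Q PQ|c c' P Q Lc Lc' PQ].
- have [J [J' [_ ->]]] := Lok _ Lc.
  have cl K : is_parabolic_class rG (denote rG s (labI K)).
    by exists (stdp s K); [apply: (parabolic_stdp RS)|apply: denote_labI].
  by split; apply: cl.
- have [J [J' [/exists_nodes[P [Q [PQ dP dQ]]] ->]]] := Lok _ Lc.
  by exists P, Q; split=> //; apply/denote_labI.
- have [J [J' [ok /denote_labI dP /denote_labI dQ]]] := concept_nodes PQ.
  have [Lc|Lc] : L (labI J, labI J') \/ L (labI J', labI J).
    by case: ok => /okL[]; auto.
    by exists (labI J, labI J') => //; split=> //; left.
  by exists (labI J', labI J) => //; split=> //; right.
have [J [J' [ok ->]]] := Lok _ Lc; have [hJ hJ'] := okI_inj ok.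
have [K [K' [ok' ->]]] := Lok _ Lc'.
move=> /= dP dQ; split=> dP' dQ'; congr (_, _).
- exact: labI_inj dP dP'.
- exact: labI_inj dQ dQ'.
- exact: labI_inj dQ dP'.
exact: labI_inj dP dQ'.
Qed.

Lemma dihedral_classified : classified_by rG s (concept_list (TI m)).
Proof.
have p0 : partner ord0 = m./2 by rewrite /partner eqxx.
have p1 : partner ord_max = m./2.-1 by [].
have T0 : okI setT set0 by left.
have T1 i : ~~ odd m -> okI [set i] [set partner_node i].
  by move=> em; right; split=> //; exists i.
apply: classified_by_labI => [c|J J'].
  case=> [->|[m4 lc]|[m4 ->]].
  - by exists setT, set0; rewrite labIT labI0.
  - have [em h] : ~~ odd m /\ odd m./2 = false by split; [lia|apply/negbTE; lia].
    have N0 : partner_node ord0 = ord0 by rewrite /partner_node p0 h.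
    have N1 : partner_node ord_max = ord_max.
      by rewrite /partner_node p1 (_ : odd _ = true) //; lia.
    case: lc => [->|[->|//]].
      by exists [set ord0], [set ord0]; rewrite labI1; split=> //; rewrite -{2}N0; apply: T1.
    by exists [set ord_max], [set ord_max]; rewrite labI1; split=> //; rewrite -{2}N1; apply: T1.
  have [em h] : ~~ odd m /\ odd m./2 by split; lia.
  have N0 : partner_node ord0 = ord_max by rewrite /partner_node p0 h.
  by exists [set ord0], [set ord_max]; rewrite !labI1; split=> //; rewrite -N0; apply: T1.
case=> [[-> ->]|[em [i [-> ->]]]]; first by left; rewrite labIT labI0; apply: Or31.
rewrite !labI1; have [m4|m4] := boolP (4 %| m)%N.
  left; apply: Or32; split=> //; have h : odd m./2 = false by apply/negbTE; lia.
  have [->|->] := I2P i.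
    by left; rewrite /partner_node p0 h.
  by right; left; rewrite /partner_node p1 (_ : odd _ = true) //; lia.
have m42 : (m %% 4 = 2)%N by lia.
have h : odd m./2 by lia.
have [->|->] := I2P i.
  by left; apply: Or33; rewrite /partner_node p0 h.
right; apply: Or33; rewrite /partner_node p1 (_ : odd _ = false) //; apply/negbTE; lia.
Qed.

End Dihedral.

Lemma typeI_classification (R : realType) (gT : finGroupType) (W : {group gT}) (d : nat)
    (rG : mx_representation R W d) m (s : 'I_2 -> gT) : mx_faithful rG -> (1 < m)%N ->
  @simple_system R gT W d rG (cox_diagram (TI m)) s W ->
  classified_by rG s (concept_list (TI m)).
Proof.
move=> W_faithful m1 ss; have [a [fa aa sP WE]] := ss.
pose th : R := pi / m%:R; have sth : 0 < sin th by apply: sin_th_gt0.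
have a1 i : dot (a i) (a i) = 1.
  by rewrite aa /cox_entry eqxx divr1 cospi opprK.
have a01 : dot (a ord0) (a ord_max) = - cos th by rewrite aa.
(* Orthonormalization that places the second simple root at the angle [pi - th]. *)
pose e0 := a ord0; pose e1 := (sin th)^-1 *: (a ord_max + cos th *: e0).
have e00 : dot e0 e0 = 1 := a1 _.
have e01 : dot e0 e1 = 0.
  by rewrite dotZr dotDr dotZr e00 a01 mulr1 addNr mulr0.
have e11 : dot e1 e1 = 1.
  rewrite dotZl dotZr dotDl !dotDr !dotZl !dotZr a1 e00 [dot (a _) e0]dotC a01.
  apply: (mulfI (mulf_neq0 (lt0r_neq0 sth) (lt0r_neq0 sth))).
  rewrite mulrA -invfM mulVKf ?mulf_neq0 ?lt0r_neq0 // mulr1.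
  by have := sin2cos2 th; rewrite !expr2 => ->; ring.
have aE i : a i = rt_idx e0 e1 m (node_idx m i).
  rewrite /node_idx; have [->|->] := I2P i; rewrite /=; first by rewrite rt_idx0.
  rewrite rt_idx_last // -/th /e1 scalerA mulfV ?lt0r_neq0 // scale1r.
  by rewrite scaleNr addrC addrK.
apply: (dihedral_classified e00 e11 e01 m1 W_faithful WE) => [i||].
- by rewrite -aE; have := sP i.
- suff -> : \matrix_i rt_idx e0 e1 m (node_idx m i) = \matrix_i a i by [].
  by apply/row_matrixP => i; rewrite !rowK aE.
by apply/has_type1; exists s.
Qed.

(** * Symmetric groups: roots as differences of vectors *)

Section Differences.
Variables (R : realType) (d n : nat) (f : 'I_n.+1 -> 'rV[R]_d).
Hypothesis gram : forall i j k l, dot (f i - f j) (f k - f l) =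
  (i == k)%:R - (i == l)%:R - (j == k)%:R + (j == l)%:R.

Definition diff_root (S : {set 'I_n.+1}) v :=
  exists i j, [/\ i \in S, j \in S, i != j & v = f i - f j].

Lemma diff_norm i j : i != j -> dot (f i - f j) (f i - f j) = 2.
Proof.
by move=> ij; rewrite gram !eqxx [j == i]eq_sym (negPf ij) /=; ring.
Qed.

Lemma diff_neq0 i j : i != j -> f i - f j != 0.
Proof. by move=> ij; rewrite -dot_eq0 diff_norm // pnatr_eq0. Qed.

Lemma tperm_diff k l i : k != l ->
  f (tperm k l i) = f i - ((i == k)%:R - (i == l)%:R) *: (f k - f l).
Proof.
move=> kl; case: tpermP => [->|->|/eqP ik /eqP il].
- by rewrite eqxx (negPf kl) subr0 scale1r opprB addrC subrK.
- by rewrite eqxx eq_sym (negPf kl) sub0r scaleN1r opprK addrC subrK.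
by rewrite (negPf ik) (negPf il) subrr scale0r subr0.
Qed.

Lemma diff_refl i j k l : k != l ->
  (f i - f j) *m reflmx (f k - f l) = f (tperm k l i) - f (tperm k l j).
Proof.
move=> kl; rewrite reflmxE diff_norm // mulrAC divff ?pnatr_eq0 // mul1r.
rewrite !tperm_diff // gram; move: (f k - f l) => r.
by apply/rowP => c; rewrite !mxE; ring.
Qed.

Lemma diff_scale (x : R) i j k l : i != j -> k != l -> f k - f l = x *: (f i - f j) ->
  x = 1 \/ x = -1.
Proof.
move=> ij kl E; have := diff_norm kl; rewrite E dotZl dotZr diff_norm // => H.
have xx : x * x = 1 by lra.
have /eqP : (x - 1) * (x + 1) = 0 by rewrite -[RHS](subrr (x * x)) {2}xx; ring.
by rewrite mulf_eq0 subr_eq0 addr_eq0 => /orP[/eqP ->|/eqP ->]; [left|right].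
Qed.

Lemma diff_dot_neq0 k l j : k != l -> j != k -> dot (f k - f j) (f k - f l) != 0.
Proof.
move=> kl jk; rewrite gram eqxx (negPf kl) (negPf jk) !subr0 -natrD pnatr_eq0.
by case: (j == l).
Qed.

End Differences.

Section SymmetricGroup.
Variables (R : realType) (gT : finGroupType) (W : {group gT}) (d : nat).
Variable rG : mx_representation R W d.
Variables (n : nat) (s : 'I_n -> gT) (b : 'I_n -> 'rV[R]_d) (f : 'I_n.+1 -> 'rV[R]_d).
Hypothesis gram : forall i j k l, dot (f i - f j) (f k - f l) =
  (i == k)%:R - (i == l)%:R - (j == k)%:R + (j == l)%:R.
Hypothesis n0 : (0 < n)%N.
Hypothesis b_f : forall i : 'I_n, b i = f (widen_ord (leqnSn n) i) - f (lift ord0 i).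
Let Phi := diff_root f setT.
Hypothesis RS : root_system rG s b Phi.
Implicit Types (P Q : {group gT}) (S : {set 'I_n.+1}) (v w : 'rV[R]_d).
Local Notation gp := (gp rG).
Local Notation D := (diff_root f).

Let PhiP i j : i != j -> Phi (f i - f j).
Proof. by move=> ij; exists i, j; rewrite !inE. Qed.

Let sub_Phi S v : D S v -> Phi v.
Proof. by move=> [i [j [_ _ ij ->]]]; apply: PhiP. Qed.

Lemma W_diff_perm (sigma : {perm 'I_n.+1}) :
  exists2 x, x \in W & forall i j, (f i - f j) *m rG x = f (sigma i) - f (sigma j).
Proof.
have [ts -> dts] := prod_tpermP sigma.
elim: ts dts => [_|[k l] ts IH /= /andP[kl /IH[w wW wE]]].
  by exists 1%g => // i j; rewrite repr_mx1 mulmx1 big_nil !perm1.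
have [t tW tE] := Phi_refl RS (PhiP kl).
exists (t * w)%g => [|i j]; first exact: groupM.
by rewrite repr_mxM // mulmxA tE (diff_refl gram) // wE big_cons !permM.
Qed.

Lemma conj_diff S S' : #|S| = #|S'| ->
  exists2 w, w \in W & gp (D S') = gp (D S) :^ w :> {set gT}.
Proof.
move=> SS'; have [|sigma sE] := perm_of_uniq (enum_uniq S) (enum_uniq S').
  by rewrite -!cardE.
have SE i : (sigma i \in S') = (i \in S).
  by rewrite -!(mem_enum S) -(mem_enum S') -sE mem_map //; apply: perm_inj.
have [w wW wE] := W_diff_perm sigma; exists w => //.
rewrite (gp_conj RS) //; congr (gval _); apply: eq_gp => v; split.
  move=> [i [j [iS jS ij ->]]]; exists (sigma^-1%g i), (sigma^-1%g j).
  rewrite -!SE !permKV iS jS (inj_eq perm_inj) ij; split=> //.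
  by rewrite -{1}(permKV sigma i) -{1}(permKV sigma j) -wE repr_mxK.
move=> [i [j [iS jS ij /(congr1 (fun v => v *m rG w))]]].
rewrite repr_mxKV // wE => ->; exists (sigma i), (sigma j).
by rewrite !SE (inj_eq perm_inj).
Qed.

Lemma Orth_vec w v : Orth Phi (eq^~ w) v <->
  exists i j, [/\ i != j, dot w (f i) = dot w (f j) & v = f i - f j].
Proof.
split=> [[[i [j [_ _ ij ->]]] /(_ _ erefl)]|[i [j [ij E ->]]]].
  by rewrite dotBr => /eqP; rewrite subr_eq0 => /eqP E; exists i, j.
by split=> [|_ ->]; [apply: PhiP|rewrite dotBr E subrr].
Qed.

Definition singles w := [set i | [forall j, (j != i) ==> (dot w (f j) != dot w (f i))]].

(** If [k] shares its value with another point [j], then f_k - f_j is orthogonal to [w] but not to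
    f_k - f_l; if neither end of a root shares its value, no root orthogonal to [w] meets them. *)
Lemma Orth_Orth_vecA w v : Orth Phi (Orth Phi (eq^~ w)) v <-> D (singles w) v.
Proof.
have nsing i : i \notin singles w -> exists2 j, j != i & dot w (f i) = dot w (f j).
  rewrite inE negb_forall => /existsP[j]; rewrite negb_imply negbK => /andP[ji /eqP E].
  by exists j.
split=> [[[k [l [_ _ kl ->]]] ov]|[k [l [kS lS kl ->]]]]; last first.
  split; first exact: PhiP.
  move=> _ /Orth_vec[i [j [ij E ->]]].
  have notS x y z : z \in singles w -> y != x -> dot w (f x) = dot w (f y) -> (x == z) = false.
    rewrite inE => /forallP/(_ y) H yx Exy; apply/eqP => xz; move: H.
    by rewrite -xz yx Exy eqxx.
  have ji : j != i by rewrite eq_sym.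
  rewrite gram (notS i j k) // (notS i j l) // (notS j i k) // (notS j i l) //.
  by rewrite !subrr add0r.
have lk : l != k by rewrite eq_sym.
exists k, l; split=> //; apply: contraT => /nsing[j jk E].
  have := diff_dot_neq0 gram kl jk; rewrite ov ?eqxx //.
  by apply/Orth_vec; exists k, j; rewrite eq_sym.
have := diff_dot_neq0 gram lk jk; rewrite -[f l - f k]opprB dotNr ov ?oppr0 ?eqxx //.
by apply/Orth_vec; exists l, j; rewrite eq_sym.
Qed.

(** A root meeting [S] at [k] is not orthogonal to f_k - f_j for another point [j] of [S]; a single
    point would carry no root to test with, hence the bound. *)
Lemma Orth_diff S v : (1 < #|S|)%N -> Orth Phi (D S) v <-> D (~: S) v.
Proof.
move=> S1; split=> [[[k [l [_ _ kl ->]]] ov]|[k [l [kS lS kl ->]]]]; last first.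
  split=> [|_ [i [j [iS jS ij ->]]]]; first exact: PhiP.
  have ne x y : x \in S -> y \in ~: S -> (x == y) = false.
    by move=> xS; rewrite inE; apply: contraNF => /eqP <-.
  by rewrite gram !ne // !subrr add0r.
have other x : x \in S -> exists2 j, j \in S & j != x.
  move=> xS; have : (0 < #|S :\ x|)%N by move: S1; rewrite (cardsD1 x) xS.
  by case/card_gt0P => j; rewrite !inE => /andP[jx jS]; exists j.
have lk : l != k by rewrite eq_sym.
exists k, l; rewrite !inE; split=> //; apply/negP => /[dup] xS /other[j jS jx].
  have := diff_dot_neq0 gram kl jx; rewrite ov ?eqxx //.
  by exists k, j; rewrite eq_sym.
have := diff_dot_neq0 gram lk jx; rewrite -[f l - f k]opprB dotNr ov ?oppr0 ?eqxx //.
by exists l, j; rewrite eq_sym.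
Qed.

Lemma concept_diff S : (1 < #|S|)%N -> (1 < #|~: S|)%N -> concept rG (gp (D S)) (gp (D (~: S))).
Proof.
move=> S1 S2; apply: (gp_concept RS (Psi := D S) (Psi' := D (~: S))) => //.
- exact: sub_Phi.
- exact: sub_Phi.
- by apply: eq_gp => v; apply: Orth_diff.
by apply: eq_gp => v; rewrite Orth_diff // setCK.
Qed.

Lemma gp_diff_small S : (#|S| <= 1)%N -> gp (D S) = 1%g :> {set gT}.
Proof.
move=> S1; apply: gp_False => v [i [j [iS jS /eqP ij _]]].
by apply: ij; apply: (card_le1_eqP S1).
Qed.

Lemma concept_cases P Q : concept rG P Q -> [\/ P :=: W /\ Q :=: 1%g, P :=: 1%g /\ Q :=: W |
  exists S, [/\ (1 < #|S|)%N, (1 < #|~: S|)%N, P = gp (D S) & Q = gp (D (~: S))]].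
Proof.
move=> PQ; have [w _ [QE PE]] := concept_gp RS PQ; pose S := singles w.
have {}QE : Q = gp (D S) by rewrite QE; apply: eq_gp => v; apply: Orth_Orth_vecA.
have [S1|S1] := leqP #|S| 1.
  have Q1 : Q :=: 1%g by rewrite QE gp_diff_small.
  by apply: Or31; split=> //; apply: (concept_triv RS (conceptC PQ)).
have {}PE : P = gp (D (~: S)).
  rewrite PE; apply: eq_gp => v; rewrite -(Orth_diff _ S1).
  by split=> -[Pv ov]; split=> // x; [move/Orth_Orth_vecA|move/Orth_Orth_vecA]; apply: ov.
have [S2|S2] := leqP #|~: S| 1.
  have P1 : P :=: 1%g by rewrite PE gp_diff_small.
  by apply: Or32; split=> //; apply: (concept_triv RS PQ).
by apply: Or33; exists (~: S); rewrite setCK.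
Qed.

Hypothesis W_type : @simple_system R gT W d rG (cox_diagram (TA n)) s W.

Lemma adjacent_root (i : 'I_n) (x y : 'I_n.+1) : x = i :> nat -> y = i.+1 :> nat ->
  b i = f x - f y.
Proof. by move=> xi yi; rewrite b_f; congr (f _ - f _); apply: val_inj; rewrite /= ?lift0 ?xi ?yi. Qed.

(** Induction on y - x: the reflection in f_x - f_y is that in f_x - f_(y-1), conjugated by the
    adjacent transposition of y - 1 and y. *)
Lemma stdp_diff m : (m <= n)%N ->
  stdp s [set i : 'I_n | i < m]%N = gp (D [set x : 'I_n.+1 | x <= m]%N) :> {set gT}.
Proof.
move=> mn; set J := [set i | _]; apply/eqP; rewrite eqEsubset; apply/andP; split.
  rewrite gen_subG; apply/subsetP => _ /imsetP[i iJ ->]; apply: mem_gen.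
  apply: mem_refls_in (rs_in RS i) (rs_refl RS i); rewrite b_f.
  have iw : (i < m)%N by rewrite inE in iJ.
  exists (widen_ord (leqnSn n) i), (lift ord0 i); rewrite !inE lift0 /= iw ltnW //; split=> //.
  by apply/eqP => /(congr1 val) /=; rewrite /bump /=; lia.
rewrite gen_subG; apply/subsetP => t /refls_inP[tW [_ [x [y [xS yS xy ->]]] tE]].
wlog lxy : x y xS yS xy tE / (x < y)%N => [H|].
  have := xy; rewrite -(inj_eq val_inj) neq_ltn => /orP[|yx]; first exact: H.
  by apply: (H y x) => //; [rewrite eq_sym|rewrite tE -reflmxN opprB].
have [k kE] : exists k, (y = x + k.+1 :> nat)%N by exists (y - x).-1; lia.
elim: k y yS xy lxy kE t tW tE => [|k IH] y yS xy lxy kE t tW tE.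
  have xn : (x < n)%N by move: yS; rewrite inE; lia.
  have -> : t = s (Ordinal xn).
    apply: (rs_inj RS) => //; first exact: (rs_in RS).
    by rewrite (rs_refl RS) tE (adjacent_root (x := x) (y := y)) //= kE addn1.
  by apply/mem_gen/imset_f; move: yS; rewrite !inE /=; lia.
have zn : (x + k.+1 < n)%N by move: yS; rewrite inE; lia.
have zn1 : (x + k.+1 < n.+1)%N by lia.
pose z : 'I_n.+1 := Ordinal zn1; pose i : 'I_n := Ordinal zn.
have zS : z \in [set x : 'I_n.+1 | x <= m]%N by move: yS; rewrite !inE /=; lia.
have xz : x != z by apply/eqP => /(congr1 val) /=; lia.
have zy : z != y by apply/eqP => /(congr1 val) /=; lia.
have [t' t'W t'E] := Phi_refl RS (PhiP xz).
have iE : b i = f z - f y by apply: adjacent_root => //=; lia.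
have -> : t = (t' ^ s i)%g.
  apply: (rs_inj RS); rewrite ?groupJ ?(rs_in RS) //.
  rewrite (rs_conj RS t'W (rs_in RS i) t'E) (rs_refl RS) iE (diff_refl gram) //.
  by rewrite tpermL tpermD // 1?eq_sym.
apply: groupJ; last by apply/mem_gen/imset_f; move: yS; rewrite !inE /=; lia.
by apply: (IH z) => //=; lia.
Qed.

Lemma diff_type S m : (0 < m)%N -> #|S| = m.+1 -> has_type rG [:: TA m] (gp (D S)).
Proof.
move=> m0 cS; have mn : (m <= n)%N.
  by have := max_card (mem S); rewrite cS card_ord.
have c0 : #|[set x : 'I_n.+1 | x <= m]%N| = #|S|.
  rewrite cS; have mn1 : (m.+1 <= n.+1)%N by [].
  have -> : [set x : 'I_n.+1 | x <= m]%N = [set widen_ord mn1 i | i : 'I_m.+1].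
    apply/setP => x; rewrite inE; apply/idP/imsetP => [xm|[i _ ->]]; last exact: ltn_ord i.
    by have xm' : (x < m.+1)%N by []; exists (Ordinal xm') => //; apply: val_inj.
  by rewrite card_imset ?card_ord // => i j /(congr1 val) /= /val_inj.
have [w wW ->] := conj_diff c0; apply: (has_type_conj RS wW); rewrite -stdp_diff //.
pose g k : 'I_n := odflt (Ordinal n0) (insub k).
have gE k : (k < n)%N -> g k = k :> nat by move=> kn; rewrite /g insubT.
have rk : (product_diagram [:: TA m]).1 = m by rewrite product_diagram1.
have := @stdp_has_type _ _ _ _ rG n s (cox_diagram (TA n)) erefl [:: TA m] g.
rewrite rk => H; have {H} : has_type rG [:: TA m] (stdp s [set g (i : 'I_m) | i : 'I_m]).
  apply: H => [|i j im jm /(congr1 val)|i j im jm].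
  - have E : (fun i : 'I_n => s (cast_ord erefl i)) = s.
      by apply/funext => i; rewrite cast_ord_id.
    by rewrite E.
  - by rewrite /= !gE //; lia.
  by rewrite product_diagram1 !entryA ?gE //; lia.
congr (has_type rG _ (gval (stdp s _))); apply/setP => i; rewrite inE.
apply/imsetP/idP => [[j _ ->]|im]; first by rewrite gE //; have := ltn_ord j; lia.
by exists (Ordinal im) => //; apply: val_inj; rewrite /= gE.
Qed.

(** The simple roots of P are differences at points with equal values under [w]. As the diagram is a
    connected chain, all these points lie in one level set [C], so P is the group of all differences
    in [C]; the rank gives the size of [C]. *)
Lemma type_diff P m : (0 < m)%N -> parabolic rG P -> has_type rG [:: TA m] P ->
  exists2 S : {set 'I_n.+1}, #|S| = m.+1 & P = gp (D S).
Proof.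
move=> m0 pP tP; have [w PE] := parabolic_vec RS pP.
have [t [c [fc cE tE tG]]] := (has_type1 rG (TA m) P).1 tP.
have H (k : 'I_m) : exists pq : 'I_n.+1 * 'I_n.+1, exists z : R, [/\ pq.1 != pq.2, z != 0,
    dot w (f pq.1) = dot w (f pq.2) & c k = z *: (f pq.1 - f pq.2)].
  have [tW tk] := tE k; have ck0 : c k != 0 := row_free_neq0 k fc.
  have : t k \in P :&: reflections rG.
    rewrite in_setI tG; apply/andP; split; first by apply/mem_gen/imset_f.
    by apply/reflectionsP; split=> //; exists (c k).
  rewrite PE (gp_reflections RS) => /refls_inP[_ [v /Orth_vec[i [j [ij E ->]]] tv]].
  have ij0 := diff_neq0 gram ij.
  have [z z0 zE] := reflmx_inj ij0 (etrans (esym tv) tk).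
  by exists (i, j), z.
have {H} [pq pqP] := choice H.
pose x0 := dot w (f (pq (Ordinal m0)).1); pose C := [set i | dot w (f i) == x0].
have inC k : (pq k).1 \in C /\ (pq k).2 \in C.
  have base i : (pq i).1 \in C -> (pq i).1 \in C /\ (pq i).2 \in C.
    by move=> h; split=> //; have [z [_ _ E _]] := pqP i; move: h; rewrite !inE E.
  case: k => k; elim: k => [|k IH] km; apply: base.
    by rewrite inE (_ : Ordinal km = Ordinal m0) //; apply: val_inj.
  have km' : (k < m)%N by lia.
  have [h1 h2] := IH km'; set i := Ordinal km' in h1 h2; set j := Ordinal km.
  have [z [ne z0 E zE]] := pqP i; have [z' [ne' z'0 E' zE']] := pqP j.
  (* Neighbours in the chain are not orthogonal, so their differences share a point and the level
     set is the same. *)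
  have : dot (c i) (c j) != 0.
    rewrite cE entryA //= (_ : (k == k.+1) = false) ?eqxx; last by apply/eqP; lia.
    by rewrite cos_pi3 oppr_eq0 mul1r invr_eq0 pnatr_eq0.
  rewrite zE zE' dotZl dotZr !mulf_eq0 (negPf z0) (negPf z'0) /= gram.
  have share y : y \in C -> (y == (pq j).1) || (y == (pq j).2) -> (pq j).1 \in C.
    by move=> yC /orP[] /eqP E2; move: yC; rewrite E2 // !inE E'.
  have [s1|/norP[/negPf -> /negPf ->]] := boolP (((pq i).1 == (pq j).1) || ((pq i).1 == (pq j).2)).
    by move=> _; apply: share s1.
  have [s2|/norP[/negPf -> /negPf ->]] := boolP (((pq i).2 == (pq j).1) || ((pq i).2 == (pq j).2)).
    by move=> _; apply: share s2.
  by rewrite !subrr add0r eqxx.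
have PC : P = gp (D C).
  apply/val_inj/eqP; rewrite eqEsubset; apply/andP; split.
    rewrite /= tG gen_subG; apply/subsetP => _ /imsetP[k _ ->]; apply: mem_gen.
    have [z [ne z0 _ zE]] := pqP k; have [tW tk] := tE k; have [h1 h2] := inC k.
    apply: (@mem_refls_in _ _ _ _ _ _ (f (pq k).1 - f (pq k).2)) => //.
      by exists (pq k).1, (pq k).2.
    by rewrite tk zE reflmxZ.
  rewrite /= PE gen_subG; apply/subsetP => u /refls_inP[uW [_ [i [j [iC jC ij ->]]] uE]].
  apply: mem_gen; apply: mem_refls_in uE => //; apply/Orth_vec; exists i, j; split=> //.
  by move: iC jC; rewrite !inE => /eqP -> /eqP ->.
exists C => //.
have [z [ne _ _ _]] := pqP (Ordinal m0); have [h1 h2] := inC (Ordinal m0).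
have C1 : (1 < #|C|)%N.
  by apply/card_gt1P; exists (pq (Ordinal m0)).1, (pq (Ordinal m0)).2.
have [k cC] : exists k, #|C| = k.+2 by case: #|C| C1 => [|[|k]] // _; exists k.
have tC : has_type rG [:: TA k.+1] P by rewrite PC; apply: diff_type cC.
have [t' /simple_system_generated[c' gc' _]] := tP.
by have := has_type_rank tC gc'; rewrite !product_diagram1 /= cC => ->.
Qed.

Definition labA m := if m is 0 then Typ [::] else Typ [:: TA m].

Lemma labAE m : (0 < m)%N -> labA m = Typ [:: TA m].
Proof. by case: m. Qed.

Lemma labA_inj m m' P : denote rG s (labA m) P -> denote rG s (labA m') P -> labA m' = labA m.
Proof.
have rk k : denote rG s (labA k) P ->
    exists2 Xs, has_type rG Xs P & (product_diagram Xs).1 = k.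
  case: k => [|k] [_ H]; first by exists [::].
  by exists [:: TA k.+1]; rewrite ?product_diagram1.
move=> /rk[Xs tX <-] /rk[Xs' [t' /simple_system_generated[c' gc' _]] <-].
by rewrite (has_type_rank tX gc').
Qed.

Let tW : has_type rG [:: TA n] W.
Proof. by apply/has_type1; exists s. Qed.

Lemma denote_labA S m : (0 < m)%N -> #|S| = m.+1 -> parabolic rG (gp (D S)) ->
  denote rG s (labA m) (gp (D S)).
Proof. by case: m => // m m0 cS pS; split=> //; apply: diff_type. Qed.

Definition okA m l := m = n /\ l = 0%N \/ [/\ n = (m + l + 1)%N, (0 < m)%N & (0 < l)%N].

Lemma okA_diff m l S : n = (m + l + 1)%N -> (0 < m)%N -> (0 < l)%N ->
  #|S| = m.+1 -> concept rG (gp (D S)) (gp (D (~: S))) /\ #|~: S| = l.+1.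
Proof.
move=> nE m0 l0 cS; have := cardsC S; rewrite card_ord cS => H.
have cC : #|~: S| = l.+1 by lia.
by split=> //; apply: concept_diff; lia.
Qed.

Lemma exists_set_card m : (m <= n)%N -> exists S : {set 'I_n.+1}, #|S| = m.+1.
Proof.
move=> mn; have mn1 : (m.+1 <= n.+1)%N by [].
exists [set widen_ord mn1 i | i : 'I_m.+1].
by rewrite card_imset ?card_ord // => i j /(congr1 val) /= /val_inj.
Qed.

Lemma typeA_classified : classified_by rG s (concept_list (TA n)).
Proof.
have Lok c : concept_list (TA n) c -> exists m l, okA m l /\ c = (labA m, labA l).
  case=> [->|[m [l [nE m0 l0 ->]]]].
    by exists n, 0%N; split; [left|rewrite (labAE n0)].
  by exists m, l; split; [right|rewrite !labAE].
have lab0 m P : (0 < m)%N -> denote rG s (labA m) P <->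
    parabolic rG P /\ has_type rG [:: TA m] P by case: m.
have cls m l : n = (m + l + 1)%N -> (0 < m)%N -> (0 < l)%N ->
    is_parabolic_class rG (denote rG s (labA m)).
  move=> nE m0 l0; have [|S cS] := @exists_set_card m; first by lia.
  have [[pS _ _ _] _] := okA_diff nE m0 l0 cS.
  exists (gp (D S)) => // P; split=> [/(lab0 _ _ m0)[pP /(type_diff m0 pP)[S' cS' ->]]|[w wW PE]].
    have [|w wW E] := @conj_diff S S'; first by rewrite cS.
    by exists w.
  apply/lab0 => //; rewrite PE; split; first exact: parabolic_conj.
  by apply: (has_type_conj RS wW); apply: diff_type.
apply: (classified_by_intro RS) => [c Lc|c Lc|P Q PQ|c c' P Q Lc Lc' PQ].
- have [m [l [[[-> ->]|[nE m0 l0]] ->]]] := Lok _ Lc.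
    by rewrite /= (labAE n0); apply: (full_class RS tW erefl).
  split; first exact: (cls m l).
  by apply: (cls l m) => //; lia.
- have [m [l [[[-> ->]|[nE m0 l0]] ->]]] := Lok _ Lc.
    exists W, 1%G; split; first exact: (concept_full RS).
      by rewrite /= (labAE n0); apply/(has_type_full RS).
    exact/(has_type_nil RS).
  have [|S cS] := @exists_set_card m; first by lia.
  have [PQ cC] := okA_diff nE m0 l0 cS; have [pS pC _ _] := PQ.
  by exists (gp (D S)), (gp (D (~: S))); split=> //; apply: denote_labA.
- case: (concept_cases PQ) => [[PE QE]|[PE QE]|[S [S1 S2 PE QE]]].
  + exists (Typ [:: TA n], Typ [::]); first by left.
    by split=> //; left; split; [apply/(has_type_full RS)|apply/(has_type_nil RS)].
  + exists (Typ [:: TA n], Typ [::]); first by left.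
    by split=> //; right; split; [apply/(has_type_full RS)|apply/(has_type_nil RS)].
  have := cardsC S; rewrite card_ord => cSC.
  exists (Typ [:: TA #|S|.-1], Typ [:: TA #|~: S|.-1]).
    by right; exists #|S|.-1, #|~: S|.-1; split=> //; lia.
  have [pP pQ _ _] := PQ; split=> //; left; rewrite PE QE in pP pQ *.
  by split; split=> //; apply: diff_type; lia.
have [m [l [_ ->]]] := Lok _ Lc; have [m' [l' [_ ->]]] := Lok _ Lc'.
move=> /= dP dQ; split=> dP' dQ'; congr (_, _).
- exact: labA_inj dP dP'.
- exact: labA_inj dQ dQ'.
- exact: labA_inj dQ dP'.
exact: labA_inj dP dQ'.
Qed.

End SymmetricGroup.

Lemma typeA_classification (R : realType) (gT : finGroupType) (W : {group gT}) (d : nat)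
    (rG : mx_representation R W d) n (s : 'I_n -> gT) : mx_faithful rG -> (0 < n)%N ->
  @simple_system R gT W d rG (cox_diagram (TA n)) s W ->
  classified_by rG s (concept_list (TA n)).
Proof.
move=> W_faithful n0 ss; have [a [fa aa sP WE]] := ss.
pose r2 : R := Num.sqrt 2; have r20 : r2 != 0 := r2_neq0 R.
pose b i := r2 *: a i; pose A k := if insub k is Some i then b i else 0.
have AE (i : 'I_n) : A i = b i by rewrite /A valK.
have cA : cartan_chain n A.
  move=> i j iN jN; rewrite (AE (Ordinal iN)) (AE (Ordinal jN)) /b dotZl dotZr mulrA r2_sqr.
  have -> : dot (a (Ordinal iN)) (a (Ordinal jN)) =
      - cos (pi / (cox_entry (cox_diagram (TA n)) i.+1 j.+1)%:R) by apply: aa.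
  rewrite entryA //; have [->|ij] := eqVneq i j.
    by rewrite divr1 cospi !ltn_eqF //=; ring.
  have [ji|ji] := eqVneq j i.+1.
    rewrite cos_pi3 (_ : (i == j.+1 :> nat) = false); last by apply/eqP; lia.
    by rewrite /=; field.
  have [ij'|ij'] := eqVneq i j.+1; last by rewrite cos_pihalf /=; ring.
  by rewrite cos_pi3 /=; field.
pose f (i : 'I_n.+1) := tails n A 0 i.
have fD (i j : 'I_n.+1) : (i <= j)%N ->
    f i - f j = \sum_(k < n) (i <= k < j)%:R *: b k.
  move=> ij; have jn : (j <= n)%N by rewrite -ltnS.
  rewrite /f /tails !add0r (big_cat_nat ij jn) /= addrK.
  rewrite (big_nat_widen _ _ _ _ _ jn) (big_nat_widenl _ 0) // big_mkord big_mkcond /=.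
  apply: eq_bigr => k _; rewrite AE andbC.
  by case: ifP; rewrite ?scale1r ?scale0r.
have gram i j k l : dot (f i - f j) (f k - f l) =
    (i == k)%:R - (i == l)%:R - (j == k)%:R + (j == l)%:R.
  have le (x : 'I_n.+1) : (x <= n)%N by rewrite -ltnS.
  by rewrite (tails_diff cA) // => m mn; rewrite dot0l.
have b_f (i : 'I_n) : b i = f (widen_ord (leqnSn n) i) - f (lift ord0 i).
  rewrite /f lift0 /= (tails_step A 0 (ltn_ord i)) AE addrK //.
have inj (i : 'I_n) : widen_ord (leqnSn n) i != lift ord0 i.
  by apply/eqP => /(congr1 val) /=; rewrite /bump /=; lia.
apply: (typeA_classified gram n0 b_f _ ss); split=> //.
- by move=> i; case: (sP i).
- by move=> i; case: (sP i) => _ ->; rewrite reflmxZ.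
- exact: row_free_scale.
- by move=> i; rewrite b_f; exists (widen_ord (leqnSn n) i), (lift ord0 i); rewrite !inE.
- by move=> v [i [j [_ _ ij ->]]]; apply: diff_neq0.
- move=> v i [k [l [_ _ kl ->]]]; rewrite b_f (diff_refl gram) //; eexists; eexists.
  by split; last reflexivity; rewrite ?inE // (inj_eq perm_inj).
- move=> v [i [j [_ _ ij ->]]].
  have pos (x y : 'I_n.+1) : (x <= y)%N -> exists2 c : 'rV[R]_n,
      f x - f y = c *m \matrix_i b i & forall i, 0 <= c 0 i.
    move=> xy; exists (\row_k (x <= k < y)%:R) => [|k]; last by rewrite mxE ler0n.
    rewrite fD // mulmx_sum_row; apply: eq_bigr => k _; by rewrite mxE rowK.
  have [ij'|ij'] := leqP i j; first by have [c E c0] := pos i j ij'; exists c; auto.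
  have [c E c0] := pos j i (ltnW ij'); exists (- c); first by rewrite mulNmx -E opprB.
  by right=> k; rewrite mxE oppr_le0.
move=> i x [k [l [_ _ kl]]]; rewrite b_f => E.
exact: (diff_scale gram (inj i) kl (esym E)).
Qed.

Theorem theorem3p13 (R : realType) (gT : finGroupType) (W : {group gT})
    (d : nat) (rG : mx_representation R W d)
    (X : cox_type) (s : 'I_(cox_rank X) -> gT)
    (X_irr : irr_cox_type X) (W_refl : reflection_group rG)
    (W_type : @simple_system R gT W d rG (cox_diagram X) s W) :
  classified_by rG s (concept_list X).
Proof.
have [W_faithful _] := W_refl.
case: X s X_irr W_type => [n|n|n|n||n|m] s X_irr W_type.
- exact: typeA_classification.
- exact: typeB_classification.
- exact: typeD_classification.
- move: s W_type; rewrite /= !inE in X_irr.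
  case/or3P: X_irr => /eqP -> s W_type.
  + exact (check_classified W_faithful W_type check_E6).
  + exact (check_classified W_faithful W_type check_E7).
  exact (check_classified W_faithful W_type check_E8).
- exact (check_classified W_faithful W_type check_F4).
- move: s W_type; rewrite /= !inE in X_irr.
  case/orP: X_irr => /eqP -> s W_type.
  + exact (check_classified W_faithful W_type check_H3).
  exact (check_classified W_faithful W_type check_H4).
by apply: typeI_classification; rewrite // (ltn_trans _ X_irr).
Qed.
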